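(* For the integration problem $S(f,\rho)$ defined over $\mathcal{F}^{\mathrm{L}}_p(rB^d)$ with $r>0$, $\mathrm{L}\ge 0$ and $p\in(2,\infty]$ we have $$\mathrm{comp}(\varepsilon,d,\mathcal{F}^{\mathrm{L}}_p(rB^d)) \leq (d+1)\max\{r^2\, \mathrm{L}^2,d+1\} \cdot \left[ 4.8\cdot 10^6\, \varepsilon^{-2}+ 1.2\cdot 10^{6} \cdot \begin{cases} \frac{p}{p-2}\left( \mathrm{L}\, r + 0.5\log \frac{32p}{p-2} \right), & p\in(2,4)\\ 2 \mathrm{L}\, r + 4.16, & p\in[4,\infty] \end{cases} \right]$$ for all $\varepsilon\in(0,1)$ and $d\in \mathbb{N}$.
   Context: $rB^d$ is the closed Euclidean ball of radius $r$ around $0$ in $\mathbb{R}^d$; $\|\cdot\|_{\mathrm E}$ is the Euclidean norm. For $D=rB^d$, $\mathcal{R}^{\mathrm{L}}(D)$ is the set of strictly positive log-concave functions $\rho:D\to(0,\infty)$ (i.e. $\rho(\lambda x+(1-\lambda)y)\ge\rho(x)^\lambda\rho(y)^{1-\lambda}$ for $x,y\in D$, $0<\lambda<1$) with $|\log\rho(x)-\log\rho(y)|\le \mathrm{L}\|x-y\|_{\mathrm E}$ for all $x,y\in D$. Put $\pi_\rho(A)=\int_A\rho\,dx/\int_D\rho\,dx$ and $$S(f,\rho)=\frac{\int_D f(x)\rho(x)\,dx}{\int_D\rho(x)\,dx}=\int_D f\,d\pi_\rho .$$ $\mathcal{F}^{\mathrm{L}}_p(D)=\{(f,\rho)\mid\rho\in\mathcal{R}^{\mathrm{L}}(D),\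 \|f\|_p\le1\}$ with $\|f\|_p$ the norm of $L_p(D,\pi_\rho)$. Complexity: oracles return function values, $\mathrm{Or}_f(x)=f(x)$ and $\mathrm{Or}_\rho(x)=\rho(x)$ for $x\in D$. $\mathrm{Alg}_n$ is the class of all randomized algorithms using at most $n$ calls of $\mathrm{Or}_f$ and $n$ calls of $\mathrm{Or}_\rho$: $A_n(f,\rho)=\phi_{2n}(\mathrm{Or}_f(X_1),\dots,\mathrm{Or}_f(X_n),\mathrm{Or}_\rho(X_1),\dots,\mathrm{Or}_\rho(X_n))$ with a function $\phi_{2n}:\mathbb{R}^{2n}\to\mathbb{R}$, where, for a random element $\omega=(\omega_1,\dots,\omega_n)$ with some distribution $W$, $X_1=X_1(\omega_1)$ and $X_i=X_i(\mathrm{Or}_f(X_1),\dots,\mathrm{Or}_f(X_{i-1}),\mathrm{Or}_\rho(X_1),\dots,\mathrm{Or}_\rho(X_{i-1}),\omega_i)$ for $i\ge2$ are points of $D$ (adaptive sampling; not all available oracle calls need be used). The error is $e(A_n,(f,\rho))=(\mathbf E|S(f,\rho)-A_n(f,\rho)|^2)^{1/2}$, $e(A_n,\mathcal F)=\sup_{(f,\rho)\in\mathcal F}e(A_n,(f,\rho))$, and $$\mathrm{comp}(\varepsilon,d,\mathcal F)=\min\{n\mid\text{there exists }A_n\in\mathrm{Alg}_n\text{ with }e(A_n,\mathcal F)\le\varepsilon\}.$$ *)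

(* Defs.v *)
From HB Require Import structures.
From mathcomp Require Import all_boot all_order all_algebra.
From mathcomp Require Import all_classical all_reals all_analysis.
From mathcomp Require Import measurable_realfun.
From mathcomp Require Import ring lra.
Set Implicit Arguments.
Unset Strict Implicit.
Unset Printing Implicit Defensive.
Import Order.TTheory GRing.Theory Num.Theory.
Local Open Scope classical_set_scope.
Local Open Scope ring_scope.

Section lebesgue_step.
Context (R : realType) (n : nat).
Variable m : {sigma_finite_measure set (n.-tuple R) -> \bar R}.

Definition consp (xt : measurableTypeR R * n.-tuple R) : n.+1.-tuple R :=
  [tuple of xt.1 :: xt.2].

Lemma measurable_consp : measurable_fun setT consp.
Proof. exact: measurable_cons measurable_fst measurable_snd. Qed.

(* The image of the product measure under [R * R^n -> R^(n+1)]. *)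
Definition lebesgue_cons : set (n.+1.-tuple R) -> \bar R :=
  pushforward (lebesgue_measure \x m)%E consp.

Let lebesgue_cons0 : lebesgue_cons set0 = 0%E.
Proof. by rewrite /lebesgue_cons /pushforward preimage_set0 measure0. Qed.

Let lebesgue_cons_ge0 A : (0 <= lebesgue_cons A)%E.
Proof. exact: (measure_ge0 (lebesgue_measure \x m)%E). Qed.

Let measurable_preim_consp (A : set (n.+1.-tuple R)) :
  measurable A -> measurable (consp @^-1` A).
Proof. by move=> mA; rewrite -[X in measurable X]setTI; exact: measurable_consp. Qed.

Let lebesgue_cons_sigma_additive : semi_sigma_additive lebesgue_cons.
Proof.
move=> F mF tF mUF; rewrite /lebesgue_cons /pushforward preimage_bigcup.
apply: measure_semi_sigma_additive.
- by move=> i; exact: measurable_preim_consp.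
- apply/trivIsetP => /= i j _ _ ij; rewrite -preimage_setI.
  by move/trivIsetP : tF => /(_ _ _ _ _ ij) ->//; rewrite preimage_set0.
- by rewrite -preimage_bigcup; exact: measurable_preim_consp.
Qed.

HB.instance Definition _ := isMeasure.Build _ _ _ lebesgue_cons
  lebesgue_cons0 lebesgue_cons_ge0 lebesgue_cons_sigma_additive.

Let lebesgue_cons_sigma_finite : sigma_finite setT lebesgue_cons.
Proof.
have [F [TF ndF Foo]] := (sigma_finiteP _ _).1
  (sigma_finiteT (@lebesgue_measure R)).
have [G [TG ndG Goo]] := (sigma_finiteP _ _).1 (sigma_finiteT m).
pose g (t : n.+1.-tuple R) : measurableTypeR R * n.-tuple R :=
  (thead t, [tuple of behead t]).
have mg : measurable_fun setT g.
  apply/measurable_fun_pair; last exact: measurable_behead.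
  exact: measurable_tnth.
have gK x : g (consp x) = x.
  case: x => x t; congr (_, _) => /=; exact/val_inj.
exists (fun i => g @^-1` (F i `*` G i)).
  rewrite -preimage_bigcup -[LHS](preimage_setT g); congr (_ @^-1` _).
  apply/seteqP; split=> // -[x y] _.
  have [i _ Fix] : (\bigcup_i F i) x by rewrite -TF.
  have [j _ Gjy] : (\bigcup_j G j) y by rewrite -TG.
  exists (maxn i j) => //; split.
    by move: Fix; exact/subsetPset/ndF/leq_maxl.
  by move: Gjy; exact/subsetPset/ndG/leq_maxr.
move=> i; have [mFi Fioo] := Foo i; have [mGi Gioo] := Goo i; split.
  by rewrite -[X in measurable X]setTI; apply: mg => //; exact: measurableX.
rewrite /lebesgue_cons /pushforward -comp_preimage.
rewrite (_ : g \o consp = id); last by apply/funext => x; exact: gK.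
by rewrite preimage_id product_measure1E// lte_mul_pinfty// ge0_fin_numE.
Qed.

HB.instance Definition _ := Measure_isSigmaFinite.Build _ _ _ lebesgue_cons
  lebesgue_cons_sigma_finite.

End lebesgue_step.

(* d-dimensional Lebesgue measure on the product sigma-algebra of [d.-tuple R],
   as the iterated product of the one-dimensional one. *)
Fixpoint lebesgue (R : realType) (d : nat) :
    {sigma_finite_measure set (d.-tuple R) -> \bar R} :=
  match d with
  | 0 => dirac [tuple]
  | d'.+1 => lebesgue_cons (lebesgue R d')
  end.

Section euclid.
Context (R : realType) (d : nat).
Implicit Types (x y : d.-tuple R) (D : set (d.-tuple R)).

Definition enorm x : R := Num.sqrt (\sum_(i < d) tnth x i ^+ 2).

Definition vsub x y : d.-tuple R := [tuple tnth x i - tnth y i | i < d].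

Definition vconv (l : R) x y : d.-tuple R :=
  [tuple l * tnth x i + (1 - l) * tnth y i | i < d].

Definition eball (r : R) : set (d.-tuple R) := [set x | enorm x <= r].

Definition log_concave D (rho : d.-tuple R -> R) :=
  forall x y l, D x -> D y -> 0 < l < 1 ->
    rho x `^ l * rho y `^ (1 - l) <= rho (vconv l x y).

Definition log_lipschitz D (L : R) (rho : d.-tuple R -> R) :=
  forall x y, D x -> D y ->
    `|ln (rho x) - ln (rho y)| <= L * enorm (vsub x y).

Definition RL (L : R) D : set (d.-tuple R -> R) :=
  [set rho | [/\ forall x, D x -> 0 < rho x,
                 log_concave D rho & log_lipschitz D L rho]].

Lemma measurable_eball r : measurable (eball r).
Proof.
have mE : measurable_fun setT enorm.
  apply: (@measurableT_comp _ _ _ _ _ _ (@Num.sqrt R)).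
    by apply: continuous_measurable_fun => x; exact: sqrt_continuous.
  apply: measurable_sum => i.
  apply: (@measurableT_comp _ _ _ _ _ _ (fun z : R => z ^+ 2)) => //.
  exact: measurable_tnth.
rewrite (_ : eball r = enorm @^-1` `]-oo, r]); last first.
  by apply/seteqP; split=> x /=; rewrite in_itv.
by rewrite -[X in measurable X]setTI; exact: mE.
Qed.

Let box (q : d.-tuple rat) (k : nat) : set (d.-tuple R) :=
  [set x | forall i, `|tnth x i - ratr (tnth q i)| < k.+1%:R^-1].

Let measurable_box q k : measurable (box q k).
Proof.
rewrite (_ : box q k = \bigcap_(i in [set: 'I_d])
  ((fun x => tnth x i) @^-1` [set z | `|z - ratr (tnth q i)| < k.+1%:R^-1])).
  apply: fin_bigcap_measurable => // i _.
  rewrite -[X in measurable X]setTI; apply: measurable_tnth => //.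
  rewrite (_ : mkset _ = `](ratr (tnth q i) - k.+1%:R^-1),
      (ratr (tnth q i) + k.+1%:R^-1)[%classic) //.
  by apply/seteqP; split=> z /=; rewrite in_itv/= ltr_distl.
by apply/seteqP; split=> x h i; [move=> _; exact: h|exact: (h i I)].
Qed.

Let enorm_le (x : d.-tuple R) (e : R) : 0 <= e ->
  (forall i, `|tnth x i| <= e) -> enorm x <= d.+1%:R * e.
Proof.
move=> e0 xe; rewrite /enorm -[leRHS]ger0_norm ?mulr_ge0// -sqrtr_sqr.
apply: ler_wsqrtr; apply: (@le_trans _ _ (\sum_(i < d) e ^+ 2)).
  by apply: ler_sum => i _; rewrite -real_normK ?num_real// ler_pXn2r ?nnegrE.
rewrite sumr_const card_ord -[leLHS]mulr_natl exprMn.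
apply: ler_wpM2r; first exact: sqr_ge0.
by rewrite -natrX ler_nat (leq_trans (leqnSn d))// leq_pmulr.
Qed.

(* Log-Lipschitz densities are automatically measurable, so [RL] does not
   require it. *)
Lemma measurable_RL (L : R) D rho : measurable D -> RL L D rho ->
  measurable_fun D rho.
Proof.
wlog L0 : L / 0 <= L => [hw mD [rho0 rhoc rhoL]|mD [rho0 _ rhoL]].
  apply: (hw `|L|) => //; split=> // x y Dx Dy.
  apply: (le_trans (rhoL _ _ Dx Dy)).
  by rewrite ler_wpM2r ?ler_norm ?sqrtr_ge0.
have mln : measurable_fun D (@ln R \o rho).
  apply: (measurability _ (RGenOInfty.measurableE R)) => //.
  move=> _ [_ [a ->] <-].
  set U := D `&` _.
  pose P (qk : d.-tuple rat * nat) := D `&` box qk.1 qk.2 `<=` U.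
  pose F qk := if `[< P qk >] then D `&` box qk.1 qk.2 else set0.
  rewrite (_ : U = \bigcup_qk F qk).
    apply: countable_bigcupT_measurable; first exact: countableP.
    move=> qk; rewrite /F.
    by case: ifP => // _; exact: measurableI.
  apply/seteqP; split=> [x Ux|x [qk _]]; last first.
    by rewrite /F; case: asboolP => // p; exact: p.
  have [Dx /=] := Ux; rewrite in_itv/= andbT -subr_gt0 => gx.
  set g := ln (rho x) - a in gx.
  have c1 : 0 < 2 * (L + 1) * d.+1%:R.
    by rewrite !mulr_gt0// ltr_wpDl.
  have c0 : 0 < g / (2 * (L + 1) * d.+1%:R) by rewrite divr_gt0.
  have [k kc] : exists k, k.+1%:R^-1 < g / (2 * (L + 1) * d.+1%:R).
    exists (Num.truncn (g / (2 * (L + 1) * d.+1%:R))^-1).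
    rewrite invf_plt ?posrE//; exact: truncnS_gt.
  have qE i : exists q : rat, `|tnth x i - ratr q| < k.+1%:R^-1.
    have k0 : 0 < k.+1%:R^-1 :> R by rewrite invr_gt0.
    have : tnth x i - k.+1%:R^-1 < tnth x i + k.+1%:R^-1 by rewrite ltrD2l gtrN.
    move=> /rat_in_itvoo[q].
    by rewrite in_itv/= -ltr_distl distrC => ?; exists q.
  have [q qx] := choice qE.
  exists ([tuple q i | i < d], k) => //.
  have xB : box [tuple q i | i < d] k x by move=> i; rewrite tnth_mktuple.
  rewrite /F; case: asboolP => [_|[]]; first by split.
  move=> y [Dy yB]; split => //=; rewrite in_itv/= andbT -subr_gt0.
  have : `|ln (rho x) - ln (rho y)| < g.
    apply: (le_lt_trans (rhoL _ _ Dx Dy)).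
    apply: (@le_lt_trans _ _ (L * (d.+1%:R * (2 * k.+1%:R^-1)))).
      apply: ler_wpM2l => //; apply: enorm_le => [|i]; first by rewrite mulr_ge0.
      rewrite tnth_mktuple -(subrKA (ratr (q i))) (le_trans (ler_normD _ _))//.
      rewrite mulr_natl mulr2n lerD//; first exact/ltW/qx.
      by rewrite distrC ltW//; have := yB i; rewrite tnth_mktuple.
    move: kc; rewrite ltr_pdivlMr// => kc.
    apply: le_lt_trans kc; set a1 := k.+1%:R^-1; set D1 := d.+1%:R.
    have a10 : 0 <= a1 by rewrite invr_ge0.
    have D10 : 0 <= D1 by rewrite ler0n.
    rewrite (_ : L * _ = a1 * (2 * L * D1)); last by ring.
    apply: ler_wpM2l => //; apply: ler_wpM2r => //.
    by apply: ler_wpM2l => //; rewrite lerDl.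
  by rewrite ltr_norml => /andP[_]; rewrite /g; lra.
apply: (@eq_measurable_fun _ _ _ _ _ (@expR R \o (@ln R \o rho))).
  by move=> x /[!inE] Dx /=; rewrite lnK// posrE; exact: rho0.
by apply: measurableT_comp.
Qed.
End euclid.

Section target_distribution.
Context (R : realType) (d : nat) (r L : R) (rho : d.-tuple R -> R).
Local Notation D := (@eball R d r).

(* The unused argument records that [rho] is admissible, which is what makes
   this set function a measure. *)
Definition pi_measure (_ : RL L D rho) : set (d.-tuple R) -> \bar R :=
  fun A => ((\int[lebesgue R d]_(x in A `&` D) (rho x)%:E) *
            ((\int[lebesgue R d]_(x in D) rho x)%R^-1)%:E)%E.

Variable rhoP : RL L D rho.

Let mass_ge0 : 0 <= (\int[lebesgue R d]_(x in D) rho x)^-1.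
Proof.
rewrite invr_ge0 Rintegral_ge0// => x Dx.
by case: rhoP => rho0 _ _; rewrite ltW// rho0.
Qed.

Let rho_ge0 A x : (A `&` D) x -> (0 <= (rho x)%:E)%E.
Proof. by case: rhoP => rho0 _ _ [_ /rho0]; rewrite lee_fin => /ltW. Qed.

Let pi_measure0 : pi_measure rhoP set0 = 0%E.
Proof. by rewrite /pi_measure set0I integral_set0 mul0e. Qed.

Let pi_measure_ge0 A : (0 <= pi_measure rhoP A)%E.
Proof.
by rewrite mule_ge0 ?lee_fin//; apply: integral_ge0 => x; exact: rho_ge0.
Qed.

Let pi_measure_sigma_additive : semi_sigma_additive (pi_measure rhoP).
Proof.
move=> F mF tF mUF; rewrite /pi_measure setI_bigcupl.
have mD : measurable D := measurable_eball r.
have mFD k : measurable (F k `&` D) by exact: measurableI.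
have tFD : trivIset setT (fun k => F k `&` D) by exact: trivIset_setIr.
rewrite ge0_integral_bigcup//.
- rewrite [X in X @ _ --> _](_ : _ = (fun n =>
    (\sum_(0 <= k < n) \int[lebesgue R d]_(x in F k `&` D) (rho x)%:E) *
    ((\int[lebesgue R d]_(x in D) rho x)%R^-1)%:E)%E); last first.
    apply/funext => n; rewrite ge0_sume_distrl// => k _.
    by apply: integral_ge0 => x; exact: rho_ge0.
  apply: cvgeZr => //; apply: is_cvg_ereal_nneg_natsum_cond => k _ _.
  by apply: integral_ge0 => x; exact: rho_ge0.
- apply/measurable_EFinP; apply: (measurable_funS mD); last first.
    exact: measurable_RL mD rhoP.
  by apply: bigcup_sub => k _ x [].
- by move=> x [k _]; exact: rho_ge0.
Qed.

HB.instance Definition _ := isMeasure.Build _ _ _ (pi_measure rhoP)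
  pi_measure0 pi_measure_ge0 pi_measure_sigma_additive.

End target_distribution.

Section integration_problem.
Context (R : realType) (d : nat).
Local Notation Rd := (d.-tuple R).

Definition Sint (r : R) (f rho : Rd -> R) : R :=
  (\int[lebesgue R d]_(x in eball r) (f x * rho x)) /
  (\int[lebesgue R d]_(x in eball r) rho x).

(* Functions on the ball are represented by total functions whose values
   outside the ball are irrelevant; [f \_ D] is [f] with a constant value
   outside [D], a set that [pi_measure] does not charge. *)
Definition F_class (L : R) (p : \bar R) (r : R) :
    set ((Rd -> R) * (Rd -> R)) :=
  [set frho | exists rhoP : RL L (eball r) frho.2,
     measurable_fun (eball r) frho.1 /\
     ('N[pi_measure rhoP]_p[EFin \o (frho.1 \_ (eball r))] <= 1)%E].

(* [seed] is a common value space for omega_1, ..., omega_n (different spaces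
   can be embedded in their product), [law] is the joint distribution W of
   (omega_1, ..., omega_n), and the components need not be independent.
   [query i a b s] is the point X_(i+1) after the [i] values [a] of f and the
   [i] values [b] of rho; only the indices i < n are ever run. An algorithm
   using fewer oracle calls ignores some of the answers. *)
Record algorithm (n : nat) := Algorithm {
  seed_display : measure_display;
  seed : measurableType seed_display;
  law : probability (n.-tuple seed) R;
  query : forall i : nat, i.-tuple R -> i.-tuple R -> seed -> Rd;
  output : n.-tuple R -> n.-tuple R -> R
}.

Section run.
Context (n : nat) (A : algorithm n) (f rho : Rd -> R).
Implicit Type w : n.-tuple (seed A).

Fixpoint answers w (i : nat) : i.-tuple R * i.-tuple R :=
  match i with
  | 0 => ([tuple], [tuple])
  | j.+1 =>
    let a := answers w j in
    let x := @query n A j a.1 a.2 (nth point w j) in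
    ([tuple of rcons a.1 (f x)], [tuple of rcons a.2 (rho x)])
  end.

Definition sample w (i : nat) : Rd :=
  @query n A i (answers w i).1 (answers w i).2 (nth point w i).

Definition run w : R := @output n A (answers w n).1 (answers w n).2.

End run.

(* [F] only enters through the measurability that makes the sample points and
   the output random variables, so that the expectation below makes sense;
   no measurability of [query] and [output] themselves is imposed. *)
Definition Alg (r : R) (F : set ((Rd -> R) * (Rd -> R))) n
    (A : algorithm n) : Prop :=
  (forall i (a b : i.-tuple R) s, eball r (@query n A i a b s)) /\
  (forall f rho, F (f, rho) ->
     (forall i, (i < n)%N -> measurable_fun setT (fun w => @sample n A f rho w i)) /\
     measurable_fun setT (@run n A f rho)).

Definition error (r : R) n (A : algorithm n) (f rho : Rd -> R) : \bar R :=
  ((\int[law A]_w (`|Sint r f rho - @run n A f rho w| ^+ 2)%:E) `^ 2^-1)%E.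

Definition max_error (r : R) n (A : algorithm n)
    (F : set ((Rd -> R) * (Rd -> R))) : \bar R :=
  ereal_sup [set error r A frho.1 frho.2 | frho in F].

(* The infimum of a nonempty set of natural numbers is its minimum; it is +oo
   when no algorithm reaches the accuracy [eps]. *)
Definition complexity (eps : R) (r : R) (F : set ((Rd -> R) * (Rd -> R))) : \bar R :=
  ereal_inf [set n%:R%:E | n in [set n |
    exists A : algorithm n, Alg r F A /\ (max_error r A F <= eps%:E)%E]].

End integration_problem.

(* Main.v *)
(* The integral is approximated by the average of f along a lazy Metropolis chain,
   started uniformly on the ball, whose proposals are x + u with u distributed
   according to a product of squared tent functions of width
   eta = r / (4 sqrt K), where K = (d + 1) max (r^2 L^2, d + 1). Each step costs
   two oracle calls.

   The spectral gap of the chain is of order 1 / K. The density rho times a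
   Gaussian factor satisfies a strengthened log-concavity at midpoints, and
   Prekopa-Leindler applied to the triple (1 + e g) rt, ((1 + e g)^2 - e^2 Q) rt
   and rt bounds the variance of g by the integral of Q as soon as Q dominates a
   difference quotient of g. Applied to the average g of f over one proposal,
   whose increments are controlled by the Hellinger distance of shifted step
   kernels, this gives a Poincare inequality with the Dirichlet form of the
   proposal kernel. The local conductance of the ball is bounded below by an
   anticoncentration estimate, and the Lipschitz condition on log rho keeps the
   acceptance probability away from 0.

   The autocovariances of a function in L_2 then decay geometrically, and
   Young's inequality interpolates between the L_2 decay of the initial density
   and its uniform bound exp (2 L r) to control the bias of the squared function
   when f is only in L_p. *)

Require Import Defs.
From HB Require Import structures.
From mathcomp Require Import all_boot all_order all_algebra.
From mathcomp Require Import all_classical all_reals all_analysis.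
From mathcomp Require Import measurable_realfun.
From mathcomp Require Import ring lra.
Set Implicit Arguments.
Unset Strict Implicit.
Unset Printing Implicit Defensive.
Import Order.TTheory GRing.Theory Num.Theory numFieldNormedType.Exports.
Local Open Scope classical_set_scope.
Local Open Scope ring_scope.

(** * Lebesgue measure on tuples *)

(** The integrand is merely measurable, so no gradient is available. Prekopa-Leindler is therefore
    applied to the average of [f] over one proposal, and the distance from [f] to this average is
    itself controlled by the Dirichlet form. Log-concavity alone gives no gain at midpoints; the
    factor exp (- |x|^2 / (2 r^2)) produces the gain 1 + |x - y|^2 / (4 r^2) and stays above 9/16 on
    the ball, so removing it costs only a constant. The step size meets two demands at once: d eta
    <= r / 4 keeps the local conductance above 1/8 at every point of the ball, and L eta sqrt d <=
    1/4 keeps the ratio of the densities over one step below 4/3. Laziness makes the transition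
    operator positive, so that powers of it can be split evenly between both sides of an inner
    product and all autocovariances are summable. The constants multiply to a spectral gap 1 /
    (208000 K) and a squared error 9 / (gap N) after burn-in; the slack left in the final constants
    absorbs the rounding of both lengths to integers. *)

Section lebesgue_tuple.
Context (R : realType).

Lemma consp_eta d (x : d.+1.-tuple R) :
  x = consp (thead x, [tuple of behead x]).
Proof. by rewrite [LHS]tuple_eta; exact/val_inj. Qed.

Lemma tnth_consp0 d s (x : d.-tuple R) : tnth (consp (s, x)) ord0 = s.
Proof. by []. Qed.

Lemma tnth_conspS d s (x : d.-tuple R) i :
  tnth (consp (s, x)) (lift ord0 i) = tnth x i.
Proof. by rewrite tnthS; congr tnth; exact/val_inj. Qed.

Lemma eq_consp d s (x : d.-tuple R) (y : d.+1.-tuple R) :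
  tnth y ord0 = s -> (forall i, tnth y (lift ord0 i) = tnth x i) ->
  y = consp (s, x).
Proof.
move=> y0 yS; apply: eq_from_tnth => i.
have [j ->|->] := unliftP ord0 i; last by rewrite tnth_consp0.
by rewrite tnth_conspS.
Qed.

Definition vadd d (x y : d.-tuple R) : d.-tuple R :=
  [tuple tnth x i + tnth y i | i < d].

Lemma vadd_consp d s t (x y : d.-tuple R) :
  vadd (consp (s, x)) (consp (t, y)) = consp (s + t, vadd x y).
Proof.
apply: eq_consp => [|i]; rewrite ?tnth_mktuple// ?tnth_mktuple.
by rewrite !tnth_conspS.
Qed.

Lemma vsub_consp d s t (x y : d.-tuple R) :
  vsub (consp (s, x)) (consp (t, y)) = consp (s - t, vsub x y).
Proof.
apply: eq_consp => [|i]; rewrite ?tnth_mktuple// ?tnth_mktuple.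
by rewrite !tnth_conspS.
Qed.

Lemma vconv_consp d l s t (x y : d.-tuple R) :
  vconv l (consp (s, x)) (consp (t, y)) =
  consp (l * s + (1 - l) * t, vconv l x y).
Proof.
apply: eq_consp => [|i]; rewrite ?tnth_mktuple// ?tnth_mktuple.
by rewrite !tnth_conspS.
Qed.

Lemma vaddK d (x y : d.-tuple R) : vsub (vadd x y) x = y.
Proof. by apply: eq_from_tnth => i; rewrite !tnth_mktuple addrC addKr. Qed.

Section measurable.
Context dd (T : measurableType dd) (d : nat).
Implicit Types f g : T -> d.-tuple R.

Lemma measurable_tnth_comp f i : measurable_fun setT f ->
  measurable_fun setT (fun z => tnth (f z) i).
Proof. by move=> mf; move/measurable_fun_tnthP : mf => /(_ i). Qed.

Lemma measurable_vadd f g : measurable_fun setT f -> measurable_fun setT g ->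
  measurable_fun setT (fun z => vadd (f z) (g z)).
Proof.
move=> mf mg; apply/measurable_fun_tnthP => i.
rewrite (_ : _ \o _ = fun z => tnth (f z) i + tnth (g z) i); last first.
  by apply/funext => z /=; rewrite tnth_mktuple.
by apply: measurable_funD; exact: measurable_tnth_comp.
Qed.

Lemma measurable_vsub f g : measurable_fun setT f -> measurable_fun setT g ->
  measurable_fun setT (fun z => vsub (f z) (g z)).
Proof.
move=> mf mg; apply/measurable_fun_tnthP => i.
rewrite (_ : _ \o _ = fun z => tnth (f z) i - tnth (g z) i); last first.
  by apply/funext => z /=; rewrite tnth_mktuple.
by apply: measurable_funB; exact: measurable_tnth_comp.
Qed.

End measurable.

Lemma measurable_consp2 dd (T : measurableType dd) d (f : T -> R)
    (g : T -> d.-tuple R) :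
  measurable_fun setT f -> measurable_fun setT g ->
  measurable_fun setT (fun z => consp (f z, g z)).
Proof. by move=> mf mg; exact: measurable_cons. Qed.

Local Open Scope ereal_scope.

Lemma integral_lebesgue0 (f : 0.-tuple R -> \bar R) :
  \int[lebesgue R 0]_x f x = f [tuple].
Proof.
rewrite integral_dirac// ?diracT ?mul1e//.
move=> _ Y mY; rewrite setTI.
have [fY|fY] := pselect (Y (f [tuple])).
  rewrite (_ : _ @^-1` _ = setT) //.
  by apply/seteqP; split => // x _ /=; rewrite (tuple0 x).
rewrite (_ : _ @^-1` _ = set0) //.
by apply/seteqP; split => // x /=; rewrite (tuple0 x).
Qed.

Lemma integral_lebesgueS d (f : d.+1.-tuple R -> \bar R) :
  measurable_fun setT f -> (forall x, 0 <= f x) ->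
  \int[lebesgue R d.+1]_x f x =
  \int[lebesgue_measure]_s \int[lebesgue R d]_x f (consp (s, x)).
Proof.
move=> mf f0.
pose mc := isMeasurableFun.Build _ _ _ _ _ (@measurable_consp R d).
pose c : {mfun _ >-> _} := HB.pack (@consp R d) mc.
transitivity (\int[pushforward (lebesgue_measure \x lebesgue R d) c]_x f x).
  exact: eq_measure_integral.
rewrite ge0_integral_pushforward//.
have mfc : measurable_fun setT (f \o c).
  by apply: measurableT_comp => //; exact: measurable_consp.
exact: (@fubini_tonelli1 _ _ _ _ _ lebesgue_measure (lebesgue R d) (f \o c)
  mfc (fun z => f0 _)).
Qed.

Lemma lebesgue_measureD (a : R) (A : set R) : measurable A ->
  pushforward lebesgue_measure (fun x => (a + x)%R : measurableTypeR R) A =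
  lebesgue_measure A.
Proof.
move=> mA.
have ma : measurable_fun setT (fun x : measurableTypeR R => (a + x)%R : measurableTypeR R).
  by apply: measurable_funD => //; exact: measurable_cst.
pose mfa := isMeasurableFun.Build _ _ _ _ _ ma.
pose fa : {mfun _ >-> _} := HB.pack (fun x : measurableTypeR R => (a + x)%R : measurableTypeR R) mfa.
pose mu : {measure set (measurableTypeR R) -> \bar R} :=
  pushforward lebesgue_measure fa.
refine (esym (@lebesgue_measure_unique R (mu ma) _ A mA)).
move=> _ [[u v] _ <-]; transitivity (@lebesgue_measure R `](u - a)%R, (v - a)%R]%classic); last first.
  congr (lebesgue_measure _).
  by apply/seteqP; split => x /=; rewrite !in_itv/= ltrBlDl lerBrDl.
rewrite !lebesgue_measure_itv/= !lte_fin ltrD2r.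
by case: ifP => // _; rewrite -!EFinD opprB addrA subrK.
Qed.

Lemma integral_lebesgue_shift1 (a : R) (f : R -> \bar R) :
  measurable_fun setT f -> (forall x, 0 <= f x) ->
  \int[lebesgue_measure]_x f (a + x)%R = \int[lebesgue_measure]_x f x.
Proof.
move=> mf f0.
have ma : measurable_fun setT (fun x : measurableTypeR R => (a + x)%R : measurableTypeR R).
  by apply: measurable_funD => //; exact: measurable_cst.
pose mfa := isMeasurableFun.Build _ _ _ _ _ ma.
pose fa : {mfun _ >-> _} := HB.pack (fun x : measurableTypeR R => (a + x)%R : measurableTypeR R) mfa.
rewrite -[LHS]/(\int[lebesgue_measure]_(x in fa @^-1` setT) (f \o fa) x).
rewrite -(@ge0_integral_pushforward _ _ _ _ _ fa)//.
by apply: eq_measure_integral => //= A mA _; exact: lebesgue_measureD.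
Qed.

Lemma integral_lebesgue_shift d (a : d.-tuple R) (f : d.-tuple R -> \bar R) :
  measurable_fun setT f -> (forall x, 0 <= f x) ->
  \int[lebesgue R d]_x f (vadd a x) = \int[lebesgue R d]_x f x.
Proof.
elim: d => [|d IH] in a f *.
  by move=> _ _; rewrite !integral_lebesgue0 (tuple0 (vadd _ _)).
move=> mf f0.
have mfa : measurable_fun setT (fun x => f (vadd a x)).
  by apply: measurableT_comp => //; exact: measurable_vadd.
rewrite !integral_lebesgueS// [a]consp_eta.
set s := thead a; set b := [tuple of behead a].
under eq_integral => t _ do under eq_integral => x _ do rewrite vadd_consp.
under eq_integral => t _.
  rewrite (IH b (fun x => f (consp ((s + t)%R, x))))//; last first.
    by apply: measurableT_comp => //; exact: measurable_consp2.
  over.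
rewrite (@integral_lebesgue_shift1 s
  (fun t => \int[lebesgue R d]_x f (consp (t, x))))//.
- apply: (@measurable_fun_fubini_tonelli_F _ _ _ _ _ _ (f \o @consp R d)) => //.
    by apply: measurableT_comp => //; exact: measurable_consp.
  by move=> x; exact: f0.
- by move=> t; apply: integral_ge0 => x _; exact: f0.
Qed.

End lebesgue_tuple.

(** * Brunn-Minkowski and Prekopa-Leindler inequalities *)

Section brunn_minkowski1.
Context (R : realType).
Local Open Scope ereal_scope.
Notation leb := (@lebesgue_measure R).

Lemma lebesgue_measure_double (A : set R) : measurable A ->
  2%:E * leb [set x | A (2 * x)%R] = leb A.
Proof.
move=> mA.
have ma : measurable_fun setT
    (fun x : measurableTypeR R => (2 * x)%R : measurableTypeR R).
  exact: mulrl_measurable.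
pose mfa := isMeasurableFun.Build _ _ _ _ _ ma.
pose fa : {mfun _ >-> _} :=
  HB.pack (fun x : measurableTypeR R => (2 * x)%R : measurableTypeR R) mfa.
pose mu : {measure set (measurableTypeR R) -> \bar R} :=
  mscale (NngNum (ler0n R 2)) (pushforward leb fa).
apply/esym; refine (@lebesgue_measure_unique R (mu ma) _ A mA).
move=> _ [[u v] _ <-].
transitivity (2%:E * leb `](u / 2)%R, (v / 2)%R]%classic); last first.
  congr (_ * leb _).
  apply/seteqP; split => x /=; rewrite !in_itv/= ?(ltr_pdivrMr, ler_pdivlMr)//.
    by rewrite ![(x * 2)%R]mulrC.
  by rewrite ![(2 * x)%R]mulrC.
rewrite !lebesgue_measure_itv/= !lte_fin ltr_pM2r//.
case: ifP => // _; last by rewrite mule0.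
by rewrite -!EFinD -EFinM; congr (_%:E); field.
Qed.

Lemma measurable_preimage_shift (a : R) (A : set R) : measurable A ->
  measurable [set z | A (a + z)%R].
Proof.
move=> mA; rewrite -[X in measurable X]setTI.
have ma : measurable_fun setT
    (fun x : measurableTypeR R => (a + x)%R : measurableTypeR R).
  by apply: measurable_funD => //; exact: measurable_cst.
exact: (ma measurableT _ mA).
Qed.

(** With a the supremum of [A] and b the infimum of [B], the translates b + A and a + B lie in A + B
    and meet at most in a + b, so their measures add up. As the extrema need not be attained, points
    within e / 2 of them are used and the sets are cut there. Since [C] is only required to contain
    the midpoints, the possibly non-measurable set A + B never occurs. *)
Lemma brunn_minkowski1 (A B C : set R) (rho : R) :
  measurable A -> measurable B -> measurable C ->
  A !=set0 -> B !=set0 ->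
  (forall x, A x -> `|x| <= rho)%R -> (forall x, B x -> `|x| <= rho)%R ->
  (forall a b, A a -> B b -> C ((a + b) / 2))%R ->
  leb A + leb B <= 2%:E * leb C.
Proof.
move=> mA mB mC A0 B0 Arho Brho ABC; apply/lee_addgt0Pr => e e0.
have hA : has_sup A.
  by split=> //; exists rho => x /Arho; rewrite ler_norml => /andP[].
have hB : has_inf B.
  by split=> //; exists (- rho)%R => x /Brho; rewrite ler_norml => /andP[].
have lebU2 (X Y : set R) : measurable X -> measurable Y ->
  leb (X `|` Y) <= leb X + leb Y.
  by move=> mX mY; exact: (@measureU2 _ _ _ leb X Y mX mY).
have e20 : (0 < e / 2)%R by rewrite divr_gt0.
have [a Aa ae] := sup_adherent e20 hA.
have [b Bb be] := inf_adherent e20 hB.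
(* A closed ray for [A] and an open one for [B] make the translates disjoint: b + A1 lies at or to
   the left of a + b, and a + B1 strictly to the right. *)
pose A1 := A `&` [set` `]-oo, a]%R]; pose B1 := B `&` [set` `]b, +oo[%R].
have mA1 : measurable A1 by exact: measurableI.
have mB1 : measurable B1 by exact: measurableI.
have lA : leb A <= leb A1 + (e / 2)%:E.
  apply: (@le_trans _ _ (leb (A1 `|` `[a, (a + e / 2)%R]%classic))).
    apply: le_measure; rewrite ?inE//; first exact: measurableU.
    move=> x Ax; have [xa|ax] := leP x a; first by left; split.
    right; rewrite /= in_itv/= (ltW ax)/=.
    apply: (le_trans (ub_le_sup _ Ax)); first by case: hA.
    by rewrite -lerBlDr ltW.
  apply: (le_trans (lebU2 _ _ _ _)) => //.
  by rewrite leeD2l// lebesgue_measure_itv/= lte_fin ltrDl e20 -EFinD addrAC subrr add0r.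
have lB : leb B <= leb B1 + (e / 2)%:E.
  apply: (@le_trans _ _ (leb (B1 `|` `[(b - e / 2)%R, b]%classic))).
    apply: le_measure; rewrite ?inE//; first exact: measurableU.
    move=> x Bx; have [xb|bx] := leP x b; last first.
      by left; split => //=; rewrite in_itv/= bx.
    right; rewrite /= in_itv/= xb andbT.
    apply: (le_trans _ (ge_inf _ Bx)); last by case: hB.
    by rewrite lerBlDr ltW.
  apply: (le_trans (lebU2 _ _ _ _)) => //.
  rewrite leeD2l// lebesgue_measure_itv/= lte_fin ltrBlDr ltrDl e20.
  by rewrite -EFinD opprB addrCA subrr addr0.
(* [C2] is [C] stretched by 2, so it contains the sums instead of the midpoints. *)
pose C2 := [set z | C (z / 2)%R].
have mC2 : measurable C2.
  rewrite -[X in measurable X]setTI.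
  exact: (@mulrr_measurable R setT (2^-1)%R measurableT C mC).
have -> : leb C = leb [set x | C2 (2 * x)%R].
  by congr leb; apply/seteqP; split => x; rewrite /C2/= mulrC mulKf// .
rewrite lebesgue_measure_double//.
pose A2 := [set z | A1 (- b + z)%R]; pose B2 := [set z | B1 (- a + z)%R].
have mA2 : measurable A2 by exact: measurable_preimage_shift.
have mB2 : measurable B2 by exact: measurable_preimage_shift.
have -> : e%:E = (e / 2)%:E + (e / 2)%:E by rewrite -EFinD -splitr.
apply: (@le_trans _ _ (leb A1 + leb B1 + ((e / 2)%:E + (e / 2)%:E))).
  by rewrite addeACA leeD.
have eA : leb A2 = leb A1 := lebesgue_measureD (- b) mA1.
have eB : leb B2 = leb B1 := lebesgue_measureD (- a) mB1.
rewrite leeD2r// -eA -eB -measureU//; last first.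
  rewrite -subset0 => z [[_ /=] ] ; rewrite in_itv/= addrC lerBlDr => zab.
  by move=> [_ /=]; rewrite in_itv/= andbT addrC ltrBrDr addrC ltNge zab.
apply: le_measure; rewrite ?inE//; first exact: measurableU.
move=> z [[Az _]|[Bz _]]; rewrite /C2/=.
  by have := ABC _ _ Az Bb; rewrite addrAC addNr add0r.
by have := ABC _ _ Aa Bz; rewrite addrA subrr add0r.
Qed.

End brunn_minkowski1.

Lemma measurable_set_ltr (R : realType) dd (T : measurableType dd)
    (f g : T -> R) :
  measurable_fun setT f -> measurable_fun setT g ->
  measurable [set x | f x < g x].
Proof.
move=> mf mg; rewrite -[X in measurable X]setTI.
by have := measurable_fun_ltr mf mg measurableT; apply => //=.
Qed.

Lemma eq_indic (R : pzRingType) T U (A : set T) (B : set U) x y :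
  (A x <-> B y) -> \1_A x = \1_B y :> R.
Proof.
move=> AB; rewrite !indicE; congr (nat_of_bool _)%:R.
by apply/idP/idP; rewrite !inE => /AB.
Qed.

Section prekopa_leindler1.
Context (R : realType).
Local Open Scope ereal_scope.
Notation leb := (@lebesgue_measure R).

(** Levels are rescaled to the unit interval so that functions with different suprema can be
    compared level by level. The cut at [c] keeps the identity usable for a function that exceeds
    [c]. *)
Lemma layer_cake (h : R -> R) (c : R) : (0 < c)%R ->
  measurable_fun setT h -> (forall x, 0 <= h x)%R ->
  \int[leb]_x (Num.min c (h x))%:E =
  c%:E * \int[leb]_(t in `]0%R, 1%R[) leb [set x | (c * t < h x)%R].
Proof.
move=> c0 mh h0.
pose E : set (measurableTypeR R * measurableTypeR R) :=
  (`]0%R, 1%R[%classic `*` setT) `&` [set z | (c * z.1 < h z.2)%R].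
have mE : measurable E.
  apply: measurableI; first exact: measurableX.
  apply: measurable_set_ltr; last exact: measurableT_comp.
  by apply: measurable_funM; [exact: measurable_cst|exact: measurable_fst].
have m1E : measurable_fun setT (EFin \o \1_E : _ -> \bar R).
  by apply/measurable_EFinP; exact: measurable_indic.
have H0 (z : measurableTypeR R * measurableTypeR R) :
  0 <= (EFin \o (\1_E : _ -> R)) z by rewrite lee_fin.
have mGE := @measurable_fun_fubini_tonelli_G _ _ _ _ _ leb (EFin \o \1_E) m1E H0.
have -> : \int[leb]_(t in `]0%R, 1%R[) leb [set x | (c * t < h x)%R] =
    \int[leb]_t \int[leb]_x (EFin \o \1_E) (t, x).
  rewrite integral_mkcond; apply: eq_integral => t _.
  rewrite patchE; case: ifPn => [|]; rewrite ?notin_setE ?inE/= => t01.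
    transitivity (\int[leb]_x (\1_[set x | (c * t < h x)%R] x : R)%:E).
      rewrite integral_indic ?setIT//.
      by apply: measurable_set_ltr => //; exact: measurable_cst.
    apply: eq_integral => x _; congr (_%:E); apply: eq_indic.
    by split=> [ctx|[_ ctx]]; [split; [split|]|].
  apply/esym/integral0_eq => x _; rewrite /= indicE memNset//.
  by case=> -[/= t01' _] _; exact: t01.
rewrite (@fubini_tonelli _ _ _ _ _ leb leb (EFin \o \1_E) m1E H0).
rewrite -ge0_integralZl_EFin; [|exact: measurableT| |exact: mGE|exact: ltW];
  last by move=> x _; apply: integral_ge0 => t _; exact: H0.
clear mGE H0 m1E mE.
apply: eq_integral => x _.
pose b := Num.min 1%R (h x / c)%R.
have b0 : (0 <= b)%R by rewrite le_min ler01 divr_ge0// ltW.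
rewrite (_ : (fun t => _) = (fun t => (\1_(`]0%R, b[%classic) t)%:E)); last first.
  apply/funext => t; congr (_%:E); apply: eq_indic.
  rewrite /E /b/= !in_itv/= lt_min ltr_pdivlMr// [(t * c)%R]mulrC.
  split; first by move=> [[/andP[-> ->] _] ->].
  by move=> /and3P[-> -> ->].
rewrite integral_indic ?setIT; [|exact: measurableT|exact: measurable_itv].
rewrite -[X in _ * X]/(leb _) lebesgue_measure_itv/= lte_fin.
have -> : (Num.min c (h x) = c * b)%R.
  by rewrite minr_pMr ?ltW// mulr1 mulrCA divff ?mulr1// gt_eqF.
case: ifPn => [_|]; first by rewrite -EFinD subr0 -EFinM.
by rewrite -leNgt => b0'; rewrite (@le_anti _ _ b 0%R) ?b0 ?b0'// mulr0 mule0.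
Qed.

Lemma sup_lt_ex (u : R -> R) (M t : R) : (forall x, u x <= M)%R ->
  (t < sup (range u))%R -> exists x, (t < u x)%R.
Proof.
move=> uM tu; have hu : has_sup (range u).
  by split; [exists (u 0%R), 0%R|exists M => _ [x _ <-]].
have e0 : (0 < sup (range u) - t)%R by rewrite subr_gt0.
by have [_ [x _ <-]] := sup_adherent e0 hu; rewrite subKr; exists x.
Qed.

Lemma le_sup_range (u : R -> R) (M x : R) : (forall x, u x <= M)%R ->
  (u x <= sup (range u))%R.
Proof. by move=> uM; apply: ub_le_sup; [exists M => _ [y _ <-]|exists x]. Qed.

Lemma integral_bounded_support (u : R -> R) (M rho : R) :
  (0 <= rho)%R -> measurable_fun setT u -> (forall x, 0 <= u x <= M)%R ->
  (forall x, rho < `|x| -> u x = 0)%R ->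
  \int[leb]_x (u x)%:E <= (M * (2 * rho))%:E.
Proof.
move=> rho0 mu u0 us.
apply: (@le_trans _ _ (\int[leb]_(x in `[(- rho)%R, rho]) (cst M%:E) x)).
  rewrite [leRHS]integral_mkcond; apply: ge0_le_integral => //.
  - by move=> x _; rewrite lee_fin; case/andP: (u0 x).
  - exact/measurable_EFinP.
  - by apply/(measurable_restrict _ _ _).1 => //; exact: measurable_cst.
  - move=> x _; rewrite patchE; case: ifPn => [_|].
      by rewrite lee_fin; case/andP: (u0 x).
    rewrite notin_setE/= in_itv/= -ler_norml => /negP; rewrite -ltNge => /us ->.
    by [].
rewrite integral_cst//= lebesgue_measure_itv/= lte_fin.
case: ifPn => _; first by rewrite -EFinD -EFinM opprK lee_fin mulr2n mulrDl !mul1r.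
rewrite mule0 lee_fin mulr_ge0// ?mulr_ge0//.
by have /andP[+ +] := u0 0%R; exact: le_trans.
Qed.

(** Each function is scaled by its own supremum: for t < 1 the level sets of [u] above al t and of
    [v] above be t are nonempty, and their midpoints lie in the level set of [w] above ga t, where
    ga^2 = al be. Integrating Brunn-Minkowski over t bounds the arithmetic mean of the two
    normalized integrals, and the inequality of arithmetic and geometric means yields the
    product. *)
Lemma prekopa_leindler1 (u v w : R -> R) (M rho : R) :
  measurable_fun setT u -> measurable_fun setT v -> measurable_fun setT w ->
  (0 <= rho)%R ->
  (forall x, 0 <= u x <= M)%R -> (forall x, 0 <= v x <= M)%R ->
  (forall x, 0 <= w x)%R ->
  (forall x, rho < `|x| -> u x = 0)%R -> (forall x, rho < `|x| -> v x = 0)%R ->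
  (forall x y, u x * v y <= w ((x + y) / 2) ^+ 2)%R ->
  (\int[leb]_x (u x)%:E) * (\int[leb]_x (v x)%:E) <=
  (\int[leb]_x (w x)%:E) * (\int[leb]_x (w x)%:E).
Proof.
move=> mu mv mw rho0 u0 v0 w0 us vs uvw.
have w0i : 0 <= \int[leb]_x (w x)%:E by apply: integral_ge0 => x _; rewrite lee_fin.
have uM x : (u x <= M)%R by case/andP: (u0 x).
have vM x : (v x <= M)%R by case/andP: (v0 x).
have u00 x : (0 <= u x)%R by case/andP: (u0 x).
have v00 x : (0 <= v x)%R by case/andP: (v0 x).
set al := sup (range u); set be := sup (range v).
have al0 : (0 <= al)%R by rewrite (le_trans (u00 0%R))// (le_sup_range _ uM).
have be0 : (0 <= be)%R by rewrite (le_trans (v00 0%R))// (le_sup_range _ vM).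
have int0 (f : R -> R) : (forall x, 0 <= f x)%R -> (forall x, f x <= 0)%R ->
    \int[leb]_x (f x)%:E = 0.
  move=> f0 f1; apply: integral0_eq => x _; congr (_%:E).
  by apply/le_anti; rewrite f0 f1.
move: al0; rewrite le_eqVlt => /predU1P[al0|al0].
  rewrite int0 ?mul0e ?mule_ge0// => x.
  by rewrite al0; exact: (le_sup_range x uM).
move: be0; rewrite le_eqVlt => /predU1P[be0|be0].
  rewrite [X in _ * X]int0 ?mule0 ?mule_ge0// => x.
  by rewrite be0; exact: (le_sup_range x vM).
pose ga := Num.sqrt (al * be).
have ga0 : (0 < ga)%R by rewrite sqrtr_gt0 mulr_gt0.
have ga2 : (ga ^+ 2 = al * be)%R by rewrite sqr_sqrtr// mulr_ge0// ltW.
pose S (h : R -> R) (c t : R) := [set x | (c * t < h x)%R].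
pose I (h : R -> R) c := \int[leb]_(t in `]0%R, 1%R[) leb (S h c t).
have mS h c t : measurable_fun setT h -> measurable (S h c t).
  by move=> mh; apply: measurable_set_ltr => //; exact: measurable_cst.
have mI h c : measurable_fun setT h ->
    measurable_fun (`]0%R, 1%R[%classic : set R) (fun t => leb (S h c t)).
  move=> mh; apply: measurable_funTS.
  pose E : set (measurableTypeR R * measurableTypeR R) := [set z | (c * z.1 < h z.2)%R].
  have mE : measurable E.
    apply: measurable_set_ltr; last exact: measurableT_comp.
    by apply: measurable_funM => //; exact: measurable_cst.
  rewrite (_ : (fun t => leb (S h c t)) = leb \o xsection E).
    exact: measurable_fun_xsection.
  apply/funext => t /=; congr leb; apply/seteqP; split=> x.
    by rewrite /S /xsection /E /= inE.
  by rewrite /S /xsection /E /= inE.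
have I0 h c : 0 <= I h c by apply: integral_ge0.
have Iu : \int[leb]_x (u x)%:E = al%:E * I u al.
  rewrite -layer_cake//; apply: eq_integral => x _; congr (_%:E).
  by rewrite min_r// (le_sup_range x uM).
have Iv : \int[leb]_x (v x)%:E = be%:E * I v be.
  rewrite -layer_cake//; apply: eq_integral => x _; congr (_%:E).
  by rewrite min_r// (le_sup_range x vM).
(* [w] may exceed [ga], and only its part below [ga] is measured: hence an inequality. *)
have Iw : ga%:E * I w ga <= \int[leb]_x (w x)%:E.
  rewrite -layer_cake//; apply: ge0_le_integral => //.
  - by move=> x _; rewrite lee_fin le_min (ltW ga0) w0.
  - by apply/measurable_EFinP; apply: measurable_minr => //; exact: measurable_cst.
  - exact/measurable_EFinP.
  - by move=> x _; rewrite lee_fin ge_min lexx orbT.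
have Iuvw : I u al + I v be <= 2%:E * I w ga.
  rewrite -ge0_integralD//; [|exact: mI|exact: mI].
  rewrite -ge0_integralZl_EFin//; last exact: mI.
  apply: ge0_le_integral => //.
  - by move=> t _; exact: adde_ge0.
  - by apply: emeasurable_funD; exact: mI.
  - by apply: measurable_funeM; exact: mI.
  move=> t /=; rewrite in_itv/= => /andP[t0 t1].
  apply: (@brunn_minkowski1 R _ _ _ rho); [exact: mS|exact: mS|exact: mS| | | | |].
  - by apply: (sup_lt_ex uM); rewrite -/al gtr_pMr.
  - by apply: (sup_lt_ex vM); rewrite -/be gtr_pMr.
  - move=> x; rewrite /S/= => ux; rewrite leNgt; apply/negP => /us ux0.
    by move: ux; rewrite ux0 ltNge mulr_ge0// ltW.
  - move=> x; rewrite /S/= => ux; rewrite leNgt; apply/negP => /vs ux0.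
    by move: ux; rewrite ux0 ltNge mulr_ge0// ltW.
  - move=> a b; rewrite /S/= => ua vb; rewrite ltNge; apply/negP => wle.
    have := uvw a b; apply/negP; rewrite -ltNge.
    apply: (@le_lt_trans _ _ ((ga * t) ^+ 2)%R).
      by rewrite lerXn2r ?nnegrE// mulr_ge0// ltW.
    rewrite exprMn ga2.
    have -> : (al * be * t ^+ 2 = (al * t) * (be * t))%R by ring.
    by apply: ltr_pM => //; rewrite mulr_ge0// ltW.
have fu : \int[leb]_x (u x)%:E < +oo.
  by apply: le_lt_trans (integral_bounded_support rho0 mu u0 us) _; rewrite ltry.
have fv : \int[leb]_x (v x)%:E < +oo.
  by apply: le_lt_trans (integral_bounded_support rho0 mv v0 vs) _; rewrite ltry.
have u0i : 0 <= \int[leb]_x (u x)%:E by apply: integral_ge0 => x _; rewrite lee_fin.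
have v0i : 0 <= \int[leb]_x (v x)%:E by apply: integral_ge0 => x _; rewrite lee_fin.
have [woo|woo] := eqVneq (\int[leb]_x (w x)%:E) +oo.
  by rewrite woo mulyy leey.
have fIw : I w ga \is a fin_num.
  rewrite ge0_fin_numE// ltey; apply/eqP => Iy; move: Iw.
  by rewrite Iy gt0_muley ?lte_fin// leye_eq (negbTE woo).
have fIu : I u al \is a fin_num.
  rewrite ge0_fin_numE// ltey; apply/eqP => Iy; move: fu.
  by rewrite Iu Iy gt0_muley ?lte_fin// ltxx.
have fIv : I v be \is a fin_num.
  rewrite ge0_fin_numE// ltey; apply/eqP => Iy; move: fv.
  by rewrite Iv Iy gt0_muley ?lte_fin// ltxx.
apply: (@le_trans _ _ ((ga%:E * I w ga) * (ga%:E * I w ga))); last first.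
  by apply: lee_pmul => //; rewrite mule_ge0// lee_fin ltW.
rewrite Iu Iv; move: Iuvw (I0 u al) (I0 v be) (I0 w ga).
rewrite -(fineK fIu) -(fineK fIv) -(fineK fIw) -!EFinM -EFinD !lee_fin.
set a := fine _; set b := fine _; set c := fine _ => abc a0 b0 c0.
have -> : ((al * a) * (be * b) = ga ^+ 2 * (a * b))%R by rewrite ga2; ring.
have -> : ((ga * c) * (ga * c) = ga ^+ 2 * c ^+ 2)%R by ring.
apply: ler_wpM2l; first exact: sqr_ge0.
have := sqr_ge0 (a - b); nra.
Qed.

End prekopa_leindler1.

Section prekopa_leindler.
Context (R : realType).
Local Open Scope ereal_scope.

(** A cube instead of a ball: fixing the first coordinate leaves a function supported in a cube of
    the same size, as the induction on the dimension requires. *)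
Definition cube_support d (rho : R) (u : d.-tuple R -> R) :=
  forall x i, (rho < `|tnth x i|)%R -> u x = 0%R.

Lemma measurable_consp_comp d (u : d.+1.-tuple R -> R) (s : R) :
  measurable_fun setT u -> measurable_fun setT (fun x => u (consp (s, x))).
Proof.
move=> mu; apply: measurableT_comp => //.
by apply: measurable_consp2; [exact: measurable_cst|exact: measurable_id].
Qed.

Lemma cube_support_consp d (rho : R) (u : d.+1.-tuple R -> R) (s : R) :
  cube_support rho u -> cube_support rho (fun x => u (consp (s, x))).
Proof. by move=> us x i xi; apply: (us _ (lift ord0 i)); rewrite tnth_conspS. Qed.

Lemma measurable_integral_consp d (u : d.+1.-tuple R -> R) :
  measurable_fun setT u -> (forall x, 0 <= u x)%R ->
  measurable_fun setT
    (fun s : R => \int[lebesgue R d]_x (u (consp (s, x)))%:E).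
Proof.
move=> mu u0.
apply: (@measurable_fun_fubini_tonelli_F _ _ _ _ _ (lebesgue R d)
  (EFin \o u \o @consp R d)).
  apply: measurableT_comp; last exact: measurable_consp.
  exact/measurable_EFinP.
by move=> z; rewrite lee_fin u0.
Qed.

Lemma integral_cube_support d (rho M : R) (u : d.-tuple R -> R) :
  (0 <= rho)%R -> measurable_fun setT u -> (forall x, 0 <= u x <= M)%R ->
  cube_support rho u ->
  \int[lebesgue R d]_x (u x)%:E <= (M * (2 * rho) ^+ d)%:E.
Proof.
move=> rho0; elim: d => [|d IH] in u *.
  by move=> _ uM _; rewrite integral_lebesgue0 expr0 mulr1 lee_fin; case/andP: (uM [tuple]).
move=> mu uM us.
have u0 x : (0 <= u x)%R by case/andP: (uM x).
have IHs (s : R) : \int[lebesgue R d]_x (u (consp (s, x)))%:E <= (M * (2 * rho) ^+ d)%:E.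
  apply: IH; [exact: measurable_consp_comp| |exact: cube_support_consp].
  by move=> x; exact: uM.
have pos (s : R) : 0 <= \int[lebesgue R d]_x (u (consp (s, x)))%:E.
  by apply: integral_ge0 => x _; rewrite lee_fin.
pose U (s : R) := fine (\int[lebesgue R d]_x (u (consp (s, x)))%:E).
have UE (s : R) : \int[lebesgue R d]_x (u (consp (s, x)))%:E = (U s)%:E.
  rewrite fineK// ge0_fin_numE//; apply: le_lt_trans (IHs s) _.
  by rewrite ltry.
rewrite integral_lebesgueS; [|exact/measurable_EFinP|by move=> x; rewrite lee_fin].
under eq_integral => s _ do rewrite UE.
rewrite exprSr mulrA; apply: integral_bounded_support => //.
- by apply: measurableT_comp => //; exact: measurable_integral_consp.
- by move=> s; rewrite -2!lee_fin -UE pos IHs.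
- move=> s srho; rewrite /U integral0_eq// => x _.
  by rewrite (us _ ord0).
Qed.

(** Induction on the dimension: for fixed first coordinates, the induction hypothesis says that the
    integrals over the sections satisfy the midpoint condition of the one-dimensional inequality.
    The common bound [M] and the cube make these integrals finite and bounded functions of the first
    coordinate. Keeping the square on the side of [w] avoids square roots throughout the
    induction. *)
Theorem prekopa_leindler d (M rho : R) (u v w : d.-tuple R -> R) :
  (0 <= rho)%R ->
  measurable_fun setT u -> measurable_fun setT v -> measurable_fun setT w ->
  (forall x, 0 <= u x <= M)%R -> (forall x, 0 <= v x <= M)%R ->
  (forall x, 0 <= w x <= M)%R ->
  cube_support rho u -> cube_support rho v -> cube_support rho w ->
  (forall x y, u x * v y <= w (vconv 2^-1 x y) ^+ 2)%R ->
  (\int[lebesgue R d]_x (u x)%:E) * (\int[lebesgue R d]_x (v x)%:E) <=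
  (\int[lebesgue R d]_x (w x)%:E) * (\int[lebesgue R d]_x (w x)%:E).
Proof.
move=> rho0; elim: d => [|d IH] in u v w *.
  move=> _ _ _ _ _ _ _ _ _ /(_ [tuple] [tuple]).
  rewrite !integral_lebesgue0 -!EFinM lee_fin => /le_trans; apply.
  by rewrite (tuple0 (vconv _ _ _)) expr2.
move=> mu mv mw uM vM wM us vs ws uvw.
pose J (f : d.+1.-tuple R -> R) (s : R) :=
  fine (\int[lebesgue R d]_x (f (consp (s, x)))%:E).
have pos (f : d.+1.-tuple R -> R) (s : R) : (forall x, 0 <= f x <= M)%R ->
    0 <= \int[lebesgue R d]_x (f (consp (s, x)))%:E.
  by move=> f0; apply: integral_ge0 => x _; rewrite lee_fin; case/andP: (f0 (consp (s, x))).
have bnd (f : d.+1.-tuple R -> R) (s : R) : measurable_fun setT f -> (forall x, 0 <= f x <= M)%R ->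
    cube_support rho f ->
    \int[lebesgue R d]_x (f (consp (s, x)))%:E <= (M * (2 * rho) ^+ d)%:E.
  move=> mf fM fs; apply: integral_cube_support => //.
  - exact: measurable_consp_comp.
  - exact: cube_support_consp.
have JE (f : d.+1.-tuple R -> R) (s : R) : measurable_fun setT f -> (forall x, 0 <= f x <= M)%R ->
    cube_support rho f ->
    \int[lebesgue R d]_x (f (consp (s, x)))%:E = (J f s)%:E.
  move=> mf fM fs; rewrite fineK// ge0_fin_numE//; last exact: pos.
  by apply: le_lt_trans (bnd _ s mf fM fs) _; rewrite ltry.
have IE (f : d.+1.-tuple R -> R) : measurable_fun setT f -> (forall x, 0 <= f x <= M)%R ->
    cube_support rho f ->
    \int[lebesgue R d.+1]_x (f x)%:E = \int[lebesgue_measure]_s (J f s)%:E.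
  move=> mf fM fs; rewrite integral_lebesgueS.
  - by apply: eq_integral => s _; rewrite JE.
  - exact/measurable_EFinP.
  - by move=> x; rewrite lee_fin; case/andP: (fM x).
have mJ (f : d.+1.-tuple R -> R) : measurable_fun setT f -> (forall x, 0 <= f x <= M)%R ->
    measurable_fun setT (J f).
  move=> mf fM; apply: measurableT_comp => //.
  by apply: measurable_integral_consp => // x; case/andP: (fM x).
have JM (f : d.+1.-tuple R -> R) (s : R) : measurable_fun setT f -> (forall x, 0 <= f x <= M)%R ->
    cube_support rho f -> (0 <= J f s <= M * (2 * rho) ^+ d)%R.
  by move=> mf fM fs; rewrite -2!lee_fin -JE// pos// bnd.
have Js (f : d.+1.-tuple R -> R) (s : R) : cube_support rho f -> (rho < `|s| -> J f s = 0)%R.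
  move=> fs srho; rewrite /J integral0_eq// => x _.
  by rewrite (fs _ ord0).
rewrite (IE u mu uM us) (IE v mv vM vs) (IE w mw wM ws).
apply: (@prekopa_leindler1 R _ _ _ (M * (2 * rho) ^+ d)%R rho).
- exact: mJ.
- exact: mJ.
- exact: mJ.
- by [].
- by move=> s; exact: JM.
- by move=> s; exact: JM.
- by move=> s; have /andP[] := JM _ s mw wM ws.
- by move=> s; exact: Js.
- by move=> s; exact: Js.
move=> s t; rewrite -lee_fin expr2 !EFinM -!JE//.
apply: IH.
- exact: measurable_consp_comp.
- exact: measurable_consp_comp.
- exact: measurable_consp_comp.
- by move=> x; exact: uM.
- by move=> x; exact: vM.
- by move=> x; exact: wM.
- exact: cube_support_consp.
- exact: cube_support_consp.
- exact: cube_support_consp.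
move=> x y; have := uvw (consp (s, x)) (consp (t, y)).
rewrite vconv_consp; congr (_ <= w (consp (_, _)) ^+ 2)%R.
by field.
Qed.

End prekopa_leindler.

(** * Bounded measurable functions *)

Section bounded_measurable.
Context (R : realType) dd (T : measurableType dd).
Implicit Types f g : T -> R.

(** These functions form an algebra closed under lattice operations and are integrable over every
    set of finite measure, so linearity of the real-valued integral becomes a syntactic matter. *)
Definition bmf f := measurable_fun setT f /\ exists M, forall x, `|f x| <= M.

Lemma bmf_measurable f : bmf f -> measurable_fun setT f.
Proof. by case. Qed.

Lemma bmf_bound f : bmf f -> exists2 M, 0 < M & forall x, `|f x| <= M.
Proof.
move=> [_ [M fM]]; exists (`|M| + 1); first by rewrite ltr_wpDl.
by move=> x; rewrite (le_trans (fM x))// (le_trans (ler_norm _))// lerDl.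
Qed.

Lemma bmf_cst (c : R) : bmf (fun _ => c).
Proof. by split; [exact: measurable_cst|exists `|c|]. Qed.

Lemma bmfD f g : bmf f -> bmf g -> bmf (fun x => f x + g x).
Proof.
move=> [mf [M fM]] [mg [N gN]]; split; first exact: measurable_funD.
by exists (M + N) => x; rewrite (le_trans (ler_normD _ _))// lerD.
Qed.

Lemma bmfN f : bmf f -> bmf (fun x => - f x).
Proof.
move=> [mf [M fM]]; split; first exact: measurable_funN.
by exists M => x; rewrite normrN.
Qed.

Lemma bmfB f g : bmf f -> bmf g -> bmf (fun x => f x - g x).
Proof. by move=> bf bg; apply: bmfD => //; exact: bmfN. Qed.

Lemma bmfM f g : bmf f -> bmf g -> bmf (fun x => f x * g x).
Proof.
move=> [mf [M fM]] [mg [N gN]]; split; first exact: measurable_funM.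
by exists (M * N) => x; rewrite normrM ler_pM.
Qed.

Lemma bmfX f n : bmf f -> bmf (fun x => f x ^+ n).
Proof.
move=> bf; elim: n => [|n IH]; first exact: bmf_cst.
rewrite (_ : (fun x => _) = fun x => f x * f x ^+ n); first exact: bmfM.
by apply/funext => x; rewrite exprS.
Qed.

Lemma bmf_norm f : bmf f -> bmf (fun x => `|f x|).
Proof.
move=> [mf [M fM]]; split; first exact: measurableT_comp.
by exists M => x; rewrite normr_id.
Qed.

Lemma bmf_max f g : bmf f -> bmf g -> bmf (fun x => Num.max (f x) (g x)).
Proof.
move=> [mf [M fM]] [mg [N gN]]; split; first exact: measurable_maxr.
exists (Num.max M N) => x.
by case: (leP (f x) (g x)) => _; rewrite le_max ?fM ?gN ?orbT.
Qed.

Lemma bmf_min f g : bmf f -> bmf g -> bmf (fun x => Num.min (f x) (g x)).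
Proof.
move=> bf bg; have := bmfN (bmf_max (bmfN bf) (bmfN bg)).
by congr bmf; apply/funext => x; rewrite -oppr_min opprK.
Qed.

Lemma bmf_sum I (s : seq I) (F : I -> T -> R) :
  (forall i, bmf (F i)) -> bmf (fun x => \sum_(i <- s) F i x).
Proof.
move=> bF; elim: s => [|i s IH].
  rewrite (_ : (fun x => _) = fun _ => 0); first exact: bmf_cst.
  by apply/funext => x; rewrite big_nil.
rewrite (_ : (fun x => _) = fun x => F i x + \sum_(j <- s) F j x); first exact: bmfD.
by apply/funext => x; rewrite big_cons.
Qed.

Lemma bmf_indic (A : set T) : measurable A -> bmf (\1_A : T -> R).
Proof.
move=> mA; split; first exact: measurable_indic.
by exists 1 => x; rewrite indicE ger0_norm ?lern1 ?leq_b1.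
Qed.

Lemma bmf_restrict (A : set T) f (M : R) : measurable A -> measurable_fun A f ->
  (forall x, A x -> `|f x| <= M) -> bmf (f \_ A).
Proof.
move=> mA mf fM; split; first exact/(measurable_restrictT f mA).1.
exists (Num.max 0 M) => x; rewrite patchE; case: ifPn; rewrite ?inE => Ax.
  by rewrite le_max fM// orbT.
by rewrite normr0 le_max lexx.
Qed.

End bounded_measurable.

Lemma bmf_comp (R : realType) d1 d2 (T1 : measurableType d1)
    (T2 : measurableType d2) (f : T2 -> R) (g : T1 -> T2) :
  bmf f -> measurable_fun setT g -> bmf (fun x => f (g x)).
Proof.
move=> [mf [M fM]] mg; split; first exact: measurableT_comp.
by exists M => x.
Qed.

Ltac bmf_tac := repeat first
  [ assumption | exact: bmf_cst | apply: bmfB | apply: bmfD | apply: bmfN | apply: bmfM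
  | apply: bmfX | apply: bmf_norm | apply: bmf_max | apply: bmf_min ].

Section bounded_integral.
Context (R : realType) dd (T : measurableType dd).
Variables (m : {measure set T -> \bar R}) (D : set T).
Hypotheses (mD : measurable D) (finD : (m D < +oo)%E).
Implicit Types f g : T -> R.
Local Notation E f := (Rintegral m D f).

Lemma bmf_integrable f : bmf f -> m.-integrable D (EFin \o f).
Proof.
move=> [mf [M fM]]; apply: measurable_bounded_integrable => //.
  exact: measurable_funTS.
exists M; split; first exact: num_real.
by move=> N MN x _ /=; rewrite (le_trans (fM x))// ltW.
Qed.

Lemma EFin_bmf_integral f : bmf f ->
  (E f)%:E = (\int[m]_(x in D) (f x)%:E)%E.
Proof. by move=> bf; rewrite fineK//; exact: integrable_fin_num (bmf_integrable bf). Qed.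

Lemma bintD f g : bmf f -> bmf g -> E (fun x => f x + g x) = E f + E g.
Proof. by move=> bf bg; rewrite RintegralD//; exact: bmf_integrable. Qed.

Lemma bintB f g : bmf f -> bmf g -> E (fun x => f x - g x) = E f - E g.
Proof. by move=> bf bg; rewrite RintegralB//; exact: bmf_integrable. Qed.

Lemma bintZl (c : R) f : bmf f -> E (fun x => c * f x) = c * E f.
Proof. by move=> bf; rewrite RintegralZl//; exact: bmf_integrable. Qed.

Lemma bintZr (c : R) f : bmf f -> E (fun x => f x * c) = E f * c.
Proof. by move=> bf; rewrite RintegralZr//; exact: bmf_integrable. Qed.

Lemma bint_le f g : bmf f -> bmf g -> (forall x, D x -> f x <= g x) -> E f <= E g.
Proof. by move=> bf bg fg; apply: le_Rintegral => //; exact: bmf_integrable. Qed.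

Lemma bint_ge0 f : (forall x, D x -> 0 <= f x) -> 0 <= E f.
Proof. exact: Rintegral_ge0. Qed.

Lemma bint_cst (c : R) : E (fun _ => c) = c * fine (m D).
Proof. exact: Rintegral_cst. Qed.

Lemma bint_eq f g : (forall x, D x -> f x = g x) -> E f = E g.
Proof. by move=> fg; apply: eq_Rintegral => x /[!inE] /fg. Qed.

Lemma bint_sum I (s : seq I) (F : I -> T -> R) : (forall i, bmf (F i)) ->
  E (fun x => \sum_(i <- s) F i x) = \sum_(i <- s) E (F i).
Proof.
move=> bF; elim: s => [|i s IH].
  rewrite big_nil (_ : (fun x => _) = fun _ => 0); last first.
    by apply/funext => x; rewrite big_nil.
  by rewrite bint_cst mul0r.
rewrite big_cons -IH -bintD//; last exact: bmf_sum.
by apply: bint_eq => x _; rewrite big_cons.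
Qed.

Lemma bint_abs_le f : bmf f -> `|E f| <= E (fun x => `|f x|).
Proof. by move=> bf; apply: le_normr_Rintegral => //; exact: bmf_integrable. Qed.

Lemma bint_cauchy_schwarz f g : bmf f -> bmf g ->
  E (fun x => f x * g x) ^+ 2 <= E (fun x => f x ^+ 2) * E (fun x => g x ^+ 2).
Proof.
move=> bf bg.
set A := E (fun x => f x ^+ 2); set B := E _; set C := E _.
have key a b : 0 <= a ^+ 2 * A + (2 * a * b * B + b ^+ 2 * C).
  rewrite /A /B /C -!bintZl; try by bmf_tac.
  rewrite -!bintD; try by bmf_tac.
  apply: bint_ge0 => x _.
  rewrite (_ : _ + _ = (a * f x + b * g x) ^+ 2); last by ring.
  exact: sqr_ge0.
have A0 : 0 <= A by apply: bint_ge0 => x _; exact: sqr_ge0.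
have C0 : 0 <= C by apply: bint_ge0 => x _; exact: sqr_ge0.
have [A0'|Apos] := eqVneq A 0.
  have [->|Bne] := eqVneq B 0; first by rewrite expr0n mulr_ge0.
  (* When [A] vanishes the form is affine in a; this a makes its value -1. *)
  have := key (- (C + 1) / (2 * B)) 1.
  rewrite A0' mulr0 add0r.
  rewrite (_ : _ + _ = -1); last by field; rewrite Bne.
  by rewrite lerNr oppr0 ler10.
have {A0 Apos}Apos : 0 < A by rewrite lt_neqAle eq_sym Apos.
(* The minimizing ratio a / b = - B / A, cleared of its denominator. *)
have := key (- B) A.
rewrite (_ : _ + _ = A * (A * C - B ^+ 2)); last by ring.
by rewrite pmulr_rge0// subr_ge0.
Qed.

End bounded_integral.

Section bounded_marginal.
Context (R : realType) d1 d2 (T1 : measurableType d1) (T2 : measurableType d2).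
Variables (m2 : {sigma_finite_measure set T2 -> \bar R}) (D2 : set T2).
Hypotheses (mD2 : measurable D2) (finD2 : (m2 D2 < +oo)%E).
Implicit Types F : T1 * T2 -> R.

Lemma bmf_pair1 F x : bmf F -> bmf (fun y => F (x, y)).
Proof. by move=> bF; exact: (bmf_comp bF (pair1_measurable x)). Qed.

Lemma bmf_pair2 F y : bmf F -> bmf (fun x => F (x, y)).
Proof. by move=> bF; exact: (bmf_comp bF (pair2_measurable y)). Qed.

Lemma bmf_bint1 F : bmf F -> bmf (fun x => \int[m2]_(y in D2) F (x, y)).
Proof.
move=> bF; have [M M0 FM] := bmf_bound bF.
have bD : bmf (\1_D2 : T2 -> R) := bmf_indic R mD2.
(* Adding the bound [M] makes the integrand nonnegative, so Tonelli gives measurability; the shift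
   contributes a constant that is subtracted again. *)
pose G z := (F z + M) * (\1_D2 z.2 : R).
have bG : bmf G.
  apply: bmfM; first by bmf_tac.
  exact: (bmf_comp bD measurable_snd).
have G0 z : 0 <= G z.
  rewrite mulr_ge0//.
  by have := FM z; rewrite ler_norml => /andP[]; lra.
have GE x : (\int[m2]_y (G (x, y))%:E = (\int[m2]_(y in D2) (F (x, y) + M))%:E)%E.
  rewrite EFin_bmf_integral//; last by apply: bmfD; [exact: bmf_pair1|exact: bmf_cst].
  rewrite [RHS]integral_mkcond; apply: eq_integral => y _.
  by rewrite patchE /G/= indicE; case: (y \in D2); rewrite /= ?mulr1 ?mulr0.
have FE x : \int[m2]_(y in D2) F (x, y) =
    fine (\int[m2]_y (G (x, y))%:E)%E - M * fine (m2 D2).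
  rewrite GE/= bintD//; [|exact: bmf_pair1|exact: bmf_cst].
  by rewrite bint_cst// addrK.
split.
  rewrite (_ : (fun x => _) = fun x => fine (\int[m2]_y (G (x, y))%:E)%E - M * fine (m2 D2)).
    apply: measurable_funB; last exact: measurable_cst.
    apply: measurableT_comp => //.
    apply: (@measurable_fun_fubini_tonelli_F _ _ _ _ _ m2 (EFin \o G)).
      by apply/measurable_EFinP; exact: bmf_measurable.
    by move=> z; rewrite lee_fin G0.
  by apply/funext => x; exact: FE.
exists (M * fine (m2 D2)) => x.
have bFx := bmf_pair1 x bF.
apply: (le_trans (bint_abs_le mD2 finD2 bFx)).
rewrite -bint_cst//; apply: bint_le => //; first exact: bmf_norm.
exact: bmf_cst.
Qed.

End bounded_marginal.

Section bounded_fubini.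
Context (R : realType) d1 d2 (T1 : measurableType d1) (T2 : measurableType d2).
Variables (m1 : {sigma_finite_measure set T1 -> \bar R})
  (m2 : {sigma_finite_measure set T2 -> \bar R}) (D1 : set T1) (D2 : set T2).
Hypotheses (mD1 : measurable D1) (finD1 : (m1 D1 < +oo)%E).
Hypotheses (mD2 : measurable D2) (finD2 : (m2 D2 < +oo)%E).

Lemma bint_fubini (F : T1 * T2 -> R) : bmf F ->
  \int[m1]_(x in D1) (\int[m2]_(y in D2) F (x, y)) =
  \int[m2]_(y in D2) (\int[m1]_(x in D1) F (x, y)).
Proof.
move=> bF.
pose G z := F z * (\1_D1 z.1 * \1_D2 z.2 : R).
have bG : bmf G.
  apply: bmfM => //; apply: bmfM.
    exact: (bmf_comp (bmf_indic R mD1) measurable_fst).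
  exact: (bmf_comp (bmf_indic R mD2) measurable_snd).
have G1 x : (\int[m2]_y (G (x, y))%:E =
    (((fun x => \int[m2]_(y in D2) F (x, y)) \_ D1) x)%:E)%E.
  rewrite patchE; case: ifPn => xD; last first.
    rewrite integral0_eq// => y _; congr (_%:E).
    by rewrite /G/= indicE (negbTE xD) mul0r mulr0.
  rewrite EFin_bmf_integral//; last exact: bmf_pair1.
  rewrite [RHS]integral_mkcond; apply: eq_integral => y _.
  rewrite patchE /G/= !indicE xD mul1r.
  by case: (y \in D2); rewrite /= ?mulr1 ?mulr0.
have G2 y : (\int[m1]_x (G (x, y))%:E =
    (((fun y => \int[m1]_(x in D1) F (x, y)) \_ D2) y)%:E)%E.
  rewrite patchE; case: ifPn => yD; last first.
    rewrite integral0_eq// => x _; congr (_%:E).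
    by rewrite /G/= !indicE (negbTE yD) !mulr0.
  rewrite EFin_bmf_integral//; last exact: bmf_pair2.
  rewrite [RHS]integral_mkcond; apply: eq_integral => x _.
  rewrite patchE /G/= !indicE yD mulr1.
  by case: (x \in D1); rewrite /= ?mulr1 ?mulr0.
have iG : (m1 \x m2)%E.-integrable setT (EFin \o G).
  have [M M0 FM] := bmf_bound bF.
  have mX : measurable (D1 `*` D2) by exact: measurableX.
  have fX : ((m1 \x m2)%E (D1 `*` D2) < +oo)%E.
    by rewrite product_measure1E// lte_mul_pinfty// ge0_fin_numE.
  have bF' := bmf_integrable mX fX bF.
  have := (integrable_mkcond _ mX).1 bF'.
  apply: eq_integrable => // -[x y] _.
  rewrite /= patchE /G/= !indicE in_setX.
  by do 2 case: (_ \in _) => /=; rewrite ?mulr1 ?mul1r ?mulr0 ?mul0r ?mulr0.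
have := @Fubini _ _ _ _ _ m1 m2 (EFin \o G) iG.
under eq_integral => x _ do rewrite G1.
under [RHS]eq_integral => y _ do rewrite G2.
move=> fub; rewrite Rintegral_mkcond [RHS]Rintegral_mkcond /Rintegral.
by rewrite fub.
Qed.

End bounded_fubini.

(** * The step kernel *)

Section monomial_integral.
Context (R : realType).
Notation leb := (@lebesgue_measure R).

Lemma integral_monomial (b : R) n : 0 < b ->
  (\int[leb]_(x in `[0%R, b]) (x ^+ n)%R%:E = (b ^+ n.+1 / n.+1%:R)%R%:E)%E.
Proof.
move=> b0; rewrite (@continuous_FTC2 _ _ (fun x => x ^+ n.+1 / n.+1%:R) 0 b)//.
- by rewrite expr0n/= mul0r sube0.
- by apply: continuous_subspaceT => x; exact: exprn_continuous.
- have c (x : R) : {for x, continuous (fun x : R => x ^+ n.+1 / n.+1%:R)}.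
    by apply: cvgM; [exact: exprn_continuous|exact: cvg_cst].
  split.
  + by move=> x _; apply: derivableM => //; exact: exprn_derivable.
  + by apply: cvg_at_right_filter; exact: c.
  + by apply: cvg_at_left_filter; exact: c.
- move=> x _; rewrite derive1Mr//; last exact: exprn_derivable.
  rewrite derive1E exp_derive /= -[X in X / _]/(n.+1%:R * x ^+ n *: 1).
  by rewrite scaler1 mulrAC divff// mul1r.
Qed.

Lemma ge0_integral_reflect (f : R -> \bar R) : measurable_fun setT f ->
  (forall x, 0 <= f x)%E ->
  (\int[leb]_x f (- x)%R = \int[leb]_x f x)%E.
Proof.
move=> mf f0.
pose mfa := isMeasurableFun.Build _ _ _ _ _
  (@oppr_measurable R setT : measurable_fun setT (-%R : measurableTypeR R -> measurableTypeR R)).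
pose fa : {mfun _ >-> _} := HB.pack (-%R : measurableTypeR R -> measurableTypeR R) mfa.
rewrite -[LHS]/(\int[leb]_(x in fa @^-1` setT) (f \o fa) x)%E.
rewrite -(@ge0_integral_pushforward _ _ _ _ _ fa)//.
by apply: eq_measure_integral => //= A mA _; exact: lebesgue_measureN.
Qed.

Lemma ge0_integral_even (f : R -> \bar R) : measurable_fun setT f ->
  (forall x, 0 <= f x)%E -> (forall x, f (- x) = f x) ->
  (\int[leb]_x f x = 2%:E * \int[leb]_(x in `[0%R, +oo[) f x)%E.
Proof.
move=> mf f0 fe.
have -> : [set: R] = `]-oo, 0%R[%classic `|` `[0%R, +oo[%classic.
  apply/seteqP; split => // x _ /=; rewrite !in_itv/= andbT.
  by case: (ltP x 0) => _; [left|right].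
rewrite ge0_integral_setU//=; last 2 first.
- exact: measurable_funTS.
- rewrite disj_set2E; apply/eqP; rewrite -subset0 => x /= [].
  by rewrite !in_itv/= andbT ltNge => /negbTE ->.
rewrite integral_itv_bndo_bndc; last exact: measurable_funTS.
rewrite [in RHS]ge0_integration_by_substitution0//.
under [in RHS]eq_integral => x _ do rewrite fe.
rewrite [X in (_ + X)%E](ge0_integration_by_substitution0 mf f0).
under [X in (_ + X)%E]eq_integral => x _ do rewrite fe.
by rewrite [2]mulr2n EFinD ge0_muleDl ?mul1e.
Qed.

End monomial_integral.

Section tent_kernel.
Context (R : realType) (eta : R).
Hypothesis eta0 : 0 < eta.
Notation leb := (@lebesgue_measure R).

(* The step density is [rootk1 ^+ 2]; its square root is kept because the
   overlap of two shifted step densities is controlled by their Hellinger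
   distance, to which [rootk1] contributes a Lipschitz constant. *)
Definition tent (t : R) : R := Num.max 0 (1 - `|t| / eta).

Definition rootk1 (t : R) : R := Num.sqrt (3 / (2 * eta)) * tent t.

Lemma tent_ge0 t : 0 <= tent t.
Proof. by rewrite le_max lexx. Qed.

Lemma tent_le1 t : tent t <= 1.
Proof. by rewrite ge_max ler01/= gerBl divr_ge0// ltW. Qed.

Lemma rootk1_ge0 t : 0 <= rootk1 t.
Proof. by rewrite mulr_ge0 ?sqrtr_ge0 ?tent_ge0. Qed.

Lemma tent_eq0 t : eta <= `|t| -> tent t = 0.
Proof. by move=> te; apply/max_idPl; rewrite subr_le0 ler_pdivlMr// mul1r. Qed.

Lemma rootk1_eq0 t : eta <= `|t| -> rootk1 t = 0.
Proof. by move=> te; rewrite /rootk1 tent_eq0// mulr0. Qed.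

Lemma tentN t : tent (- t) = tent t.
Proof. by rewrite /tent normrN. Qed.

Lemma rootk1N t : rootk1 (- t) = rootk1 t.
Proof. by rewrite /rootk1 tentN. Qed.

Lemma tent_lip s t : `|tent s - tent t| <= `|s - t| / eta.
Proof.
rewrite /tent; have : `|s| <= `|t| + `|s - t|.
  by rewrite -{1}(subrK t s) addrC ler_normD.
have : `|t| <= `|s| + `|s - t|.
  by rewrite -{1}(subrK s t) addrC distrC ler_normD.
rewrite -(ler_pM2r (_ : 0 < eta^-1)) ?invr_gt0// mulrDl => h1.
rewrite -(ler_pM2r (_ : 0 < eta^-1)) ?invr_gt0// mulrDl => h2.
have : 0 <= `|s - t| / eta by rewrite divr_ge0// ltW.
rewrite ler_norml; move: h1 h2.
move: (_ / _) (_ / _) (_ / _) => p q u.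
by case: (leP 0 (1 - u)) => ?; case: (leP 0 (1 - q)) => ? ? ? ?; apply/andP; split; lra.
Qed.

Lemma rootk1_sqr t : rootk1 t ^+ 2 = 3 / (2 * eta) * tent t ^+ 2.
Proof. by rewrite exprMn sqr_sqrtr// divr_ge0// mulr_ge0// ltW. Qed.

Lemma measurable_tent : measurable_fun setT tent.
Proof.
apply: measurable_maxr; first exact: measurable_cst.
apply: measurable_funB; first exact: measurable_cst.
by apply: measurable_funM; [exact: normr_measurable|exact: measurable_cst].
Qed.

Lemma bmf_rootk1 : bmf rootk1.
Proof.
apply: bmfM; first exact: bmf_cst.
split; first exact: measurable_tent.
by exists 1 => t; rewrite ger0_norm ?tent_ge0// tent_le1.
Qed.

(** The three reciprocals come from expanding (1 - x / eta)^2 on the positive half of the support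
    and integrating each monomial; evenness doubles the result. *)
Lemma rootk1_moment n :
  (\int[leb]_x (rootk1 x ^+ 2 * x ^+ n.*2)%R%:E =
   (3 * eta ^+ n.*2 *
    (n.*2.+1%:R^-1 - 2 / n.*2.+2%:R + n.*2.+3%:R^-1))%R%:E)%E.
Proof.
set m := n.*2; pose c : R := 3 / (2 * eta).
have ev (x : R) : (- x) ^+ m = x ^+ m by rewrite /m -mul2n !exprM sqrrN.
have xm0 (x : R) : 0 <= x ^+ m by rewrite /m -mul2n exprM exprn_ge0 ?sqr_ge0.
rewrite ge0_integral_even; last 3 first.
- apply/measurable_EFinP; apply: measurable_funM; last exact: exprn_measurable.
  exact: (bmf_measurable (bmfX 2 bmf_rootk1)).
- by move=> x; rewrite lee_fin mulr_ge0// sqr_ge0.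
- by move=> x; rewrite rootk1N ev.
have -> : (\int[leb]_(x in `[0%R, +oo[) (rootk1 x ^+ 2 * x ^+ m)%R%:E =
  \int[leb]_(x in `[0%R, eta]) (c * x ^+ m + (- 2 * c / eta * x ^+ m.+1 +
     c / eta ^+ 2 * x ^+ m.+2))%R%:E)%E.
  rewrite integral_mkcond [RHS]integral_mkcond; apply: eq_integral => x _.
  rewrite !patchE; case: ifPn; rewrite ?notin_setE ?inE/= in_itv/= andbT => x0.
    case: ifPn; rewrite ?notin_setE ?inE/= in_itv/= x0/= => xe.
      congr (_%:E); rewrite rootk1_sqr /tent ger0_norm// max_r.
        by rewrite -/c !exprSr; field; rewrite gt_eqF.
      by rewrite subr_ge0 ler_pdivrMr// mul1r.
    rewrite rootk1_eq0 ?expr0n ?mul0r// ger0_norm// ltW// ltNge.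
    exact/negP.
  case: ifPn => //; rewrite ?inE/= in_itv/= => /andP[x0' _].
  by move/negP : x0; rewrite x0'.
have im k : leb.-integrable `[0, eta] (EFin \o (fun x : R => x ^+ k)).
  apply: continuous_compact_integrable; first exact: segment_compact.
  by apply: continuous_subspaceT => x; exact: exprn_continuous.
have iZ a k : leb.-integrable `[0, eta] (EFin \o (fun x : R => a * x ^+ k)).
  apply: eq_integrable (integrableZl _ a (im k)) => //.
rewrite integralD_EFin//; last first.
  by apply: eq_integrable (integrableD _ (iZ _ _) (iZ _ _)).
rewrite integralD_EFin//.
have Z a k : (\int[leb]_(x in `[0%R, eta]) (a * x ^+ k)%R%:E =
    (a * (eta ^+ k.+1 / k.+1%:R))%R%:E)%E.
  under eq_integral => x _ do rewrite EFinM.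
  by rewrite (integralZl _ (im k))// (integral_monomial k eta0).
rewrite !Z -!EFinD -EFinM; congr (_%:E); rewrite /c !exprSr.
have h k : k.+1%:R != 0 :> R by rewrite pnatr_eq0.
move: (h m) (h m.+1) (h m.+2).
move: (m.+1%:R) (m.+2%:R) (m.+3%:R) => u v w u0 v0 w0.
by field; rewrite (gt_eqF eta0) u0 v0 w0.
Qed.

Lemma rootk1_mass : (\int[leb]_x (rootk1 x ^+ 2)%R%:E = 1)%E.
Proof.
under eq_integral => x _ do rewrite -[_ ^+ 2]mulr1 -(expr0 x).
by rewrite (rootk1_moment 0) -[0.*2]/0%N expr0; congr (_%:E); field.
Qed.

Lemma rootk1_var :
  (\int[leb]_x (rootk1 x ^+ 2 * x ^+ 2)%R%:E = (eta ^+ 2 / 10)%R%:E)%E.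
Proof. by rewrite (rootk1_moment 1) -[1.*2]/2%N; congr (_%:E); field. Qed.

Lemma rootk1_m4 :
  (\int[leb]_x (rootk1 x ^+ 2 * x ^+ 4)%R%:E = (eta ^+ 4 / 35)%R%:E)%E.
Proof. by rewrite (rootk1_moment 2) -[2.*2]/4%N; congr (_%:E); field. Qed.

(** The squared Lipschitz bound of [rootk1] times the length 2 eta + |a - b| of the joint support
    gives 3 (a - b)^2 / eta^2 times 1 + |a - b| / (2 eta). The last factor is at most 5/4 here, and
    4/3 already suffices for the constant 4. *)
Lemma rootk1_shift_dist (a b : R) : `|a - b| <= eta / 2 ->
  (\int[leb]_v ((rootk1 (v - a) - rootk1 (v - b)) ^+ 2)%R%:E <=
   (4 / eta ^+ 2 * (a - b) ^+ 2)%R%:E)%E.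
Proof.
move=> ab.
have [m [mD E0]] : exists m, (forall v, `|v - a| < eta \/ `|v - b| < eta ->
    v \in `[m - eta, m + `|a - b| + eta]) /\ True.
  exists (Num.min a b); split=> // v; rewrite in_itv/=.
  case: (leP a b) => ab'.
    have -> : `|a - b| = b - a by rewrite distrC ger0_norm// subr_ge0.
    by rewrite !ltr_norml => -[|] /andP[? ?]; apply/andP; split; lra.
  have -> : `|a - b| = a - b by rewrite ger0_norm// subr_ge0 ltW.
  by rewrite !ltr_norml => -[|] /andP[? ?]; apply/andP; split; lra.
set I := `[_, _] in mD.
set M := 3 / (2 * eta) * ((a - b) ^+ 2 / eta ^+ 2).
have M0 : 0 <= M.
  have e0 := ltW eta0.
  by apply: mulr_ge0; apply: divr_ge0; rewrite ?sqr_ge0// mulr_ge0.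
apply: (@le_trans _ _ (\int[leb]_(v in [set` I]) (cst M%:E) v)%E).
  rewrite [leRHS]integral_mkcond; apply: ge0_le_integral => //.
  - by move=> v _; rewrite lee_fin sqr_ge0.
  - apply/measurable_EFinP; apply: measurable_funX; apply: measurable_funB.
      apply: measurableT_comp; first exact: (bmf_measurable bmf_rootk1).
      by apply: measurable_funB => //; exact: measurable_cst.
    apply: measurableT_comp; first exact: (bmf_measurable bmf_rootk1).
    by apply: measurable_funB => //; exact: measurable_cst.
  - by apply/(measurable_restrict _ _ _).1 => //; exact: measurable_cst.
  - move=> v _; rewrite patchE; case: ifPn => [_|].
      have e0 := ltW eta0.
      rewrite lee_fin -mulrBr exprMn sqr_sqrtr; last by rewrite divr_ge0 ?mulr_ge0.
      rewrite /M; apply: ler_wpM2l; first by rewrite divr_ge0 ?mulr_ge0// ltW.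
      rewrite -expr_div_n -(real_normK (num_real (tent _ - _))) -(real_normK (num_real (_ / eta))).
      rewrite lerXn2r ?nnegrE// normrM normfV (gtr0_norm eta0).
      apply: (le_trans (tent_lip _ _)).
      by rewrite (_ : v - a - (v - b) = b - a) ?(distrC b)//; ring.
    rewrite notin_setE => /= vI; rewrite lee_fin.
    have va : eta <= `|v - a| by rewrite leNgt; apply/negP => h; apply/vI/mD; left.
    have vb : eta <= `|v - b| by rewrite leNgt; apply/negP => h; apply/vI/mD; right.
    by rewrite !rootk1_eq0// subrr expr0n.
rewrite integral_cst//= lebesgue_measure_itv/= lte_fin ifT; last first.
  by move: eta0 (normr_ge0 (a - b)); move: `|a - b| => e; lra.
rewrite -EFinD -EFinM lee_fin /M.
set e := `|a - b| in ab *.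
rewrite (_ : _ + _ - _ = 2 * eta + e); last by ring.
rewrite (_ : 3 / _ * _ * _ = 3 / eta ^+ 2 * (a - b) ^+ 2 * (1 + e / (2 * eta))); last first.
  by field; rewrite gt_eqF.
rewrite (_ : 4 / _ * _ = 3 / eta ^+ 2 * (a - b) ^+ 2 * (4 / 3)); last first.
  by field; rewrite gt_eqF.
apply: ler_wpM2l; first by rewrite mulr_ge0 ?sqr_ge0// divr_ge0 ?sqr_ge0.
rewrite -lerBrDl ler_pdivrMr; last by rewrite mulr_gt0.
by have e0 := eta0; move: ab e0; clear; lra.
Qed.

End tent_kernel.

Section ge0_real_integral.
Context (R : realType) dd (T : measurableType dd) (m : {measure set T -> \bar R}).
Local Open Scope ereal_scope.

Lemma ge0_EFin_integralZl (k : R) (f : T -> R) :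
  measurable_fun setT f -> (0 <= k)%R -> (forall x, 0 <= f x)%R ->
  \int[m]_x (k * f x)%R%:E = k%:E * \int[m]_x (f x)%:E.
Proof.
move=> mf k0 f0; under eq_integral => x _ do rewrite EFinM.
apply: ge0_integralZl_EFin => //; first by move=> x _; rewrite lee_fin.
exact/measurable_EFinP.
Qed.

Lemma ge0_EFin_integralD (f g : T -> R) :
  measurable_fun setT f -> measurable_fun setT g ->
  (forall x, 0 <= f x)%R -> (forall x, 0 <= g x)%R ->
  \int[m]_x (f x + g x)%R%:E = \int[m]_x (f x)%:E + \int[m]_x (g x)%:E.
Proof.
move=> mf mg f0 g0; under eq_integral => x _ do rewrite EFinD.
apply: ge0_integralD => //; try exact/measurable_EFinP;
  by move=> x _; rewrite lee_fin.
Qed.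

Lemma ge0_EFin_integral_le (f g : T -> R) :
  measurable_fun setT f -> measurable_fun setT g ->
  (forall x, 0 <= f x)%R -> (forall x, f x <= g x)%R ->
  \int[m]_x (f x)%:E <= \int[m]_x (g x)%:E.
Proof.
move=> mf mg f0 fg; apply: ge0_le_integral => //; try exact/measurable_EFinP.
- by move=> x _; rewrite lee_fin.
- by move=> x _; rewrite lee_fin.
Qed.

End ge0_real_integral.

Section product_kernel.
Context (R : realType) (eta : R).
Hypothesis eta0 : 0 < eta.
Notation rootk1 := (rootk1 eta).
Local Notation leb := (@lebesgue_measure R).

Definition rootk d (u : d.-tuple R) : R := \prod_(i < d) rootk1 (tnth u i).

Definition dot d (x u : d.-tuple R) : R := \sum_(i < d) tnth x i * tnth u i.

Definition sqn d (x : d.-tuple R) : R := \sum_(i < d) tnth x i ^+ 2.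

Definition vopp d (x : d.-tuple R) : d.-tuple R := [tuple - tnth x i | i < d].

Lemma rootk_consp d s (x : d.-tuple R) :
  rootk (consp (s, x)) = rootk1 s * rootk x.
Proof.
rewrite /rootk big_ord_recl tnth_consp0; congr (_ * _).
by apply: eq_bigr => i _; rewrite tnth_conspS.
Qed.

Lemma dot_consp d s t (x u : d.-tuple R) :
  dot (consp (s, x)) (consp (t, u)) = s * t + dot x u.
Proof.
rewrite /dot big_ord_recl !tnth_consp0; congr (_ + _).
by apply: eq_bigr => i _; rewrite !tnth_conspS.
Qed.

Lemma sqn_consp d s (x : d.-tuple R) : sqn (consp (s, x)) = s ^+ 2 + sqn x.
Proof.
rewrite /sqn big_ord_recl !tnth_consp0; congr (_ + _).
by apply: eq_bigr => i _; rewrite !tnth_conspS.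
Qed.

Lemma vopp_consp d s (x : d.-tuple R) :
  vopp (consp (s, x)) = consp (- s, vopp x).
Proof.
apply: eq_consp => [|i]; rewrite ?tnth_mktuple// ?tnth_mktuple.
by rewrite !tnth_conspS.
Qed.

Lemma sqn_ge0 d (x : d.-tuple R) : 0 <= sqn x.
Proof. by apply: sumr_ge0 => i _; exact: sqr_ge0. Qed.

Lemma rootk_ge0 d (u : d.-tuple R) : 0 <= rootk u.
Proof. by apply: prodr_ge0 => i _; exact: rootk1_ge0. Qed.

Lemma rootk_eq0 d (u : d.-tuple R) i : eta <= `|tnth u i| -> rootk u = 0.
Proof. by move=> ui; rewrite /rootk (bigD1 i)//= rootk1_eq0// mul0r. Qed.

Lemma rootk_vsubC d (x y : d.-tuple R) : rootk (vsub x y) = rootk (vsub y x).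
Proof.
by apply: eq_bigr => i _; rewrite !tnth_mktuple -rootk1N opprB.
Qed.

Lemma rootk_vopp d (x : d.-tuple R) : rootk (vopp x) = rootk x.
Proof. by apply: eq_bigr => i _; rewrite !tnth_mktuple rootk1N. Qed.

Lemma dot_vopp d (x u : d.-tuple R) : dot x (vopp u) = - dot x u.
Proof.
by rewrite /dot -sumrN; apply: eq_bigr => i _; rewrite !tnth_mktuple mulrN.
Qed.

Lemma bmf_rootk d : bmf (@rootk d).
Proof.
elim: d => [|d IH].
  rewrite (_ : @rootk 0 = fun _ => 1); first exact: bmf_cst.
  by apply/funext => u; rewrite /rootk big_ord0.
rewrite (_ : @rootk d.+1 = fun u => rootk1 (tnth u ord0) * rootk [tuple of behead u]).
  apply: bmfM.
    exact: (bmf_comp (bmf_rootk1 eta0) (measurable_tnth (n := d.+1) ord0)).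
  exact: (bmf_comp IH (@measurable_behead _ _ d)).
by apply/funext => u; rewrite {1}[u]consp_eta rootk_consp.
Qed.

Lemma measurable_rootk d : measurable_fun setT (@rootk d).
Proof. exact: bmf_measurable (bmf_rootk d). Qed.

Lemma measurable_dot d (x : d.-tuple R) : measurable_fun setT (dot x).
Proof.
apply: measurable_sum => i; apply: measurable_funM; first exact: measurable_cst.
exact: measurable_tnth.
Qed.

Lemma measurable_vopp d : measurable_fun setT (@vopp d).
Proof.
apply/measurable_fun_tnthP => i.
rewrite (_ : _ \o _ = fun z => - tnth z i); last first.
  by apply/funext => z /=; rewrite tnth_mktuple.
by apply: measurable_funN; exact: measurable_tnth.
Qed.

Local Open Scope ereal_scope.

Lemma integral_lebesgue_vopp d (f : d.-tuple R -> \bar R) :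
  measurable_fun setT f -> (forall x, 0 <= f x) ->
  \int[lebesgue R d]_x f (vopp x) = \int[lebesgue R d]_x f x.
Proof.
elim: d => [|d IH] in f *.
  by move=> _ _; rewrite !integral_lebesgue0 (tuple0 (vopp _)).
move=> mf f0.
have mfo : measurable_fun setT (fun x => f (vopp x)).
  by apply: measurableT_comp => //; exact: measurable_vopp.
rewrite (integral_lebesgueS mfo); last by move=> x; exact: f0.
rewrite (integral_lebesgueS mf f0).
under eq_integral => t _ do under eq_integral => x _ do rewrite vopp_consp.
under eq_integral => t _.
  rewrite (IH (fun x => f (consp ((- t)%R, x))))//; last first.
    apply: measurableT_comp => //; apply: measurable_consp2.
      exact: measurable_cst.
    exact: measurable_id.
  over.
rewrite (@ge0_integral_reflect R
  (fun t => \int[lebesgue R d]_x f (consp (t, x))))//.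
- apply: (@measurable_fun_fubini_tonelli_F _ _ _ _ _ (lebesgue R d)
    (f \o @consp R d)) => //.
    by apply: measurableT_comp => //; exact: measurable_consp.
  by move=> x; exact: f0.
- by move=> t; apply: integral_ge0 => x _; exact: f0.
Qed.

Lemma integral_lebesgue_prod d (f : R -> R) (F : d.-tuple R -> R)
    (G : d.+1.-tuple R -> R) :
  measurable_fun setT f -> measurable_fun setT F -> measurable_fun setT G ->
  (forall s, 0 <= f s)%R -> (forall x, 0 <= F x)%R ->
  (forall s x, G (consp (s, x)) = f s * F x)%R ->
  \int[lebesgue R d.+1]_u (G u)%:E =
  (\int[leb]_s (f s)%:E) * (\int[lebesgue R d]_x (F x)%:E).
Proof.
move=> mf mF mG f0 F0 GE.
rewrite integral_lebesgueS; last 2 first.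
- exact/measurable_EFinP.
- by move=> u; rewrite [u]consp_eta GE lee_fin mulr_ge0.
set c := \int[lebesgue R d]_x (F x)%:E.
have c0 : 0 <= c by apply: integral_ge0 => x _; rewrite lee_fin.
transitivity (\int[leb]_s ((f s)%:E * c)).
  apply: eq_integral => s _.
  under eq_integral => x _ do rewrite GE.
  by rewrite ge0_EFin_integralZl.
rewrite ge0_integralZr//; first exact/measurable_EFinP.
by move=> s _; rewrite lee_fin.
Qed.

Lemma rootk_mass d : \int[lebesgue R d]_u (rootk u ^+ 2)%R%:E = 1.
Proof.
elim: d => [|d IH]; first by rewrite integral_lebesgue0 /rootk big_ord0 expr1n.
rewrite (@integral_lebesgue_prod d (fun s => rootk1 s ^+ 2)%R
  (fun x => rootk x ^+ 2)%R).
- by rewrite IH rootk1_mass// mule1.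
- exact: bmf_measurable (bmfX 2 (bmf_rootk1 eta0)).
- exact: bmf_measurable (bmfX 2 (bmf_rootk d)).
- exact: bmf_measurable (bmfX 2 (bmf_rootk d.+1)).
- by move=> s; exact: sqr_ge0.
- by move=> s; exact: sqr_ge0.
- by move=> s x; rewrite rootk_consp exprMn.
Qed.

Definition flip0 d (u : d.+1.-tuple R) : d.+1.-tuple R :=
  consp ((- thead u)%R, [tuple of behead u]).

Lemma behead_consp d s (x : d.-tuple R) : [tuple of behead (consp (s, x))] = x.
Proof. exact/val_inj. Qed.

Lemma flip0_consp d s (x : d.-tuple R) : flip0 (consp (s, x)) = consp ((- s)%R, x).
Proof. by rewrite /flip0; congr (consp (_, _)); exact/val_inj. Qed.

(** Averaging over the sign of the first coordinate removes the odd terms of an expanded power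
    before integration, so that only nonnegative integrands remain in the moment computations. *)
Lemma integral_flip0 d (F : d.+1.-tuple R -> R) :
  measurable_fun setT F -> (forall u, 0 <= F u)%R ->
  \int[lebesgue R d.+1]_u (F u)%:E =
  \int[lebesgue R d.+1]_u ((F u + F (flip0 u)) / 2)%R%:E.
Proof.
move=> mF F0.
have mflip : measurable_fun setT (@flip0 d).
  apply: measurable_consp2; last exact: measurable_behead.
  by apply: measurable_funN; exact: measurable_tnth.
have mFf : measurable_fun setT (fun u => F (flip0 u)) by exact: measurableT_comp.
have E1 : \int[lebesgue R d.+1]_u (F (flip0 u))%:E = \int[lebesgue R d.+1]_u (F u)%:E.
  rewrite !integral_lebesgueS; try exact/measurable_EFinP;
    try by move=> x; rewrite lee_fin.
  under eq_integral => t _ do under eq_integral => x _ do rewrite flip0_consp.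
  apply: (@ge0_integral_reflect R (fun t => \int[lebesgue R d]_x (F (consp (t, x)))%:E)).
    exact: measurable_integral_consp.
  by move=> t; apply: integral_ge0 => x _; rewrite lee_fin.
under [RHS]eq_integral => u _ do rewrite mulrC.
rewrite ge0_EFin_integralZl//; [|exact: measurable_funD|by move=> x; exact: addr_ge0].
rewrite ge0_EFin_integralD// E1 -[X in _ * (X + _)]mul1e -[X in _ * (_ + X)]mul1e.
rewrite -ge0_muleDl ?lee_fin// muleA -EFinD -EFinM.
by rewrite (_ : 2^-1 * (1 + 1) = 1)%R ?mul1e//; field.
Qed.

Lemma rootk_second_moment d (x : d.-tuple R) :
  \int[lebesgue R d]_u (rootk u ^+ 2 * dot x u ^+ 2)%R%:E =
  (eta ^+ 2 / 10 * sqn x)%R%:E.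
Proof.
have mk n : measurable_fun setT (fun u : n.-tuple R => rootk u ^+ 2)%R.
  exact: bmf_measurable (bmfX 2 (bmf_rootk n)).
have mk1 : measurable_fun setT (fun s : R => rootk1 s ^+ 2)%R.
  exact: bmf_measurable (bmfX 2 (bmf_rootk1 eta0)).
have mdot n (y : n.-tuple R) k : measurable_fun setT (fun u => dot y u ^+ k)%R.
  by apply: measurable_funX; exact: measurable_dot.
elim: d => [|d IH] in x *.
  by rewrite integral_lebesgue0 /sqn /dot !big_ord0 expr0n/= !mulr0.
rewrite [x]consp_eta; set a := thead x; set y := [tuple of behead x].
rewrite integral_flip0; last 2 first.
- by apply: measurable_funM; [exact: mk|exact: mdot].
- by move=> u; rewrite mulr_ge0 ?sqr_ge0.
pose G1 (u : d.+1.-tuple R) : R :=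
  (rootk1 (thead u) ^+ 2 * (a * thead u) ^+ 2 * rootk [tuple of behead u] ^+ 2)%R.
pose G2 (u : d.+1.-tuple R) : R :=
  (rootk1 (thead u) ^+ 2 * (rootk [tuple of behead u] ^+ 2 * dot y [tuple of behead u] ^+ 2))%R.
have mth : measurable_fun setT (fun u : d.+1.-tuple R => thead u) by exact: measurable_tnth.
have mbh := @measurable_behead _ _ d : measurable_fun setT (fun u : d.+1.-tuple R => [tuple of behead u]).
have mk1a k : measurable_fun setT (fun s : R => rootk1 s ^+ 2 * (a * s) ^+ k)%R.
  apply: measurable_funM => //; apply: measurable_funX.
  by apply: measurable_funM => //; exact: measurable_cst.
have mG1 : measurable_fun setT G1.
  apply: measurable_funM; last exact: (measurableT_comp (mk d) mbh).
  exact: (measurableT_comp (mk1a 2%N) mth).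
have mG2 : measurable_fun setT G2.
  apply: measurable_funM; first exact: (measurableT_comp mk1 mth).
  apply: measurable_funM; first exact: (measurableT_comp (mk d) mbh).
  exact: (measurableT_comp (mdot _ y 2%N) mbh).
have -> : \int[lebesgue R d.+1]_u ((rootk u ^+ 2 * dot (consp (a, y)) u ^+ 2 +
    rootk (flip0 u) ^+ 2 * dot (consp (a, y)) (flip0 u) ^+ 2) / 2)%R%:E =
  \int[lebesgue R d.+1]_u (G1 u + G2 u)%R%:E.
  apply: eq_integral => u _; congr (_%:E).
  rewrite {1 2 3 4}[u]consp_eta flip0_consp /G1 /G2.
  move: (thead u) [tuple of behead u] => s w.
  by rewrite !rootk_consp !dot_consp rootk1N; field.
rewrite ge0_EFin_integralD//; last 2 first.
- by move=> u; rewrite /G1; do ?[exact: sqr_ge0|apply: mulr_ge0].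
- by move=> u; rewrite /G2; do ?[exact: sqr_ge0|apply: mulr_ge0].
rewrite (@integral_lebesgue_prod d (fun s => rootk1 s ^+ 2 * (a * s) ^+ 2)%R
  (fun w => rootk w ^+ 2)%R)//; last 3 first.
- by move=> s; rewrite mulr_ge0 ?sqr_ge0.
- by move=> s; rewrite sqr_ge0.
- by move=> s w; rewrite /G1 behead_consp.
rewrite (@integral_lebesgue_prod d (fun s => rootk1 s ^+ 2)%R
  (fun w => rootk w ^+ 2 * dot y w ^+ 2)%R)//; last 4 first.
- by apply: measurable_funM; [exact: mk|exact: mdot].
- by move=> s; rewrite sqr_ge0.
- by move=> s; rewrite mulr_ge0 ?sqr_ge0.
- by move=> s w; rewrite /G2 behead_consp.
rewrite rootk_mass mule1 IH rootk1_mass// mul1e.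
have -> : \int[leb]_s (rootk1 s ^+ 2 * (a * s) ^+ 2)%R%:E = (a ^+ 2 * (eta ^+ 2 / 10))%R%:E.
  rewrite EFinM -rootk1_var// -ge0_EFin_integralZl ?sqr_ge0//.
  - by apply: eq_integral => s _; congr (_%:E); rewrite exprMn; ring.
  - by apply: measurable_funM => //; exact: exprn_measurable.
  - by move=> s; apply: mulr_ge0; exact: sqr_ge0.
rewrite -EFinD sqn_consp; congr (_%:E); ring.
Qed.

(** The fourth moment is compared with three times the squared variance, its value for a Gaussian.
    This bound is stable under adding an independent symmetric coordinate, because the cross term 6
    V1 V2 is exactly the one of 3 (V1 + V2)^2. For a single coordinate it reads 1/35 <= 3/100. *)
Lemma rootk_fourth_moment d (x : d.-tuple R) :
  \int[lebesgue R d]_u (rootk u ^+ 2 * dot x u ^+ 4)%R%:E <=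
  (3 * (eta ^+ 2 / 10 * sqn x) ^+ 2)%R%:E.
Proof.
have mk n : measurable_fun setT (fun u : n.-tuple R => rootk u ^+ 2)%R.
  exact: bmf_measurable (bmfX 2 (bmf_rootk n)).
have mk1 : measurable_fun setT (fun s : R => rootk1 s ^+ 2)%R.
  exact: bmf_measurable (bmfX 2 (bmf_rootk1 eta0)).
have mdot n (y : n.-tuple R) k : measurable_fun setT (fun u => dot y u ^+ k)%R.
  by apply: measurable_funX; exact: measurable_dot.
have e4 (t : R) : (0 <= t ^+ 4)%R by rewrite (_ : 4 = 2 * 2)%N// exprM sqr_ge0.
elim: d => [|d IH] in x *.
  by rewrite integral_lebesgue0 /sqn /dot !big_ord0 mulr0 !expr0n/= !mulr0.
rewrite [x]consp_eta; set a := thead x; set y := [tuple of behead x].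
rewrite integral_flip0; last 2 first.
- by apply: measurable_funM; [exact: mk|exact: mdot].
- by move=> u; apply: mulr_ge0; [exact: sqr_ge0|exact: e4].
pose hd (u : d.+1.-tuple R) := thead u.
pose tl (u : d.+1.-tuple R) : d.-tuple R := [tuple of behead u].
have hdE s (w : d.-tuple R) : hd (consp (s, w)) = s by [].
have tlE s (w : d.-tuple R) : tl (consp (s, w)) = w by exact: behead_consp.
pose G (c : R) (i j : nat) (u : d.+1.-tuple R) : R :=
  (c * (rootk1 (hd u) ^+ 2 * (a * hd u) ^+ i) * (rootk (tl u) ^+ 2 * dot y (tl u) ^+ j))%R.
have mth : measurable_fun setT hd by exact: measurable_tnth.
have mbh : measurable_fun setT tl := @measurable_behead _ _ d.
have mk1a k : measurable_fun setT (fun s : R => rootk1 s ^+ 2 * (a * s) ^+ k)%R.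
  apply: measurable_funM => //; apply: measurable_funX.
  by apply: measurable_funM => //; exact: measurable_cst.
have mk1c c k : measurable_fun setT (fun s : R => c * (rootk1 s ^+ 2 * (a * s) ^+ k))%R.
  by apply: measurable_funM => //; exact: measurable_cst.
have mkd k : measurable_fun setT (fun w : d.-tuple R => rootk w ^+ 2 * dot y w ^+ k)%R.
  by apply: measurable_funM; [exact: mk|exact: mdot].
have mG c i j : measurable_fun setT (G c i j).
  apply: measurable_funM; last exact: (measurableT_comp (mkd j) mbh).
  exact: (measurableT_comp (mk1c c i) mth).
have even0 (t : R) i : ~~ odd i -> (0 <= t ^+ i)%R.
  by move=> oi; rewrite exprn_even_ge0.
have G0 c i j u : (0 <= c)%R -> ~~ odd i -> ~~ odd j -> (0 <= G c i j u)%R.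
  by move=> c0 oi oj; rewrite /G; do ?[exact: sqr_ge0|exact: even0|exact: c0|apply: mulr_ge0].
have IG c i j : (0 <= c)%R -> ~~ odd i -> ~~ odd j ->
    \int[lebesgue R d.+1]_u (G c i j u)%:E =
    (c * a ^+ i)%R%:E * (\int[leb]_s (rootk1 s ^+ 2 * s ^+ i)%R%:E) *
    \int[lebesgue R d]_w (rootk w ^+ 2 * dot y w ^+ j)%R%:E.
  move=> c0 oi oj.
  rewrite (@integral_lebesgue_prod d (fun s => c * (rootk1 s ^+ 2 * (a * s) ^+ i))%R
    (fun w => rootk w ^+ 2 * dot y w ^+ j)%R)//; last 3 first.
  - by move=> s; do ?[exact: sqr_ge0|exact: even0|exact: c0|apply: mulr_ge0].
  - by move=> w; apply: mulr_ge0; [exact: sqr_ge0|exact: even0].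
  - by move=> s w; rewrite /G tlE.
  congr (_ * _); rewrite -ge0_EFin_integralZl.
  - apply: eq_integral => s _; congr (_%:E).
    rewrite [((a * s) ^+ i)%R]exprMn -[RHS]mulrA; congr (_ * _)%R.
    exact: mulrCA.
  - by apply: measurable_funM => //; exact: exprn_measurable.
  - by rewrite mulr_ge0// even0.
  - by move=> s; apply: mulr_ge0; [exact: sqr_ge0|exact: even0].
have -> : \int[lebesgue R d.+1]_u ((rootk u ^+ 2 * dot (consp (a, y)) u ^+ 4 +
    rootk (flip0 u) ^+ 2 * dot (consp (a, y)) (flip0 u) ^+ 4) / 2)%R%:E =
  \int[lebesgue R d.+1]_u (G 1 4 0 u + (G 6 2 2 u + G 1 0 4 u))%R%:E.
  apply: eq_integral => u _; congr (_%:E).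
  rewrite [u]consp_eta flip0_consp /G !tlE !hdE.
  move: (thead u) [tuple of behead u] => s w.
  by rewrite !rootk_consp !dot_consp rootk1N; field.
rewrite ge0_EFin_integralD//; last 3 first.
- exact: measurable_funD.
- by move=> u; rewrite G0.
- by move=> u; rewrite addr_ge0// G0.
rewrite ge0_EFin_integralD//; last 2 first.
- by move=> u; rewrite G0.
- by move=> u; rewrite G0.
rewrite !IG// rootk1_m4// rootk1_var// rootk_second_moment.
have -> : \int[leb]_s (rootk1 s ^+ 2 * s ^+ 0)%R%:E = 1.
  by under eq_integral => s _ do rewrite expr0 mulr1; exact: rootk1_mass.
have -> : \int[lebesgue R d]_w (rootk w ^+ 2 * dot y w ^+ 0)%R%:E = 1.
  by under eq_integral => s _ do rewrite expr0 mulr1; exact: rootk_mass.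
rewrite !mule1 expr0 mulr1 mul1e -!EFinM.
apply: (@le_trans _ _ ((1 * a ^+ 4 * (eta ^+ 4 / 35))%R%:E +
  ((6 * a ^+ 2 * (eta ^+ 2 / 10) * (eta ^+ 2 / 10 * sqn y))%R%:E +
   (3 * (eta ^+ 2 / 10 * sqn y) ^+ 2)%R%:E))).
  by rewrite leeD2l// leeD2l// IH.
rewrite -!EFinD lee_fin sqn_consp.
have := sqr_ge0 (a ^+ 2 * eta ^+ 2)%R; nra.
Qed.

End product_kernel.

Lemma measurable_set_ler (R : realType) dd (T : measurableType dd)
    (f g : T -> R) :
  measurable_fun setT f -> measurable_fun setT g ->
  measurable [set x | f x <= g x].
Proof.
move=> mf mg; rewrite -[X in measurable X]setTI.
by have := measurable_fun_ler mf mg measurableT; apply => //=.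
Qed.

Lemma measurable_natb (R : realType) dd (T : measurableType dd)
    (A : set T) (b : T -> bool) : measurable A -> (forall x, A x <-> b x) ->
  measurable_fun setT (fun x => (b x)%:R : R).
Proof.
move=> mA Ab; rewrite (_ : (fun x => _) = \1_A); first exact: measurable_indic.
apply/funext => x; rewrite indicE; congr (nat_of_bool _)%:R.
by apply/idP/idP; rewrite inE Ab.
Qed.

Lemma measurable_restrict_setT (R : realType) dd (T : measurableType dd)
    (D : set T) (f : T -> \bar R) : measurable D ->
  measurable_fun setT f -> measurable_fun setT (f \_ D).
Proof.
move=> mD mf; apply: (measurable_restrictT f mD).1.
exact: measurable_funTS.
Qed.

Lemma exp4_sqr (R : pzSemiRingType) (t : R) : t ^+ 4 = (t ^+ 2) ^+ 2.
Proof. by rewrite -exprM. Qed.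

(** * Anticoncentration of a step and local conductance of the ball *)

Section kernel_estimates.
Context (R : realType) (eta : R).
Hypothesis eta0 : 0 < eta.
Local Notation leb := (@lebesgue_measure R).
Local Notation rootk := (rootk eta).
Local Notation rootk1 := (rootk1 eta).

Lemma measurable_rootk_shift d (a : d.-tuple R) :
  measurable_fun setT (fun v => rootk (vsub v a)).
Proof.
apply: measurableT_comp; first exact: measurable_rootk.
by apply: measurable_vsub; [exact: measurable_id|exact: measurable_cst].
Qed.

Lemma enorm_sqn d (x : d.-tuple R) : enorm x = Num.sqrt (sqn x).
Proof. by []. Qed.

Lemma eball_sqn d (r : R) (x : d.-tuple R) : 0 <= r ->
  eball r x <-> sqn x <= r ^+ 2.
Proof.
move=> r0; rewrite /eball /= enorm_sqn -{1}(ger0_norm r0) -sqrtr_sqr.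
by rewrite ler_sqrt ?sqr_ge0.
Qed.

Lemma sqn_vadd d (x u : d.-tuple R) :
  sqn (vadd x u) = sqn x + 2 * dot x u + sqn u.
Proof.
rewrite /sqn /dot mulr_sumr -!big_split/=; apply: eq_bigr => i _.
by rewrite tnth_mktuple; ring.
Qed.

Lemma sqn_vsubC d (x y : d.-tuple R) : sqn (vsub x y) = sqn (vsub y x).
Proof. by apply: eq_bigr => i _; rewrite !tnth_mktuple; ring. Qed.

Lemma sqn_vsub_le d (x y : d.-tuple R) :
  sqn (vsub x y) <= 2 * sqn x + 2 * sqn y.
Proof.
rewrite /sqn !mulr_sumr -big_split/=; apply: ler_sum => i _.
rewrite tnth_mktuple; have := sqr_ge0 (tnth x i + tnth y i); nra.
Qed.

Lemma sqn_support d (u : d.-tuple R) : rootk u != 0 ->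
  sqn u <= d%:R * eta ^+ 2.
Proof.
move=> u0; rewrite /sqn.
have -> : d%:R * eta ^+ 2 = \sum_(i < d) eta ^+ 2.
  by rewrite sumr_const card_ord mulr_natl.
apply: ler_sum => i _; rewrite -real_normK ?num_real//.
have ui : `|tnth u i| <= eta.
  by rewrite leNgt; apply: contra u0 => /ltW ui; rewrite (rootk_eq0 eta0 ui).
by rewrite lerXn2r ?nnegrE// ltW.
Qed.

(* With w = Z^2 / V the polynomial (4 / (B - 5/32)^2) (w - 5/32) (B - w) is at
   most 1, and nonpositive for w < 5/32; here B = 13/2. *)
Lemma anticoncentration_poly (Z2 V : R) : 0 <= Z2 -> 0 < V ->
  (64 / 203) ^+ 2 * (213 / 32) * V * Z2 <=
  V ^+ 2 * (V * (5 / 32) <= Z2)%R%:R + (64 / 203) ^+ 2 * (Z2 ^+ 2 + 65 / 64 * V ^+ 2).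
Proof.
move=> Z0 V0.
rewrite -subr_ge0; have [h|h] := leP (V * (5 / 32)) Z2; rewrite ?mulr1 ?mulr0 ?add0r.
  rewrite (_ : _ - _ = (64 / 203) ^+ 2 * (Z2 - 213 / 64 * V) ^+ 2); last by field.
  by rewrite mulr_ge0 ?sqr_ge0.
rewrite (_ : _ - _ =
  (64 / 203) ^+ 2 * ((V * (5 / 32) - Z2) * (13 / 2 * V - Z2))); last by field.
by rewrite mulr_ge0 ?sqr_ge0// mulr_ge0//; lra.
Qed.

(** The projection Z of a step on x has variance V = eta^2 |x|^2 / 10 and fourth moment at most 3
    V^2. Integrating [anticoncentration_poly] gives Z^2 >= (5/32) V, which is |Z| >= eta |x| / 8, a
    probability of at least (64/203)^2 * 169/64 > 1/4. The symmetry of the step turns this into 1/8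
    for the negative side. *)
Lemma rootk_anticoncentration d (x : d.-tuple R) :
  ((1 / 8)%:E <= \int[lebesgue R d]_u
    (rootk u ^+ 2 * (dot x u <= - (eta / 8 * enorm x))%R%:R)%:E)%E.
Proof.
have mk : measurable_fun setT (fun u : d.-tuple R => rootk u ^+ 2).
  exact: bmf_measurable (bmfX 2 (bmf_rootk eta0 d)).
have mI (f g : d.-tuple R -> R) : measurable_fun setT f -> measurable_fun setT g ->
    measurable_fun setT (fun u => (f u <= g u)%R%:R : R).
  by move=> mf mg; apply: (measurable_natb (measurable_set_ler mf mg)).
have mdot k : measurable_fun setT (fun u : d.-tuple R => dot x u ^+ k).
  by apply: measurable_funX; exact: measurable_dot.
have mcst c : measurable_fun setT (fun u : d.-tuple R => c : R) by exact: measurable_cst.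
pose P (u : d.-tuple R) : R := (dot x u <= - (eta / 8 * enorm x))%R%:R.
pose F u := rootk u ^+ 2 * P u.
have mP : measurable_fun setT P by apply: mI => //; exact: measurable_dot.
have mF : measurable_fun setT F by exact: measurable_funM.
have F0 u : 0 <= F u by rewrite mulr_ge0 ?sqr_ge0.
have Fo : (\int[lebesgue R d]_u (F (vopp u))%:E = \int[lebesgue R d]_u (F u)%:E)%E.
  apply: (@integral_lebesgue_vopp R d (EFin \o F)) => [|u].
    exact/measurable_EFinP.
  by rewrite lee_fin F0.
have mFo : measurable_fun setT (fun u => F (vopp u)).
  by apply: measurableT_comp => //; exact: measurable_vopp.
(* For x = 0 the variance vanishes, but then the event is certain. *)
have [x0|x0] := eqVneq (sqn x) 0.
  have xi i : tnth x i = 0.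
    have /eqP := x0; rewrite /sqn psumr_eq0; last by move=> j _; exact: sqr_ge0.
    by move=> /allP/(_ i); rewrite mem_index_enum sqrf_eq0 => /(_ isT)/eqP.
  apply: (@le_trans _ _ 1%E); first by rewrite lee_fin; lra.
  rewrite -(rootk_mass eta0 d); apply: ge0_EFin_integral_le => //.
    by move=> u; exact: sqr_ge0.
  move=> u; rewrite (_ : dot x u <= _ = true) ?mulr1//.
  rewrite /dot big1; last by move=> i _; rewrite xi mul0r.
  by rewrite enorm_sqn x0 sqrtr0 mulr0 oppr0 lexx.
set V := eta ^+ 2 / 10 * sqn x.
have V0 : 0 < V.
  by rewrite mulr_gt0 ?divr_gt0 ?exprn_gt0// lt_neqAle eq_sym x0 sqn_ge0.
pose c : R := (64 / 203) ^+ 2.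
have c0 : 0 <= c by rewrite /c sqr_ge0.
have cV0 : 0 <= c * (213 / 32) * V.
  by apply: mulr_ge0; [apply: mulr_ge0 => //; exact: divr_ge0|exact: ltW].
have P2 u : (V * (5 / 32) <= dot x u ^+ 2)%R%:R <= P u + P (vopp u).
  rewrite /P dot_vopp lerN2; set t := dot x u; set s := eta / 8 * enorm x.
  have s0 : 0 <= s by rewrite mulr_ge0 ?sqrtr_ge0// divr_ge0// ltW.
  have -> : V * (5 / 32) = s ^+ 2.
    by rewrite /V /s enorm_sqn exprMn sqr_sqrtr ?sqn_ge0//; field.
  have [ts|ts] := leP (s ^+ 2) (t ^+ 2); last by rewrite addr_ge0.
  have [h|h] := leP t (- s); first by rewrite ler_wpDr.
  have [h'|h'] := leP s t; first by rewrite ler_wpDl.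
  have : t ^+ 2 < s ^+ 2.
    by rewrite -subr_gt0 subr_sqr mulr_gt0 ?subr_gt0// -ltrBlDl sub0r.
  by rewrite ltNge ts.
have alg (v a p q k z : R) :
    k * (a * (213 / 32) * v * z) <=
    k * (v ^+ 2 * (p + q) + a * (z ^+ 2 + 65 / 64 * v ^+ 2)) ->
    a * (213 / 32) * v * (k * z) <= v ^+ 2 * (k * p + k * q) +
      (a * (k * z ^+ 2) + a * (65 / 64) * v ^+ 2 * k).
  by clear; lra.
have key : (\int[lebesgue R d]_u ((c * (213 / 32) * V) * (rootk u ^+ 2 * dot x u ^+ 2))%:E <=
   \int[lebesgue R d]_u (V ^+ 2 * (F u + F (vopp u)) +
     (c * (rootk u ^+ 2 * dot x u ^+ 4) + c * (65 / 64) * V ^+ 2 * rootk u ^+ 2))%:E)%E.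
  apply: ge0_EFin_integral_le.
  - by apply: measurable_funM => //; apply: measurable_funM.
  - apply: measurable_funD.
      by apply: measurable_funM => //; apply: measurable_funD.
    apply: measurable_funD; last by apply: measurable_funM.
    by apply: measurable_funM => //; apply: measurable_funM.
  - move=> u; apply: mulr_ge0; last by apply: mulr_ge0; exact: sqr_ge0.
    exact: cV0.
  - move=> u.
    have := anticoncentration_poly (sqr_ge0 (dot x u)) V0.
    rewrite -/c => h.
    have := P2 u; rewrite -(ler_pM2l (exprn_gt0 2 V0)) => h2.
    have k0 := sqr_ge0 (rootk u).
    rewrite /F rootk_vopp exp4_sqr.
    have := ler_wpM2l k0 (le_trans h (lerD h2 (lexx _))).
    exact: alg.
move: key; rewrite ge0_EFin_integralZl//; last 2 first.
- exact: measurable_funM.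
- by move=> u; apply: mulr_ge0; exact: sqr_ge0.
rewrite rootk_second_moment// -/V ge0_EFin_integralD; last 4 first.
- by apply: measurable_funM => //; exact: measurable_funD.
- apply: measurable_funD; last by apply: measurable_funM.
  by apply: measurable_funM => //; apply: measurable_funM.
- by move=> u; rewrite mulr_ge0 ?sqr_ge0// addr_ge0.
- move=> u; apply: addr_ge0; apply: mulr_ge0 => //; try exact: sqr_ge0.
    apply: mulr_ge0; first exact: sqr_ge0.
    by rewrite exp4_sqr sqr_ge0.
  by rewrite mulr_ge0 ?sqr_ge0// mulr_ge0.
rewrite ge0_EFin_integralZl ?sqr_ge0//; last 2 first.
- exact: measurable_funD.
- by move=> u; rewrite addr_ge0.
rewrite ge0_EFin_integralD// Fo.
have e4 u : 0 <= rootk u ^+ 2 * dot x u ^+ 4.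
  apply: mulr_ge0; first exact: sqr_ge0.
  by rewrite exp4_sqr sqr_ge0.
have c1 : 0 <= c * (65 / 64) * V ^+ 2 by rewrite mulr_ge0 ?sqr_ge0// mulr_ge0.
rewrite ge0_EFin_integralD//; last 4 first.
- by apply: measurable_funM => //; apply: measurable_funM.
- exact: measurable_funM.
- by move=> u; exact: mulr_ge0.
- by move=> u; rewrite mulr_ge0 ?sqr_ge0.
rewrite ge0_EFin_integralZl//; last exact: measurable_funM.
rewrite ge0_EFin_integralZl//; last by move=> u; exact: sqr_ge0.
rewrite rootk_mass// mule1.
have I0 : (0 <= \int[lebesgue R d]_u (F u)%:E)%E by apply: integral_ge0 => u _; rewrite lee_fin.
have := rootk_fourth_moment eta0 x; rewrite -/V.
move: I0; case: (\int[lebesgue R d]_u (F u)%:E)%E => [I|_ _ _|//]; last by rewrite leey.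
rewrite lee_fin => I0.
have J0 : (0 <= \int[lebesgue R d]_u (rootk u ^+ 2 * dot x u ^+ 4)%:E)%E.
  by apply: integral_ge0 => u _; rewrite lee_fin.
move: J0; case: (\int[lebesgue R d]_u (rootk u ^+ 2 * dot x u ^+ 4)%:E)%E => [J|//|//].
rewrite !lee_fin => J0 J1.
move=> h.
have V2 : 0 < V ^+ 2 by rewrite exprn_gt0.
rewrite -(ler_pM2l V2).
have : c * (213 / 32) * V * V <= V ^+ 2 * (I + I) + (c * (3 * V ^+ 2) + c * (65 / 64) * V ^+ 2).
  by apply: (le_trans h); rewrite lerD2l lerD2r ler_wpM2l.
have -> : c * (213 / 32) * V * V = c * (213 / 32) * V ^+ 2 by rewrite expr2 mulrA.
have num (v i : R) : 0 < v ->
    (64 / 203) ^+ 2 * (213 / 32) * v <=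
    v * (i + i) + ((64 / 203) ^+ 2 * (3 * v) + (64 / 203) ^+ 2 * (65 / 64) * v) ->
    v * (1 / 8) <= v * i by clear; lra.
exact: num.
Qed.

(** A step u in the support has |u|^2 <= d eta^2 <= r eta / 4. If it also points inward, with x . u
    <= - eta |x| / 8, then |x + u|^2 <= |x|^2 + eta (r - |x|) / 4, which is at most r^2 because eta
    <= r. Inward steps have probability at least 1/8 by anticoncentration. *)
Lemma local_conductance d (r : R) (x : d.-tuple R) :
  0 < r -> eta * d%:R <= r / 4 -> eta <= r -> eball r x ->
  ((1 / 8)%:E <= \int[lebesgue R d]_(y in eball r) (rootk (vsub y x) ^+ 2)%:E)%E.
Proof.
move=> r0 etad etar Dx.
have mk : measurable_fun setT (fun u : d.-tuple R => rootk u ^+ 2).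
  exact: bmf_measurable (bmfX 2 (bmf_rootk eta0 d)).
have mD := @measurable_eball R d r.
have mid : measurable_fun setT (fun y : d.-tuple R => y) by exact: measurable_id.
rewrite integral_mkcond.
rewrite -(@integral_lebesgue_shift R d x); last 2 first.
- apply: measurable_restrict_setT => //.
  apply/measurable_EFinP; apply: measurable_funX; exact: measurable_rootk_shift.
- by move=> y; rewrite patchE; case: ifPn => // _; rewrite lee_fin sqr_ge0.
apply: (le_trans (rootk_anticoncentration x)); apply: ge0_le_integral => //.
- by move=> u _; rewrite lee_fin mulr_ge0 ?sqr_ge0.
- apply/measurable_EFinP; apply: measurable_funM => //.
  have mc : measurable_fun setT (fun _ : d.-tuple R => - (eta / 8 * enorm x)).
    exact: measurable_cst.
  by apply: (measurable_natb (measurable_set_ler (measurable_dot x) mc)).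
- pose h := (fun y => (rootk (vsub y x) ^+ 2)%:E) \_ (eball r).
  have mh : measurable_fun setT h.
    apply: measurable_restrict_setT => //.
    apply/measurable_EFinP; apply: measurable_funX; exact: measurable_rootk_shift.
  apply: (measurableT_comp mh).
  by apply: measurable_vadd => //; exact: measurable_cst.
move=> u _; rewrite patchE vaddK.
have [->|k0] := eqVneq (rootk u) 0.
  by rewrite expr0n mul0r; case: ifP.
case: ifPn => [_|]; first by rewrite lee_fin ler_piMr ?sqr_ge0// lern1 leq_b1.
rewrite notin_setE => nD; case: (leP (dot x u) _) => h; last by rewrite mulr0.
exfalso; apply: nD; apply/(eball_sqn _ (ltW r0)).
rewrite sqn_vadd.
have := sqn_support k0.
have -> : sqn x = enorm x ^+ 2 by rewrite enorm_sqn sqr_sqrtr// sqn_ge0.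
have s0 : 0 <= enorm x by exact: sqrtr_ge0.
move: Dx h; rewrite /eball/=.
move: (enorm x) s0 (sqn u) (dot x u) => s s0 U Z sr hZ hU.
have e0 := eta0.
have : d%:R * eta ^+ 2 <= r / 4 * eta by rewrite expr2 mulrA ler_pM2r// mulrC.
have : 0 <= (r - s) * (s + r - eta / 4).
  by apply: mulr_ge0; lra.
lra.
Qed.

End kernel_estimates.

(** * Hellinger affinity of shifted step densities *)

Section kernel_affinity.
Context (R : realType) (eta : R).
Hypothesis eta0 : 0 < eta.
Local Notation leb := (@lebesgue_measure R).
Local Notation rootk := (rootk eta).
Local Notation rootk1 := (rootk1 eta).

Lemma measurable_rootk1_shift (a : R) :
  measurable_fun setT (fun v : R => rootk1 (v - a)).
Proof.
apply: measurableT_comp; first exact: bmf_measurable (bmf_rootk1 eta0).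
by apply: measurable_funB => //; exact: measurable_cst.
Qed.

Lemma rootk_mass_shift d (a : d.-tuple R) :
  (\int[lebesgue R d]_v (rootk (vsub v a) ^+ 2)%:E = 1)%E.
Proof.
rewrite -(rootk_mass eta0 d) -(@integral_lebesgue_shift R d a).
- by apply: eq_integral => u _; rewrite vaddK.
- apply/measurable_EFinP; apply: measurable_funX.
  exact: measurable_rootk_shift.
- by move=> v; rewrite lee_fin sqr_ge0.
Qed.

Lemma rootk1_mass_shift (a : R) :
  (\int[leb]_v (rootk1 (v - a) ^+ 2)%R%:E = 1)%E.
Proof.
rewrite -(rootk1_mass eta0) -(@integral_lebesgue_shift1 R a).
- by apply: eq_integral => u _; rewrite [(a + u)%R]addrC addrK.
- apply/measurable_EFinP; apply: measurable_funX.
  exact: measurable_rootk1_shift.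
- by move=> v; rewrite lee_fin sqr_ge0.
Qed.

Lemma distance_affinity dd (T : measurableType dd) (m : {measure set T -> \bar R})
    (f g : T -> R) : measurable_fun setT f -> measurable_fun setT g ->
  (forall x, 0 <= f x) -> (forall x, 0 <= g x) ->
  (\int[m]_x (f x ^+ 2)%:E = 1)%E -> (\int[m]_x (g x ^+ 2)%:E = 1)%E ->
  exists A, [/\ 0 <= A, A <= 1, (\int[m]_x (f x * g x)%:E = A%:E)%E &
    (\int[m]_x ((f x - g x) ^+ 2)%:E = (2 - 2 * A)%:E)%E].
Proof.
move=> mf mg f0 g0 f1 g1.
have mfg : measurable_fun setT (fun x => f x * g x) by exact: measurable_funM.
have mB : measurable_fun setT (fun x => (f x - g x) ^+ 2).
  by apply: measurable_funX; exact: measurable_funB.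
have mf2 : measurable_fun setT (fun x => f x ^+ 2) by exact: measurable_funX.
have mg2 : measurable_fun setT (fun x => g x ^+ 2) by exact: measurable_funX.
have E : (\int[m]_x ((f x - g x) ^+ 2)%:E + 2%:E * \int[m]_x (f x * g x)%:E = 2%:E)%E.
  rewrite -ge0_EFin_integralZl//; last by move=> x; exact: mulr_ge0.
  rewrite -ge0_EFin_integralD//.
  - rewrite (_ : 2%:E = 1 + 1)%E; last by rewrite -EFinD.
    rewrite -{1}f1 -g1 -ge0_EFin_integralD//; try by move=> x; exact: sqr_ge0.
    by apply: eq_integral => x _; congr (_%:E); ring.
  - by apply: measurable_funM => //; exact: measurable_cst.
  - by move=> x; exact: sqr_ge0.
  - by move=> x; rewrite mulr_ge0// mulr_ge0.
have I0 : (0 <= \int[m]_x ((f x - g x) ^+ 2)%:E)%E.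
  by apply: integral_ge0 => x _; rewrite lee_fin sqr_ge0.
have J0 : (0 <= \int[m]_x (f x * g x)%:E)%E.
  by apply: integral_ge0 => x _; rewrite lee_fin mulr_ge0.
move: E I0 J0.
case: (\int[m]_x ((f x - g x) ^+ 2)%:E)%E => [I|//|//].
  case: (\int[m]_x (f x * g x)%:E)%E => [A|//|//]; last first.
    by rewrite gt0_muley ?lte_fin.
  rewrite -EFinM -EFinD !lee_fin => -[E] I0 A0.
  exists A; split => //; first by lra.
  by congr (_%:E); lra.
by move=> + _ J0; rewrite addye// gt_eqF// (lt_le_trans _ (mule_ge0 _ J0))// ?lee_fin// ltNyr.
Qed.

(** The affinity, unlike the squared distance, is multiplicative over the coordinates. Its factors
    lie between 0 and 1, so A B >= A + B - 1 and the one-dimensional defects simply add up to a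
    multiple of |a - b|^2, with no dependence on the dimension. *)
Lemma rootk_affinity d (a b : d.-tuple R) :
  (forall i, `|tnth a i - tnth b i| <= eta / 2) ->
  exists A, [/\ 0 <= A, A <= 1,
    (\int[lebesgue R d]_v (rootk (vsub v a) * rootk (vsub v b))%:E = A%:E)%E &
    1 - 2 / eta ^+ 2 * sqn (vsub a b) <= A].
Proof.
elim: d => [|d IH] in a b *.
  move=> _; exists 1; split=> //.
    by rewrite integral_lebesgue0 /rootk !big_ord0 mulr1.
  by rewrite /sqn big_ord0 mulr0 subr0.
rewrite [a]consp_eta [b]consp_eta.
set s := thead a; set t := thead b.
set x := [tuple of behead a]; set y := [tuple of behead b] => ab.
have [|B [B0 B1 BE Bge]] := IH x y.
  by move=> i; have := ab (lift ord0 i); rewrite !tnth_conspS.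
have [A [A0 A1 AE AE2]] := @distance_affinity _ (measurableTypeR R) leb
  (fun v : R => rootk1 (v - s)) (fun v : R => rootk1 (v - t))
  (measurable_rootk1_shift s)
  (measurable_rootk1_shift t) (fun v => @rootk1_ge0 R eta _)
  (fun v => @rootk1_ge0 R eta _) (rootk1_mass_shift s) (rootk1_mass_shift t).
have := @rootk1_shift_dist R eta eta0 s t (ab ord0).
rewrite AE2 lee_fin => Age.
exists (A * B); split.
- exact: mulr_ge0.
- exact: mulr_ile1.
- rewrite (@integral_lebesgue_prod R d (fun v => rootk1 (v - s) * rootk1 (v - t))
    (fun v => rootk (vsub v x) * rootk (vsub v y))).
  + by rewrite AE BE -EFinM.
  + by apply: measurable_funM; exact: measurable_rootk1_shift.
  + by apply: measurable_funM; exact: measurable_rootk_shift.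
  + by apply: measurable_funM; exact: measurable_rootk_shift.
  + by move=> v; apply: mulr_ge0; exact: rootk1_ge0.
  + by move=> v; apply: mulr_ge0; exact: rootk_ge0.
  + by move=> v w; rewrite !vsub_consp !rootk_consp; ring.
- rewrite vsub_consp sqn_consp.
  have : 0 <= 2 / eta ^+ 2 * (s - t) ^+ 2 by rewrite mulr_ge0 ?divr_ge0 ?sqr_ge0.
  have e4 : 4 / eta ^+ 2 * (s - t) ^+ 2 = 2 * (2 / eta ^+ 2 * (s - t) ^+ 2) by ring.
  rewrite e4 in Age.
  rewrite mulrDr; move: Age Bge.
  by move: (_ * (s - t) ^+ 2) (_ * sqn _) => p q; nra.
Qed.

Lemma rootk_shift_dist d (D : set (d.-tuple R)) (a b : d.-tuple R) :
  measurable D -> sqn (vsub a b) <= (eta / 2) ^+ 2 ->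
  (\int[lebesgue R d]_(v in D) ((rootk (vsub v a) - rootk (vsub v b)) ^+ 2)%:E <=
   (4 / eta ^+ 2 * sqn (vsub a b))%:E)%E.
Proof.
move=> mD ab.
have abi i : `|tnth a i - tnth b i| <= eta / 2.
  have e2 : 0 <= eta / 2 by rewrite divr_ge0// ltW.
  rewrite -(ler_pXn2r (_ : (0 < 2)%N)) ?nnegrE//.
  rewrite real_normK ?num_real// (le_trans _ ab)// /sqn (bigD1 i)//= tnth_mktuple.
  by rewrite lerDl sumr_ge0// => j _; exact: sqr_ge0.
have [A [A0 A1 AE Age]] := rootk_affinity abi.
have [A' [_ _ AE' DE]] := distance_affinity (measurable_rootk_shift eta0 a)
  (measurable_rootk_shift eta0 b) (fun v => @rootk_ge0 R eta _ _)
  (fun v => @rootk_ge0 R eta _ _) (rootk_mass_shift a) (rootk_mass_shift b).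
have -> : 4 / eta ^+ 2 * sqn (vsub a b) = 2 * (2 / eta ^+ 2 * sqn (vsub a b)) by ring.
have AA : A' = A by move: AE'; rewrite AE => -[].
apply: (@le_trans _ _ (2 - 2 * A)%:E); last first.
  by rewrite lee_fin; move: Age; move: (_ * sqn _) => p; lra.
rewrite -AA -DE [leLHS]integral_mkcond; apply: ge0_le_integral => //.
- by move=> v _; rewrite patchE; case: ifPn => // _; rewrite lee_fin sqr_ge0.
- apply: measurable_restrict_setT => //.
  apply/measurable_EFinP; apply: measurable_funX.
  by apply: measurable_funB; exact: measurable_rootk_shift.
- apply/measurable_EFinP; apply: measurable_funX.
  by apply: measurable_funB; exact: measurable_rootk_shift.
- by move=> v _; rewrite patchE; case: ifPn => // _; rewrite lee_fin sqr_ge0.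
Qed.

End kernel_affinity.

(** * The nonlocal Poincare inequality *)

Section ball_geometry.
Context (R : realType) (d : nat) (r : R).
Hypothesis r0 : 0 < r.
Local Notation D := (@eball R d r).

Lemma sqn_vconv (l : R) (x y : d.-tuple R) :
  sqn (vconv l x y) =
  l * sqn x + (1 - l) * sqn y - l * (1 - l) * sqn (vsub x y).
Proof.
rewrite /sqn !mulr_sumr -big_split/= -sumrB; apply: eq_bigr => i _.
by rewrite !tnth_mktuple; ring.
Qed.

Lemma eball_vconv (l : R) (x y : d.-tuple R) : 0 <= l <= 1 ->
  D x -> D y -> D (vconv l x y).
Proof.
move=> /andP[l0 l1] /(eball_sqn _ (ltW r0)) Dx /(eball_sqn _ (ltW r0)) Dy.
apply/(eball_sqn _ (ltW r0)); rewrite sqn_vconv.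
have := sqn_ge0 (vsub x y) => h.
have l1' : 0 <= 1 - l by rewrite subr_ge0.
have := mulr_ge0 (mulr_ge0 l0 l1') h.
have := ler_wpM2l l0 Dx; have := ler_wpM2l l1' Dy; lra.
Qed.

Lemma sqn_vsub_mid (x y : d.-tuple R) :
  sqn (vsub (vconv 2^-1 x y) x) = sqn (vsub x y) / 4.
Proof.
rewrite /sqn mulr_suml; apply: eq_bigr => i _.
by rewrite !tnth_mktuple; field.
Qed.

Lemma eball_coord (x : d.-tuple R) i : D x -> `|tnth x i| <= r.
Proof.
move=> /(eball_sqn _ (ltW r0)) Dx; rewrite -ler_sqr ?nnegrE//; last exact: ltW.
rewrite real_normK ?num_real// (le_trans _ Dx)// /sqn (bigD1 i)//= lerDl.
by rewrite sumr_ge0// => j _; exact: sqr_ge0.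
Qed.

Lemma eball0 : D [tuple 0 | i < d].
Proof.
apply/(eball_sqn _ (ltW r0)); rewrite /sqn big1 ?sqr_ge0// => i _.
by rewrite tnth_mktuple expr0n.
Qed.

Lemma lebesgue_eball_fin : (lebesgue R d D < +oo)%E.
Proof.
have mD := @measurable_eball R d r.
rewrite -[D]setIT -integral_indic//.
apply: (@le_lt_trans _ _ (1 * (2 * r) ^+ d)%:E); last by rewrite ltry.
apply: integral_cube_support; first exact: ltW.
- exact: measurable_indic.
- by move=> x; rewrite indicE ler0n lern1 leq_b1.
- move=> x i xi; rewrite indicE memNset// => Dx.
  by move: xi; rewrite ltNge eball_coord.
Qed.

Lemma enorm_vsub_eball (x y : d.-tuple R) : D x -> D y ->
  enorm (vsub x y) <= 2 * r.
Proof.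
move=> /(eball_sqn _ (ltW r0)) Dx /(eball_sqn _ (ltW r0)) Dy.
have r20 : 0 <= 2 * r by rewrite mulr_ge0// ltW.
apply/(eball_sqn _ r20); apply: (le_trans (sqn_vsub_le _ _)).
by rewrite exprMn; lra.
Qed.

End ball_geometry.

(** * A variance bound from Prekopa-Leindler *)

Section pl_variance.
Context (R : realType) (d : nat) (r : R).
Hypothesis r0 : 0 < r.
Local Notation D := (@eball R d r).
Local Notation E f := (\int[lebesgue R d]_(x in D) (f x)).

Let mD := @measurable_eball R d r.
Let finD := @lebesgue_eball_fin R d r r0.

(** [u] is allowed to be negative since it will be a perturbed density from which a multiple of Q is
    subtracted; its positive part inherits the midpoint condition. Convexity of the ball lets all
    three functions be extended by 0. *)
Lemma pl_ball (u v w : d.-tuple R -> R) : bmf u -> bmf v -> bmf w ->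
  (forall x, D x -> 0 <= v x) ->
  (forall x, D x -> 0 <= w x) ->
  (forall x y, D x -> D y -> u x * v y <= w (vconv 2^-1 x y) ^+ 2) ->
  E u * E v <= E w ^+ 2.
Proof.
move=> bu bv bw v0 w0 uvw.
have bu' : bmf (fun x => Num.max 0 (u x)) by apply: bmf_max => //; exact: bmf_cst.
have Ev0 : 0 <= E v by exact: bint_ge0.
apply: (@le_trans _ _ (E (fun x => Num.max 0 (u x)) * E v)).
  apply: ler_wpM2r => //; apply: bint_le => // x _.
  by rewrite le_max lexx orbT.
pose z (f : d.-tuple R -> R) := (f : d.-tuple R -> R) \_ D.
have [Mu Mu0 uM] := bmf_bound bu'; have [Mv Mv0 vM] := bmf_bound bv.
have [Mw Mw0 wM] := bmf_bound bw.
pose M := Mu + Mv + Mw.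
have zE f x : D x -> z f x = f x by move=> Dx; rewrite /z patchE mem_set.
have zN f x : ~ D x -> z f x = 0 by move=> Dx; rewrite /z patchE memNset.
have mz f : bmf f -> measurable_fun setT (z f).
  by move=> [mf _]; apply: (measurable_restrictT _ mD).1; exact: measurable_funTS.
have zM f N : (forall x, `|f x| <= N) -> 0 < N -> N <= M ->
    (forall x, D x -> 0 <= f x) -> forall x, 0 <= z f x <= M.
  move=> fN N0 NM f0 x; have [Dx|Dx] := pselect (D x).
    by rewrite zE// f0//= (le_trans (ler_norm _))// (le_trans (fN x)).
  by rewrite zN// lexx/= (le_trans (ltW N0)).
have zs f : cube_support r (z f).
  move=> x i xi; apply: zN => Dx.
  by move: xi; rewrite ltNge eball_coord.
have Ez f : bmf f -> (\int[lebesgue R d]_x (z f x)%:E = (E f)%:E)%E.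
  move=> bf; rewrite EFin_bmf_integral// [RHS]integral_mkcond.
  by apply: eq_integral => x _; rewrite /z !patchE; case: ifP.
have uM' := zM _ _ uM Mu0.
have := @prekopa_leindler R d M r (z (fun x => Num.max 0 (u x))) (z v) (z w) (ltW r0)
  (mz _ bu') (mz _ bv) (mz _ bw).
rewrite !Ez// -!EFinM lee_fin expr2; apply => //.
- by apply: (zM _ _ uM) => //; [rewrite /M; lra|move=> x _; rewrite le_max lexx].
- by apply: (zM _ _ vM) => //; rewrite /M; lra.
- by apply: (zM _ _ wM) => //; rewrite /M; lra.
move=> x y.
have [Dx|Dx] := pselect (D x); last by rewrite zN// mul0r sqr_ge0.
have [Dy|Dy] := pselect (D y); last by rewrite [z v y]zN// mulr0 sqr_ge0.
have Dm : D (vconv 2^-1 x y).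
  apply: eball_vconv => //; apply/andP; split; first by rewrite invr_ge0.
  by rewrite invf_le1// ler1n.
rewrite !zE//; case: (leP 0 (u x)) => _; first exact: uvw.
by rewrite mul0r sqr_ge0.
Qed.

(* Prekopa-Leindler with w = (1 + e g) rt, v = rt and
   u = ((1 + e g)^2 - e^2 Q) rt: comparing the coefficients of e^2 turns it
   into a variance bound, with no error term in e. *)
Lemma pl_variance (rt g Q : d.-tuple R -> R) (e : R) :
  0 < e -> bmf rt -> bmf g -> bmf Q ->
  (forall x, D x -> 0 <= rt x) -> (forall x, D x -> 0 <= 1 + e * g x) ->
  (forall x y, D x -> D y ->
    rt x * rt y * (1 + sqn (vsub x y) / (4 * r ^+ 2)) <=
    rt (vconv 2^-1 x y) ^+ 2) ->
  (forall x y, D x -> D y ->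
    (1 + e * g x) ^+ 2 - e ^+ 2 * Q x <=
    (1 + e * g (vconv 2^-1 x y)) ^+ 2 * (1 + sqn (vsub x y) / (4 * r ^+ 2))) ->
  E rt * E (fun x => g x ^+ 2 * rt x) - E (fun x => g x * rt x) ^+ 2 <=
  E rt * E (fun x => Q x * rt x).
Proof.
move=> e0 brt bg bQ rt0 g0 hrt hg.
have := @pl_ball (fun x => ((1 + e * g x) ^+ 2 - e ^+ 2 * Q x) * rt x) rt
  (fun x => (1 + e * g x) * rt x).
have b1 : bmf (fun x => 1 + e * g x) by bmf_tac.
move=> /(_ _ brt _ rt0).
have h1 : bmf (fun x => ((1 + e * g x) ^+ 2 - e ^+ 2 * Q x) * rt x) by bmf_tac.
have h2 : bmf (fun x => (1 + e * g x) * rt x) by bmf_tac.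
move=> /(_ h1 h2).
have E1 : E (fun x => ((1 + e * g x) ^+ 2 - e ^+ 2 * Q x) * rt x) =
    E rt + (2 * e) * E (fun x => g x * rt x) +
    (e ^+ 2) * (E (fun x => g x ^+ 2 * rt x) - E (fun x => Q x * rt x)).
  have b2 : bmf (fun x => g x * rt x) by bmf_tac.
  have b3 : bmf (fun x => g x ^+ 2 * rt x) by bmf_tac.
  have b4 : bmf (fun x => Q x * rt x) by bmf_tac.
  have b5 : bmf (fun x => (2 * e) * (g x * rt x)) by bmf_tac.
  have b6 : bmf (fun x => g x ^+ 2 * rt x - Q x * rt x) by bmf_tac.
  have b7 : bmf (fun x => e ^+ 2 * (g x ^+ 2 * rt x - Q x * rt x)) by bmf_tac.
  have b8 : bmf (fun x => rt x + (2 * e) * (g x * rt x)) by bmf_tac.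
  rewrite -(bintB mD finD b3 b4) -(bintZl mD finD _ b6) -(bintZl mD finD _ b2).
  rewrite -(bintD mD finD brt b5) -(bintD mD finD b8 b7).
  by apply: bint_eq => x _; ring.
have E2 : E (fun x => (1 + e * g x) * rt x) = E rt + e * E (fun x => g x * rt x).
  have b2 : bmf (fun x => g x * rt x) by bmf_tac.
  have b3 : bmf (fun x => e * (g x * rt x)) by bmf_tac.
  rewrite -(bintZl mD finD _ b2) -(bintD mD finD brt b3).
  by apply: bint_eq => x _; ring.
rewrite E1 E2 => h.
rewrite -(ler_pM2l (exprn_gt0 2 e0)).
have : forall a b c q : R, (a + 2 * e * b + e ^+ 2 * (c - q)) * a <= (a + e * b) ^+ 2 ->
  e ^+ 2 * (a * c - b ^+ 2) <= e ^+ 2 * (a * q) by move=> a b c q; lra.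
apply; apply: h.
  by move=> x Dx; apply: mulr_ge0; [exact: g0|exact: rt0].
move=> x y Dx Dy.
have Dm : D (vconv 2^-1 x y).
  apply: eball_vconv => //; apply/andP; split; first by rewrite invr_ge0.
  by rewrite invf_le1// ler1n.
have := hg x y Dx Dy; have := hrt x y Dx Dy.
have := mulr_ge0 (rt0 x Dx) (rt0 y Dy).
have T0 : 0 <= sqn (vsub x y) / (4 * r ^+ 2).
  by rewrite divr_ge0 ?sqn_ge0// mulr_ge0// sqr_ge0.
move: (_ / _) T0 => T T0 h0 h3 h4.
rewrite exprMn -mulrA; apply: (le_trans (ler_wpM2r h0 h4)).
rewrite -mulrA; apply: ler_wpM2l; first exact: sqr_ge0.
by rewrite mulrC.
Qed.

End pl_variance.

Lemma bmf_inv (R : realType) dd (T : measurableType dd) (h : T -> R) (c : R) :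
  0 < c -> bmf h -> (forall x, c <= h x) -> bmf (fun x => (h x)^-1).
Proof.
move=> c0 [mh _] ch; have h0 x : 0 < h x := lt_le_trans c0 (ch x).
split.
  rewrite (_ : (fun x => _) = fun x => expR (- ln (h x))); last first.
    by apply/funext => x; rewrite expRN lnK// posrE.
  apply: measurableT_comp; first exact: measurable_expR.
  by apply: measurable_funN; exact: (measurableT_comp (@measurable_ln R) mh).
exists c^-1 => x; rewrite gtr0_norm ?invr_gt0//.
by rewrite lef_pV2 ?posrE.
Qed.

(** * Averages over one proposal and their increments *)

Section smoothing.
Context (R : realType) (d : nat) (r eta : R).
Hypotheses (r0 : 0 < r) (eta0 : 0 < eta) (etad : eta * d%:R <= r / 4)
  (etar : eta <= r).
Local Notation D := (@eball R d r).
Local Notation E f := (\int[lebesgue R d]_(y in D) (f y)).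

Let mD := @measurable_eball R d r.
Let finD := @lebesgue_eball_fin R d r r0.

Definition skern (x y : d.-tuple R) : R := rootk eta (vsub y x).

(* On the ball the local conductance makes the maximum redundant; outside it
   only keeps [kmass] away from 0. *)
Definition kmass (x : d.-tuple R) : R :=
  Num.max (1 / 8) (E (fun y => skern x y ^+ 2)).

(** For x in the ball, the mean of [f] at a proposal from x conditioned to stay in the ball. *)
Definition smooth (f : d.-tuple R -> R) (x : d.-tuple R) : R :=
  (kmass x)^-1 * E (fun y => f y * skern x y ^+ 2).

Definition local_var (f : d.-tuple R -> R) (x : d.-tuple R) : R :=
  (kmass x)^-1 * E (fun y => (f y - f x) ^+ 2 * skern x y ^+ 2).

Lemma bmf_skern2 :
  bmf (fun z : d.-tuple R * d.-tuple R => skern z.1 z.2).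
Proof.
apply: (bmf_comp (bmf_rootk eta0 d)).
by apply: measurable_vsub; [exact: measurable_snd|exact: measurable_fst].
Qed.

Lemma bmf_skern x : bmf (skern x).
Proof. exact: (bmf_pair1 x bmf_skern2). Qed.

Lemma bmf_kmass : bmf kmass.
Proof.
apply: bmf_max; first exact: bmf_cst.
exact: (@bmf_bint1 _ _ _ _ _ (lebesgue R d) D mD finD
  (fun z => skern z.1 z.2 ^+ 2) (bmfX 2 bmf_skern2)).
Qed.

Lemma kmass_ge x : 1 / 8 <= kmass x.
Proof. by rewrite le_max lexx. Qed.

Lemma kmass_gt0 x : 0 < kmass x.
Proof. by apply: lt_le_trans (kmass_ge x); rewrite divr_gt0. Qed.

Lemma bmf_kmassV : bmf (fun x => (kmass x)^-1).
Proof. by apply: (bmf_inv _ bmf_kmass kmass_ge); rewrite divr_gt0. Qed.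

Lemma bmf_smooth f : bmf f -> bmf (smooth f).
Proof.
move=> bf; apply: bmfM; first exact: bmf_kmassV.
apply: (@bmf_bint1 _ _ _ _ _ (lebesgue R d) D mD finD
  (fun z => f z.2 * skern z.1 z.2 ^+ 2)).
by apply: bmfM; [exact: (bmf_comp bf measurable_snd)|exact: bmfX bmf_skern2].
Qed.

Lemma bmf_local_var f : bmf f -> bmf (local_var f).
Proof.
move=> bf; apply: bmfM; first exact: bmf_kmassV.
apply: (@bmf_bint1 _ _ _ _ _ (lebesgue R d) D mD finD
  (fun z => (f z.2 - f z.1) ^+ 2 * skern z.1 z.2 ^+ 2)).
apply: bmfM; last exact: bmfX bmf_skern2.
apply: bmfX; apply: bmfB; first exact: (bmf_comp bf measurable_snd).
exact: (bmf_comp bf measurable_fst).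
Qed.

Lemma kmassE x : D x -> E (fun y => skern x y ^+ 2) = kmass x.
Proof.
move=> Dx; rewrite /kmass max_r//.
rewrite -lee_fin EFin_bmf_integral//; last exact: bmfX (bmf_skern x).
exact: (local_conductance eta0 r0 etad etar Dx).
Qed.

Section increment.
Variables (f : d.-tuple R -> R) (F : R).
Hypotheses (bf : bmf f) (F0 : 0 < F) (fF : forall x, `|f x| <= F).

(** Square root of the density of the conditioned proposal: for x in the ball its square has
    integral 1, so averages at two points can be compared by a Hellinger distance. *)
Let unitk x y := Num.sqrt (kmass x)^-1 * skern x y.

Let bmf_unitk x : bmf (unitk x).
Proof. by apply: bmfM; [exact: bmf_cst|exact: bmf_skern]. Qed.

Let unitk_sqr x y : unitk x y ^+ 2 = (kmass x)^-1 * skern x y ^+ 2.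
Proof. by rewrite exprMn sqr_sqrtr// invr_ge0 ltW// kmass_gt0. Qed.

Let unitk_mass x : D x -> E (fun y => unitk x y ^+ 2) = 1.
Proof.
move=> Dx.
transitivity (E (fun y => (kmass x)^-1 * skern x y ^+ 2)).
  by apply: bint_eq => y _; exact: unitk_sqr.
rewrite bintZl//; last exact: bmfX (bmf_skern x).
by rewrite kmassE// mulVf// gt_eqF// kmass_gt0.
Qed.

Let smoothE x : smooth f x = E (fun y => f y * unitk x y ^+ 2).
Proof.
rewrite /smooth -bintZl//; last by apply: bmfM => //; exact: bmfX (bmf_skern x).
by apply: bint_eq => y _; rewrite unitk_sqr mulrCA.
Qed.

Let local_varE x : local_var f x = E (fun y => (f y - f x) ^+ 2 * unitk x y ^+ 2).
Proof.
rewrite /local_var -bintZl//; last first.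
  by apply: bmfM; [apply: bmfX; apply: bmfB => //; exact: bmf_cst|exact: bmfX (bmf_skern x)].
by apply: bint_eq => y _; rewrite unitk_sqr mulrCA.
Qed.

Let smooth_shift x (c : R) : D x ->
  smooth f x - c = E (fun y => (f y - c) * unitk x y ^+ 2).
Proof.
move=> Dx; have bu := bmfX 2 (bmf_unitk x).
rewrite smoothE -[c in LHS]mulr1 -(unitk_mass Dx) -bintZl// -bintB//; first last.
- by apply: bmfM => //; exact: bmf_cst.
- by apply: bmfM.
by apply: bint_eq => y _; rewrite mulrBl.
Qed.

Lemma smooth_bound x : D x -> `|smooth f x| <= F.
Proof.
move=> Dx; have bu := bmfX 2 (bmf_unitk x); rewrite smoothE.
have bfu : bmf (fun y => f y * unitk x y ^+ 2) by exact: bmfM.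
have bFu : bmf (fun y => F * unitk x y ^+ 2) by apply: bmfM => //; exact: bmf_cst.
apply: (le_trans (bint_abs_le mD finD bfu)).
rewrite -[F]mulr1 -(unitk_mass Dx) -bintZl//; apply: bint_le => //.
  exact: bmf_norm.
move=> y _; rewrite normrM (ger0_norm (sqr_ge0 _)).
by apply: ler_wpM2r; [exact: sqr_ge0|exact: fF].
Qed.

Lemma smooth_error x : D x -> (f x - smooth f x) ^+ 2 <= local_var f x.
Proof.
move=> Dx; have bu := bmf_unitk x.
rewrite -opprB sqrrN smooth_shift// local_varE.
have bp : bmf (fun y => (f y - f x) * unitk x y).
  by apply: bmfM => //; apply: bmfB => //; exact: bmf_cst.
have := bint_cauchy_schwarz mD finD bp bu.
rewrite unitk_mass// mulr1 => h; apply: le_trans (le_trans _ h) _.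
  by rewrite le_eqVlt; apply/orP; left; apply/eqP; congr (_ ^+ 2);
    apply: bint_eq => y _; ring.
by rewrite le_eqVlt; apply/orP; left; apply/eqP; apply: bint_eq => y _; ring.
Qed.

Lemma local_var_ge0 x : 0 <= local_var f x.
Proof.
apply: mulr_ge0; first by rewrite invr_ge0 ltW// kmass_gt0.
by apply: bint_ge0 => y _; apply: mulr_ge0; exact: sqr_ge0.
Qed.

(** For the normalizing factors p = kmass(x)^(-1/2) and q = kmass(z)^(-1/2), the normalized squared
    distance is at most p q times the unnormalized one, and p q <= 8 because both masses are at
    least 1/8. Hence 32 = 8 * 4. *)
Lemma unitk_dist x z : D x -> D z -> sqn (vsub z x) <= (eta / 2) ^+ 2 ->
  E (fun y => (unitk z y - unitk x y) ^+ 2) <= 32 / eta ^+ 2 * sqn (vsub z x).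
Proof.
move=> Dx Dz zx.
have bx := bmf_skern x; have bz := bmf_skern z.
have bux := bmf_unitk x; have buz := bmf_unitk z.
have := @rootk_shift_dist R eta eta0 d D z x mD zx.
have bdist : bmf (fun y => (skern z y - skern x y) ^+ 2) by bmf_tac.
rewrite -[X in (X <= _)%E](EFin_bmf_integral mD finD bdist) lee_fin => h.
set p := Num.sqrt (kmass x)^-1; set q := Num.sqrt (kmass z)^-1.
have p0 : 0 <= p by exact: sqrtr_ge0.
have q0 : 0 <= q by exact: sqrtr_ge0.
have p8 w : 0 <= (kmass w)^-1 <= 8.
  rewrite invr_ge0 (ltW (kmass_gt0 w))/= invf_ple ?posrE ?kmass_gt0//.
  by have := kmass_ge w; rewrite mul1r.
have pp : p ^+ 2 = (kmass x)^-1 by rewrite sqr_sqrtr//; case/andP: (p8 x).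
have qq : q ^+ 2 = (kmass z)^-1 by rewrite sqr_sqrtr//; case/andP: (p8 z).
have pq8 : p * q <= 8.
  have /andP[_ hx] := p8 x; have /andP[_ hz] := p8 z.
  rewrite -pp in hx; rewrite -qq in hz; have := sqr_ge0 (p - q); nra.
set C := E (fun y => skern z y * skern x y).
have bC : bmf (fun y => skern z y * skern x y) by bmf_tac.
have hE : E (fun y => (skern z y - skern x y) ^+ 2) = kmass z + kmass x - 2 * C.
  have b1 : bmf (fun y => skern z y ^+ 2 + skern x y ^+ 2) by bmf_tac.
  have b2 : bmf (fun y => 2 * (skern z y * skern x y)) by bmf_tac.
  rewrite -(kmassE Dx) -(kmassE Dz) -(bintZl mD finD _ bC).
  rewrite -(bintD mD finD (bmfX 2 bz) (bmfX 2 bx)) -(bintB mD finD b1 b2).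
  by apply: bint_eq => y _; ring.
have uE : E (fun y => (unitk z y - unitk x y) ^+ 2) = 2 - 2 * (p * q) * C.
  have bu2 : bmf (fun y => unitk z y ^+ 2 + unitk x y ^+ 2) by bmf_tac.
  have b2 : bmf (fun y => (2 * (p * q)) * (skern z y * skern x y)) by bmf_tac.
  transitivity (E (fun y => unitk z y ^+ 2) + E (fun y => unitk x y ^+ 2) -
      2 * (p * q) * C); last by rewrite !unitk_mass//; ring.
  rewrite -(bintZl mD finD _ bC).
  rewrite -(bintD mD finD (bmfX 2 buz) (bmfX 2 bux)) -(bintB mD finD bu2 b2).
  by apply: bint_eq => y _; rewrite /unitk -/p -/q; ring.
rewrite uE; rewrite hE in h.
have kx : kmass x = (kmass x) * p ^+ 2 * kmass x.
  by rewrite pp mulfV ?mul1r// gt_eqF// kmass_gt0.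
have ex : p ^+ 2 * kmass x = 1 by rewrite pp mulVf// gt_eqF// kmass_gt0.
have ez : q ^+ 2 * kmass z = 1 by rewrite qq mulVf// gt_eqF// kmass_gt0.
(* AM-GM, as [kmass x = p^-2] and [kmass z = q^-2] *)
have pq2 : 2 <= (p * q) * (kmass z + kmass x).
  have pp0 : 0 < p by rewrite sqrtr_gt0 invr_gt0 kmass_gt0.
  have qp0 : 0 < q by rewrite sqrtr_gt0 invr_gt0 kmass_gt0.
  rewrite -(ler_pM2l (mulr_gt0 pp0 qp0)).
  have -> : p * q * (p * q * (kmass z + kmass x)) =
      p ^+ 2 * (q ^+ 2 * kmass z) + q ^+ 2 * (p ^+ 2 * kmass x) by ring.
  have alg (a b : R) : a * b * 2 <= a ^+ 2 * 1 + b ^+ 2 * 1.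
    by have := sqr_ge0 (a - b); lra.
  rewrite ex ez; exact: alg.
have : 2 - 2 * (p * q) * C <= (p * q) * (kmass z + kmass x - 2 * C).
  have alg (a b c : R) : 2 <= a * b -> 2 - 2 * a * c <= a * (b - 2 * c) by lra.
  exact: alg.
have h0 : 0 <= kmass z + kmass x - 2 * C.
  by rewrite -hE; apply: bint_ge0 => y _; exact: sqr_ge0.
have pqh := ler_wpM2r h0 pq8.
move=> /le_trans; apply; apply: (le_trans pqh).
have -> : 32 / eta ^+ 2 * sqn (vsub z x) = 8 * (4 / eta ^+ 2 * sqn (vsub z x)) by ring.
by rewrite ler_pM2l.
Qed.

(** A difference of two squared kernels factors as (a - b)(a + b). Cauchy-Schwarz separates the
    Hellinger distance from the integral of (f - f x)^2 (a + b)^2. In the latter, (a + b)^2 <= 4 b^2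
    + 2 (a^2 - b^2) leaves the local variance at x alone, as needed for a [Q] that depends on one
    endpoint only; the excess is of first order in |z - x| and vanishes for close points. *)
Lemma smooth_increment x z : D x -> D z -> sqn (vsub z x) <= (eta / 2) ^+ 2 ->
  (smooth f z - smooth f x) ^+ 2 <=
  32 / eta ^+ 2 * sqn (vsub z x) *
   (4 * local_var f x + 96 * F ^+ 2 * (enorm (vsub z x) / eta)).
Proof.
move=> Dx Dz zx.
set w := enorm (vsub z x).
have w0 : 0 <= w by exact: sqrtr_ge0.
have wE : sqn (vsub z x) = w ^+ 2 by rewrite /w enorm_sqn sqr_sqrtr// sqn_ge0.
have bux := bmf_unitk x; have buz := bmf_unitk z.
have bc : bmf (fun _ : d.-tuple R => f x) by exact: bmf_cst.
have bphi : bmf (fun y => f y - f x) by exact: bmfB.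
set H := 32 / eta ^+ 2 * sqn (vsub z x).
have Hd : E (fun y => (unitk z y - unitk x y) ^+ 2) <= H by exact: unitk_dist.
have H0 : 0 <= H by apply: le_trans Hd; apply: bint_ge0 => y _; exact: sqr_ge0.
have bm : bmf (fun y => unitk z y - unitk x y) by bmf_tac.
have bp : bmf (fun y => unitk z y + unitk x y) by bmf_tac.
have hp : E (fun y => (unitk z y + unitk x y) ^+ 2) <= 4.
  have b1 : bmf (fun y => 2 * unitk z y ^+ 2) by bmf_tac.
  have b2 : bmf (fun y => 2 * unitk x y ^+ 2) by bmf_tac.
  apply: (@le_trans _ _ (E (fun y => 2 * unitk z y ^+ 2 + 2 * unitk x y ^+ 2))).
    apply: bint_le => //; [by bmf_tac|by bmf_tac|].
    by move=> y _; have := sqr_ge0 (unitk z y - unitk x y); lra.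
  rewrite (bintD mD finD b1 b2) !(bintZl mD finD) ?unitk_mass//; try exact: bmfX.
  by rewrite !mulr1; lra.
have eqf : smooth f z - smooth f x =
    E (fun y => (unitk z y - unitk x y) * ((f y - f x) * (unitk z y + unitk x y))).
  (* Both conditioned densities have mass 1, so the same constant [f x] can be subtracted from [f]
     at x and at z. *)
  have -> : smooth f z - smooth f x = (smooth f z - f x) - (smooth f x - f x) by ring.
  rewrite !smooth_shift// -(bintB mD finD); [|by bmf_tac|by bmf_tac].
  by apply: bint_eq => y _; ring.
have bq : bmf (fun y => (f y - f x) * (unitk z y + unitk x y)) by exact: bmfM.
rewrite eqf; apply: (le_trans (bint_cauchy_schwarz mD finD bm bq)).
apply: ler_pM => //.
- by apply: bint_ge0 => y _; exact: sqr_ge0.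
- by apply: bint_ge0 => y _; exact: sqr_ge0.
have habs : E (fun y => `|(unitk z y - unitk x y) * (unitk z y + unitk x y)|) <= 12 * (w / eta).
  have bm' := bmf_norm bm; have bp' := bmf_norm bp.
  have := bint_cauchy_schwarz mD finD bm' bp'.
  rewrite (_ : E (fun y => `|unitk z y - unitk x y| ^+ 2) = E (fun y => (unitk z y - unitk x y) ^+ 2)); last first.
    by apply: bint_eq => y _; rewrite real_normK// num_real.
  rewrite (_ : E (fun y => `|unitk z y + unitk x y| ^+ 2) = E (fun y => (unitk z y + unitk x y) ^+ 2)); last first.
    by apply: bint_eq => y _; rewrite real_normK// num_real.
  rewrite (_ : E (fun y => `|unitk z y - unitk x y| * `|unitk z y + unitk x y|) =
    E (fun y => `|(unitk z y - unitk x y) * (unitk z y + unitk x y)|)); last first.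
    by apply: bint_eq => y _; rewrite normrM.
  move=> cs; rewrite -(ler_pXn2r (_ : (0 < 2)%N)) ?nnegrE//; last 2 first.
  - by apply: bint_ge0 => y _.
  - by rewrite mulr_ge0// divr_ge0// ltW.
  apply: (le_trans cs); apply: (@le_trans _ _ (H * 4)).
    by apply: ler_pM => //; apply: bint_ge0 => y _; exact: sqr_ge0.
  (* 4 H equals 128 |z - x|^2 / eta^2, and 128 <= 144 = 12^2. *)
  rewrite /H wE; have -> : (12 * (w / eta)) ^+ 2 = 144 * (w ^+ 2 / eta ^+ 2).
    by rewrite exprMn expr_div_n; ring.
  have : 0 <= w ^+ 2 / eta ^+ 2 by rewrite divr_ge0 ?sqr_ge0.
  have -> : 32 / eta ^+ 2 * w ^+ 2 * 4 = 128 * (w ^+ 2 / eta ^+ 2) by ring.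
  lra.
have b3 : bmf (fun y => 4 * ((f y - f x) ^+ 2 * unitk x y ^+ 2)) by bmf_tac.
have b4 : bmf (fun y => (8 * F ^+ 2) * `|(unitk z y - unitk x y) * (unitk z y + unitk x y)|).
  by apply: bmfM; [exact: bmf_cst|apply: bmf_norm; exact: bmfM].
apply: (@le_trans _ _ (E (fun y => 4 * ((f y - f x) ^+ 2 * unitk x y ^+ 2) +
    (8 * F ^+ 2) * `|(unitk z y - unitk x y) * (unitk z y + unitk x y)|))).
  apply: bint_le => //; [exact: bmfX|exact: bmfD|].
  move=> y _; rewrite exprMn.
  have phiF : (f y - f x) ^+ 2 <= 4 * F ^+ 2.
    have := fF x; have := fF y; rewrite !ler_norml => /andP[? ?] /andP[? ?]; nra.
  have alg (P a b N : R) : 0 <= P -> P <= 4 * F ^+ 2 -> 0 <= N ->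
      (a - b) * (a + b) <= N ->
      P * (a + b) ^+ 2 <= 4 * (P * b ^+ 2) + 8 * F ^+ 2 * N.
    move=> P0 PF N0 ab.
    have h1 : P * ((a - b) * (a + b)) <= P * N by exact: ler_wpM2l.
    have h2 : P * N <= 4 * F ^+ 2 * N by exact: ler_wpM2r.
    have h3 : P * (a + b) ^+ 2 <= P * (2 * a ^+ 2 + 2 * b ^+ 2).
      by apply: ler_wpM2l => //; have := sqr_ge0 (a - b); lra.
    lra.
  by apply: alg; [exact: sqr_ge0|exact: phiF|exact: normr_ge0|exact: ler_norm].
rewrite (bintD mD finD b3 b4) (bintZl mD finD); last by bmf_tac.
rewrite (bintZl mD finD); last by apply: bmf_norm; exact: bmfM.
rewrite -local_varE lerD2l.
have -> : 96 * F ^+ 2 * (w / eta) = 8 * F ^+ 2 * (12 * (w / eta)) by ring.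
by apply: ler_wpM2l => //; rewrite mulr_ge0// sqr_ge0.
Qed.

End increment.

End smoothing.

Ltac gt0_tac := repeat first
  [ assumption | by rewrite ltr0n | apply: divr_gt0 | apply: mulr_gt0
  | apply: exprn_gt0 | apply: addr_gt0 | by rewrite invr_gt0 ].
Ltac ge0_tac := repeat first
  [ assumption | exact: sqr_ge0 | exact: ler0n | exact: ltW | apply: divr_ge0
  | apply: mulr_ge0 | apply: exprn_ge0 | apply: addr_ge0 ].

Section nonlocal_poincare.
Context (R : realType) (d : nat) (r eta : R).
Hypotheses (r0 : 0 < r) (eta0 : 0 < eta) (etad : eta * d%:R <= r / 4)
  (etar : eta <= r).
Local Notation D := (@eball R d r).
Local Notation E f := (\int[lebesgue R d]_(y in D) (f y)).
Local Notation smooth := (smooth r eta).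
Local Notation local_var := (local_var r eta).
Local Notation skern := (skern eta).

Let mD := @measurable_eball R d r.
Let finD := @lebesgue_eball_fin R d r r0.

Variables (rt : d.-tuple R -> R).
Hypotheses (brt : bmf rt) (rt0 : forall x, D x -> 0 <= rt x)
  (rtm : 0 < E rt)
  (rtc : forall x y, D x -> D y ->
    rt x * rt y * (1 + sqn (vsub x y) / (4 * r ^+ 2)) <=
    rt (vconv 2^-1 x y) ^+ 2).

(** [s] is the distance up to which the increment bound is used. The parameter e of [pl_variance] is
    fixed so that |e g| <= T0 / 8 with T0 = s^2 / r^2; it is positive but drops out of the
    conclusion, so only [s] remains as an error parameter. *)
Lemma smooth_variance_sigma (f : d.-tuple R -> R) (F s : R) :
  bmf f -> 0 < F -> (forall x, `|f x| <= F) -> 0 < s -> s <= eta / 2 ->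
  E rt * E (fun x => smooth f x ^+ 2 * rt x) - E (fun x => smooth f x * rt x) ^+ 2 <=
  E rt * (40 * r ^+ 2 / eta ^+ 2 *
    (4 * E (fun x => local_var f x * rt x) + 96 * F ^+ 2 * (s / eta) * E rt)).
Proof.
move=> bf F0 fF s0 se.
have bg : bmf (smooth f) by exact: bmf_smooth.
have bl : bmf (local_var f) by exact: bmf_local_var.
(* 40 = 32 * 5/4, where 5/4 bounds the factor 1 + T for points at distance at most [s]. *)
pose Q x := 40 * r ^+ 2 / eta ^+ 2 * (4 * local_var f x + 96 * F ^+ 2 * (s / eta)).
have bQ : bmf Q by rewrite /Q; bmf_tac.
have A0 : 0 <= 40 * r ^+ 2 / eta ^+ 2 by ge0_tac.
have c0 : 0 <= 96 * F ^+ 2 * (s / eta).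
  by ge0_tac.
have Q0 x : 0 <= Q x.
  by rewrite /Q mulr_ge0// addr_ge0// mulr_ge0// local_var_ge0.
pose T0 := s ^+ 2 / r ^+ 2.
have T00 : 0 < T0 by rewrite divr_gt0 ?exprn_gt0.
have T01 : T0 <= 1 / 4.
  rewrite /T0 ler_pdivrMr ?exprn_gt0//.
  have : s <= r / 2 by have := etar; lra.
  by move=> sr; have := s0; nra.
pose e := T0 / (8 * F).
have e0 : 0 < e by rewrite /e; gt0_tac.
have eg x : D x -> `|e * smooth f x| <= T0 / 8.
  move=> Dx; rewrite normrM gtr0_norm//.
  have -> : T0 / 8 = e * F by rewrite /e; field; rewrite gt_eqF.
  by rewrite ler_pM2l//; exact: (smooth_bound r0 eta0 etad etar bf fF Dx).
have eg' x : D x -> - (T0 / 8) <= e * smooth f x <= T0 / 8.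
  by move=> Dx; rewrite -ler_norml eg.
have := @pl_variance R d r r0 rt (smooth f) Q e e0 brt bg bQ rt0.
have h1 x : D x -> 0 <= 1 + e * smooth f x.
  by move=> Dx; have /andP[? _] := eg' x Dx; lra.
move=> /(_ h1 rtc) h.
apply: le_trans (h _) _ => {h}; last first.
  rewrite le_eqVlt; apply/orP; left; apply/eqP; congr (_ * _).
  have b1 : bmf (fun x => local_var f x * rt x) by bmf_tac.
  have b2 : bmf (fun x => 4 * (local_var f x * rt x)) by bmf_tac.
  have b3 : bmf (fun x => (96 * F ^+ 2 * (s / eta)) * rt x) by bmf_tac.
  rewrite -(bintZl mD finD _ b1) -(bintZl mD finD _ brt) -(bintD mD finD b2 b3).
  rewrite -(bintZl mD finD); last by bmf_tac.
  by apply: bint_eq => x _; rewrite /Q; ring.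
move=> x y Dx Dy.
have Dm : D (vconv 2^-1 x y).
  apply: eball_vconv => //; apply/andP; split; first by rewrite invr_ge0.
  by rewrite invf_le1// ler1n.
set z := vconv 2^-1 x y in Dm *.
have qE : sqn (vsub x y) = 4 * sqn (vsub z x).
  by rewrite /z sqn_vsub_mid; field.
set q := sqn (vsub z x) in qE.
have q0 : 0 <= q by exact: sqn_ge0.
pose T := q / r ^+ 2.
have -> : sqn (vsub x y) / (4 * r ^+ 2) = T.
  by rewrite qE /T; field; rewrite gt_eqF.
have Tq : q = T * r ^+ 2 by rewrite /T; field; rewrite gt_eqF.
have Tp : 0 <= T by rewrite divr_ge0 ?sqr_ge0.
have [qs|qs] := leP q (s ^+ 2); last first.
  (* far apart points: e is so small that the factor 1 + T absorbs the
     variation of (1 + e g)^2 *)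
  have TT : T0 <= T by rewrite /T /T0 ler_pM2r ?invr_gt0 ?exprn_gt0// ltW.
  have /andP[gx1 gx2] := eg' x Dx; have /andP[gz1 gz2] := eg' z Dm.
  move: gx1 gx2 gz1 gz2; move: (e * smooth f x) (e * smooth f z) => a b a1 a2 b1 b2.
  have : 0 <= e ^+ 2 * Q x by rewrite mulr_ge0 ?sqr_ge0.
  have : (1 + a) ^+ 2 <= (1 + T0 / 8) ^+ 2 by rewrite lerXn2r ?nnegrE//; lra.
  have : (1 - T0 / 8) ^+ 2 <= (1 + b) ^+ 2 by rewrite lerXn2r ?nnegrE//; lra.
  have : (1 + T0 / 8) ^+ 2 <= (1 - T0 / 8) ^+ 2 * (1 + T0) by nra.
  have : (1 - T0 / 8) ^+ 2 * (1 + T0) <= (1 - T0 / 8) ^+ 2 * (1 + T).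
    by apply: ler_wpM2l; [exact: sqr_ge0|lra].
  move: (_ * Q x) => Z h1' h2 h3 h4 h5.
  have := ler_wpM2r (_ : 0 <= 1 + T) h3; lra.
have qe : sqn (vsub z x) <= (eta / 2) ^+ 2.
  apply: (le_trans qs); rewrite lerXn2r ?nnegrE ?divr_ge0//; exact: ltW.
have inc := smooth_increment r0 eta0 etad etar bf fF Dx Dm qe.
have we : enorm (vsub z x) <= s.
  rewrite enorm_sqn -[leRHS]ger0_norm; last exact: ltW.
  by rewrite -sqrtr_sqr ler_sqrt ?sqr_ge0.
pose Y := 4 * local_var f x + 96 * F ^+ 2 * (s / eta).
have Y0 : 0 <= Y by rewrite addr_ge0// mulr_ge0// local_var_ge0.
have inc2 : (smooth f z - smooth f x) ^+ 2 <= T * (32 * r ^+ 2 / eta ^+ 2 * Y).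
  apply: (le_trans inc); rewrite -/q Tq.
  have -> : T * (32 * r ^+ 2 / eta ^+ 2 * Y) = 32 / eta ^+ 2 * (T * r ^+ 2) * Y by ring.
  apply: ler_wpM2l.
    by ge0_tac.
  rewrite lerD2l; apply: ler_wpM2l; first by ge0_tac.
  by rewrite ler_pM2r ?invr_gt0.
have T14 : T <= 1 / 4.
  apply: le_trans T01; rewrite /T /T0 ler_pM2r ?invr_gt0 ?exprn_gt0//.
have inc3 : (smooth f z - smooth f x) ^+ 2 * (1 + T) <= T * Q x.
  have -> : T * Q x = T * (32 * r ^+ 2 / eta ^+ 2 * Y) * (5 / 4).
    have alg (t a b v : R) : t * (40 * a * b * v) = t * (32 * a * b * v) * (5 / 4).
      by field.
    exact: alg.
  apply: ler_pM => //; [exact: sqr_ge0|by rewrite addr_ge0|by lra].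
(* For T = 0 the increment is 0; otherwise the claim may be multiplied by T. *)
have [T0'|Tn] := eqVneq T 0.
  rewrite T0' addr0 !mulr1; move: inc2; rewrite T0' mul0r => h.
  have : (smooth f z - smooth f x) ^+ 2 = 0.
    by apply/le_anti; rewrite h sqr_ge0.
  move/eqP; rewrite sqrf_eq0 subr_eq0 => /eqP ->.
  by rewrite gerBl mulr_ge0 ?sqr_ge0.
have {}Tp : 0 < T by rewrite lt_neqAle eq_sym Tn.
rewrite -(ler_pM2l Tp).
have e20 : 0 <= e ^+ 2 by exact: sqr_ge0.
have := ler_wpM2l e20 inc3.
have alg (a b t ee qq : R) : 0 < t ->
    ee ^+ 2 * ((b - a) ^+ 2 * (1 + t)) <= ee ^+ 2 * (t * qq) ->
    t * ((1 + ee * a) ^+ 2 - ee ^+ 2 * qq) <= t * ((1 + ee * b) ^+ 2 * (1 + t)).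
  move=> t0 h.
  (* T times the difference of the two sides is this square plus e^2 (T Q - (1 + T) (b - a)^2). *)
  have := sqr_ge0 ((1 + ee * b) * t + ee * (b - a)); lra.
exact: alg.
Qed.

(** The excess in the previous bound is linear in [s], and [s] may be taken arbitrarily small. *)
Lemma smooth_variance (f : d.-tuple R -> R) : bmf f ->
  E rt * E (fun x => smooth f x ^+ 2 * rt x) - E (fun x => smooth f x * rt x) ^+ 2 <=
  E rt * (160 * r ^+ 2 / eta ^+ 2 * E (fun x => local_var f x * rt x)).
Proof.
move=> bf; have [F F0 fF] := bmf_bound bf.
set V := _ - _; set J := E (fun x => local_var f x * rt x).
apply/ler_addgt0Pr => e e0.
pose c := E rt * (40 * r ^+ 2 / eta ^+ 2) * (96 * F ^+ 2 / eta * E rt).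
have c0 : 0 < c.
  by rewrite /c; gt0_tac.
pose s := Num.min (eta / 2) (e / c).
have s0 : 0 < s by rewrite lt_min !divr_gt0.
have se : s <= eta / 2 by rewrite ge_min lexx.
apply: (le_trans (smooth_variance_sigma bf F0 fF s0 se)); rewrite -/J.
have -> : E rt * (40 * r ^+ 2 / eta ^+ 2 * (4 * J + 96 * F ^+ 2 * (s / eta) * E rt)) =
  E rt * (160 * r ^+ 2 / eta ^+ 2 * J) + s * c by rewrite /c; ring.
rewrite lerD2l; apply: (@le_trans _ _ (e / c * c)).
  by apply: ler_wpM2r; [exact: ltW|rewrite ge_min lexx orbT].
by rewrite divfK// gt_eqF.
Qed.

(** [f] is split into its average and the remainder, the latter being controlled by [smooth_error].
    The weights 21/20 and 21 of the split put almost no extra cost on the dominating part: 160 *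
    21/20 = 168. The factor 8 bounds the inverse of [kmass]. *)
Lemma nonlocal_poincare_weight (f : d.-tuple R -> R) : bmf f ->
  exists c : R, E (fun x => (f x - c) ^+ 2 * rt x) <=
  8 * (168 * (r ^+ 2 / eta ^+ 2) + 21) *
  E (fun x => E (fun y => rt x * skern x y ^+ 2 * (f y - f x) ^+ 2)).
Proof.
move=> bf; have [F F0 fF] := bmf_bound bf.
have bg : bmf (smooth f) by exact: bmf_smooth.
have bl : bmf (local_var f) by exact: bmf_local_var.
set M := E rt; have Mp : 0 < M := rtm.
set G1 := E (fun x => smooth f x * rt x).
set G2 := E (fun x => smooth f x ^+ 2 * rt x).
set J := E (fun x => local_var f x * rt x).
have J0 : 0 <= J.
  by apply: bint_ge0 => x Dx; rewrite mulr_ge0 ?rt0// local_var_ge0.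
pose c := G1 / M; exists c.
have Vg : E (fun x => (smooth f x - c) ^+ 2 * rt x) <= 160 * r ^+ 2 / eta ^+ 2 * J.
  have -> : E (fun x => (smooth f x - c) ^+ 2 * rt x) = G2 - 2 * c * G1 + c ^+ 2 * M.
    have b1 : bmf (fun x => smooth f x * rt x) by bmf_tac.
    have b2 : bmf (fun x => smooth f x ^+ 2 * rt x) by bmf_tac.
    have b3 : bmf (fun x => (2 * c) * (smooth f x * rt x)) by bmf_tac.
    have b4 : bmf (fun x => c ^+ 2 * rt x) by bmf_tac.
    have b5 : bmf (fun x => smooth f x ^+ 2 * rt x - (2 * c) * (smooth f x * rt x)) by bmf_tac.
    rewrite -(bintZl mD finD _ b1) -(bintZl mD finD _ brt) -(bintB mD finD b2 b3).
    rewrite -(bintD mD finD b5 b4).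
    by apply: bint_eq => x _; ring.
  rewrite -(ler_pM2l Mp).
  have -> : M * (G2 - 2 * c * G1 + c ^+ 2 * M) = M * G2 - G1 ^+ 2.
    by rewrite /c; field; rewrite gt_eqF.
  exact: smooth_variance.
have step1 : E (fun x => (f x - c) ^+ 2 * rt x) <= (168 * (r ^+ 2 / eta ^+ 2) + 21) * J.
  have b1 : bmf (fun x => (smooth f x - c) ^+ 2 * rt x) by bmf_tac.
  have b2 : bmf (fun x => local_var f x * rt x) by bmf_tac.
  have b3 : bmf (fun x => 21 / 20 * ((smooth f x - c) ^+ 2 * rt x)) by bmf_tac.
  have b4 : bmf (fun x => 21 * (local_var f x * rt x)) by bmf_tac.
  apply: (@le_trans _ _ (E (fun x => 21 / 20 * ((smooth f x - c) ^+ 2 * rt x) +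
      21 * (local_var f x * rt x)))).
    apply: bint_le => //; [by bmf_tac|exact: bmfD|].
    move=> x Dx; have := smooth_error r0 eta0 etad etar bf Dx.
    have := rt0 Dx; move: (rt x) (f x) (smooth f x) (local_var f x) => p a b v p0 h.
    have h2 : (a - c) ^+ 2 <= 21 / 20 * (b - c) ^+ 2 + 21 * v.
      by have := sqr_ge0 ((b - c) - 20 * (a - b)); lra.
    by have := ler_wpM2r p0 h2; lra.
  rewrite (bintD mD finD b3 b4) (bintZl mD finD _ b1) (bintZl mD finD _ b2) -/J.
  have := Vg.
  have -> : 160 * r ^+ 2 / eta ^+ 2 * J = 160 * (r ^+ 2 / eta ^+ 2 * J) by ring.
  by rewrite mulrDl -!mulrA; move: (_ * (_ * J)) => q; lra.
apply: (le_trans step1).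
set X := 168 * _ + 21; rewrite [8 * X]mulrC -[leRHS]mulrA; apply: ler_wpM2l.
  have rr0 : 0 <= r ^+ 2 / eta ^+ 2 by rewrite divr_ge0// sqr_ge0.
  by rewrite /X addr_ge0// mulr_ge0.
have bI : bmf (fun x => E (fun y => (f y - f x) ^+ 2 * skern x y ^+ 2)).
  apply: (@bmf_bint1 _ _ _ _ _ (lebesgue R d) D mD finD
    (fun z => (f z.2 - f z.1) ^+ 2 * skern z.1 z.2 ^+ 2)).
  apply: bmfM; last exact: bmfX (bmf_skern2 d eta0).
  apply: bmfX; apply: bmfB; first exact: (bmf_comp bf measurable_snd).
  exact: (bmf_comp bf measurable_fst).
have bxy x : bmf (fun y => (f y - f x) ^+ 2 * skern x y ^+ 2).
  apply: bmfM; first by bmf_tac.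
  exact: bmfX (bmf_skern eta0 x).
have eqI : E (fun x => E (fun y => rt x * skern x y ^+ 2 * (f y - f x) ^+ 2)) =
    E (fun x => rt x * E (fun y => (f y - f x) ^+ 2 * skern x y ^+ 2)).
  apply: bint_eq => x _; rewrite -(bintZl mD finD _ (bxy x)).
  by apply: bint_eq => y _; ring.
rewrite eqI -(bintZl mD finD); last by bmf_tac.
apply: bint_le => //; [by bmf_tac|by bmf_tac|].
move=> x Dx; rewrite /local_var.
have k8 : (kmass r eta x)^-1 <= 8.
  rewrite invf_ple ?posrE ?kmass_gt0//; have := kmass_ge r eta x; rewrite mul1r.
  by [].
have I0 : 0 <= E (fun y => (f y - f x) ^+ 2 * skern x y ^+ 2).
  by apply: bint_ge0 => y _; apply: mulr_ge0; exact: sqr_ge0.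
rewrite -mulrA; apply: (le_trans (ler_wpM2r (mulr_ge0 I0 (rt0 Dx)) k8)).
by rewrite [rt x * _]mulrC.
Qed.

End nonlocal_poincare.

(** * Log-concave densities on the ball and the choice of the step size *)

Section density.
Context (R : realType) (d : nat) (r L : R) (rho : d.-tuple R -> R).
Hypotheses (r0 : 0 < r) (L0 : 0 <= L) (rhoP : RL L (@eball R d r) rho).
Local Notation D := (@eball R d r).
Local Notation E f := (\int[lebesgue R d]_(y in D) (f y)).

Let mD := @measurable_eball R d r.
Let finD := @lebesgue_eball_fin R d r r0.

Definition dimK : R := (d%:R + 1) * Num.max (r ^+ 2 * L ^+ 2) (d%:R + 1).

Definition stepsize : R := r / (4 * Num.sqrt dimK).

Definition rho0 : d.-tuple R -> R := rho \_ D.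

Lemma dimK_ge1 : 1 <= dimK.
Proof.
have d1 : 1 <= d%:R + 1 :> R by rewrite lerDr.
have d2 : 1 <= Num.max (r ^+ 2 * L ^+ 2) (d%:R + 1) by rewrite le_max d1 orbT.
rewrite /dimK; apply: (le_trans d1); by apply: ler_peMr.
Qed.

Lemma dimK_ge_sqr : (d%:R + 1) ^+ 2 <= dimK.
Proof. by rewrite /dimK expr2 ler_wpM2l ?addr_ge0// le_max lexx orbT. Qed.

Lemma dimK_ge_lip : (d%:R + 1) * (r ^+ 2 * L ^+ 2) <= dimK.
Proof. by rewrite /dimK ler_wpM2l ?addr_ge0// le_max lexx. Qed.

Lemma dimK_gt0 : 0 < dimK.
Proof. exact: lt_le_trans dimK_ge1. Qed.

Lemma sqrt_dimK_ge : d%:R + 1 <= Num.sqrt dimK.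
Proof.
have d0 : 0 <= d%:R + 1 :> R by rewrite addr_ge0.
rewrite -[leLHS]ger0_norm// -sqrtr_sqr ler_sqrt ?dimK_ge_sqr//.
exact: ltW dimK_gt0.
Qed.

Lemma stepsize_gt0 : 0 < stepsize.
Proof. by rewrite divr_gt0// mulr_gt0// sqrtr_gt0 dimK_gt0. Qed.

Lemma stepsize_sqr : stepsize ^+ 2 = r ^+ 2 / (16 * dimK).
Proof.
rewrite /stepsize expr_div_n exprMn sqr_sqrtr; last exact: ltW dimK_gt0.
by congr (_ / (_ * _)); ring.
Qed.

Lemma stepsize_dim : stepsize * d%:R <= r / 4.
Proof.
have s0 : 0 < Num.sqrt dimK by rewrite sqrtr_gt0 dimK_gt0.
rewrite /stepsize mulrAC ler_pdivrMr ?mulr_gt0//.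
have -> : r / 4 * (4 * Num.sqrt dimK) = r * Num.sqrt dimK by field.
rewrite ler_pM2l//; apply: le_trans sqrt_dimK_ge; lra.
Qed.

Lemma stepsize_le : stepsize <= r.
Proof.
have s0 : 0 < Num.sqrt dimK by rewrite sqrtr_gt0 dimK_gt0.
rewrite /stepsize ler_pdivrMr ?mulr_gt0// -[leLHS]mulr1 ler_pM2l//.
have := sqrt_dimK_ge; have : 0 <= d%:R :> R by []. lra.
Qed.

Lemma rho0E x : D x -> rho0 x = rho x.
Proof. by move=> Dx; rewrite /rho0 patchE mem_set. Qed.

Lemma rho0N x : ~ D x -> rho0 x = 0.
Proof. by move=> Dx; rewrite /rho0 patchE memNset. Qed.

Lemma rho0_gt0 x : D x -> 0 < rho0 x.
Proof. by move=> Dx; rewrite rho0E//; case: rhoP => + _ _; exact. Qed.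

Lemma rho0_ge0 x : 0 <= rho0 x.
Proof.
have [Dx|Dx] := pselect (D x); last by rewrite rho0N.
exact: ltW (rho0_gt0 Dx).
Qed.

Lemma rho0_lip x y : D x -> D y ->
  rho0 x <= rho0 y * expR (L * enorm (vsub x y)).
Proof.
move=> Dx Dy; have x0 := rho0_gt0 Dx; have y0 := rho0_gt0 Dy.
rewrite -ler_ln ?posrE ?mulr_gt0 ?expR_gt0// lnM ?posrE ?expR_gt0// expRK.
rewrite -lerBlDl !rho0E//; apply: (le_trans (ler_norm _)).
by case: rhoP => _ _; apply.
Qed.

Lemma rho0_ratio x y : D x -> D y -> rho0 x <= rho0 y * expR (2 * (L * r)).
Proof.
move=> Dx Dy; apply: (le_trans (rho0_lip Dx Dy)).
apply: ler_wpM2l; first exact: rho0_ge0.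
rewrite ler_expR mulrCA; apply: ler_wpM2l => //.
exact: enorm_vsub_eball.
Qed.

Lemma bmf_rho0 : bmf rho0.
Proof.
pose o : d.-tuple R := [tuple 0 | i < d].
apply: (bmf_restrict (M := rho0 o * expR (2 * (L * r)))) => //.
  exact: measurable_RL mD rhoP.
move=> x Dx; rewrite -rho0E// ger0_norm ?rho0_ge0//.
by apply: rho0_ratio => //; exact: eball0.
Qed.

Lemma expR_quarter : expR (1 / 4 : R) <= 4 / 3.
Proof.
have := expR_ge1Dx (- (1 / 4) : R); rewrite expRN => h.
have e0 := expR_gt0 (1 / 4 : R).
have : 3 / 4 * expR (1 / 4) <= (expR (1 / 4))^-1 * expR (1 / 4) :> R.
  by apply: ler_wpM2r; [exact: ltW|lra].
rewrite mulVf ?gt_eqF//; lra.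
Qed.

(** A step is at most eta sqrt d long, and (L eta)^2 d <= 1/16 since K dominates (d + 1) r^2 L^2. So
    the logarithm of the density changes by at most 1/4. *)
Lemma rho0_close x y : D x -> D y -> skern stepsize x y != 0 ->
  rho0 x <= 4 / 3 * Num.min (rho0 x) (rho0 y).
Proof.
move=> Dx Dy k0.
have x0 := rho0_gt0 Dx; have y0 := rho0_gt0 Dy.
have h : rho0 x <= rho0 y * (4 / 3).
  apply: (le_trans (rho0_lip Dx Dy)); apply: ler_wpM2l; first exact: rho0_ge0.
  apply: le_trans expR_quarter; rewrite ler_expR.
  have := sqn_support stepsize_gt0 k0.
  rewrite sqn_vsubC stepsize_sqr => sq.
  have e0 : 0 <= enorm (vsub x y) by exact: sqrtr_ge0.
  rewrite -(ler_pXn2r (_ : (0 < 2)%N)) ?nnegrE ?mulr_ge0//.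
  rewrite exprMn enorm_sqn sqr_sqrtr ?sqn_ge0//.
  apply: (@le_trans _ _ (L ^+ 2 * (d%:R * (r ^+ 2 / (16 * dimK))))).
    by apply: ler_wpM2l => //; exact: sqr_ge0.
  have -> : L ^+ 2 * (d%:R * (r ^+ 2 / (16 * dimK))) =
      d%:R * (r ^+ 2 * L ^+ 2) / (16 * dimK) by ring.
  have k16 : 0 < 16 * dimK by apply: mulr_gt0 => //; exact: dimK_gt0.
  rewrite (ler_pdivrMr _ _ k16).
  have -> : (1 / 4) ^+ 2 * (16 * dimK) = dimK by field.
  apply: le_trans dimK_ge_lip; apply: ler_wpM2r; last by rewrite lerDl.
  by apply: mulr_ge0; exact: sqr_ge0.
by rewrite minElt; case: ifP => _; lra.
Qed.

Definition rhot (x : d.-tuple R) : R := rho0 x * expR (- (sqn x / (2 * r ^+ 2))).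

Lemma rhot_le x : rhot x <= rho0 x.
Proof.
rewrite /rhot ler_piMr ?rho0_ge0// -[leRHS]expR0 ler_expR oppr_le0.
by rewrite divr_ge0 ?sqn_ge0// mulr_ge0// sqr_ge0.
Qed.

Lemma rhot_ge0 x : 0 <= rhot x.
Proof. by rewrite mulr_ge0 ?rho0_ge0// expR_ge0. Qed.

Lemma measurable_sqn : measurable_fun setT (@sqn R d).
Proof.
apply: measurable_sum => i; apply: measurable_funX; exact: measurable_tnth.
Qed.

Lemma bmf_rhot : bmf rhot.
Proof.
have [M M0 hM] := bmf_bound bmf_rho0; split.
  apply: measurable_funM; first by case: bmf_rho0.
  apply: measurableT_comp; first exact: measurable_expR.
  apply: measurable_funN; apply: measurable_funM; last exact: measurable_cst.
  exact: measurable_sqn.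
exists M => x; rewrite ger0_norm ?rhot_ge0//; apply: (le_trans (rhot_le x)).
by apply: le_trans (hM x); exact: ler_norm.
Qed.

Lemma rhot_ge x : D x -> rho0 x <= 16 / 9 * rhot x.
Proof.
move=> Dx; rewrite /rhot mulrCA -[leLHS]mulr1; apply: ler_wpM2l.
  exact: rho0_ge0.
have /(eball_sqn _ (ltW r0)) sx := Dx.
have e2 : expR (- (1 / 2)) <= expR (- (sqn x / (2 * r ^+ 2))).
  by rewrite ler_expR lerN2 ler_pdivrMr ?mulr_gt0 ?exprn_gt0//; lra.
(* Squaring exp (- 1/4) >= 3/4 gives 9/16 for exp (- 1/2), better than the tangent bound 1/2. *)
have : (3 / 4) ^+ 2 <= expR (- (1 / 4) : R) ^+ 2.
  rewrite lerXn2r ?nnegrE ?expR_ge0//.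
  by apply: le_trans (expR_ge1Dx _); lra.
rewrite -expRM_natl (_ : _ * - (1 / 4) = - (1 / 2)); last by field.
by move=> /le_trans/(_ e2) h; lra.
Qed.

Lemma rho0_mid x y : D x -> D y ->
  rho0 x * rho0 y <= rho0 (vconv 2^-1 x y) ^+ 2.
Proof.
move=> Dx Dy; have x0 := rho0_gt0 Dx; have y0 := rho0_gt0 Dy.
have h01 : 0 < (2^-1 : R) < 1 by rewrite invr_gt0 ltr0n invf_lt1// ltr1n.
have Dm : D (vconv 2^-1 x y).
  by apply: eball_vconv => //; case/andP: h01 => /ltW -> /ltW.
have [_ lc _] := rhoP; have := lc x y _ Dx Dy h01.
rewrite -!rho0E// => h.
have p0 : 0 <= rho0 x `^ 2^-1 * rho0 y `^ (1 - 2^-1).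
  by rewrite mulr_ge0// powR_ge0.
apply: (@le_trans _ _ ((rho0 x `^ 2^-1 * rho0 y `^ (1 - 2^-1)) ^+ 2)).
  have hE : 1 - 2^-1 = 2^-1 :> R by field.
  rewrite hE exprMn !powR12_sqrt; [|exact: ltW|exact: ltW].
  by rewrite !sqr_sqrtr// ltW.
by rewrite lerXn2r ?nnegrE ?rho0_ge0.
Qed.

(** By the parallelogram identity the Gaussian factor gains exactly exp (|x - y|^2 / (4 r^2)) at the
    midpoint, of which the first two terms of the series are kept. *)
Lemma rhot_mid x y : D x -> D y ->
  rhot x * rhot y * (1 + sqn (vsub x y) / (4 * r ^+ 2)) <=
  rhot (vconv 2^-1 x y) ^+ 2.
Proof.
move=> Dx Dy; rewrite /rhot [leRHS]exprMn.
set T := sqn (vsub x y) / (4 * r ^+ 2).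
have -> : expR (- (sqn (vconv 2^-1 x y) / (2 * r ^+ 2))) ^+ 2 =
    expR (- (sqn x / (2 * r ^+ 2))) * expR (- (sqn y / (2 * r ^+ 2))) * expR T.
  rewrite -expRM_natl -!expRD; congr expR; rewrite sqn_vconv /T.
  by field; rewrite gt_eqF.
have -> : forall a b c e t : R, a * c * (b * e) * (1 + t) = (a * b) * (c * e * (1 + t)).
  by move=> *; ring.
apply: ler_pM.
- by rewrite mulr_ge0// rho0_ge0.
- apply: mulr_ge0; first by rewrite mulr_ge0// expR_ge0.
  by rewrite addr_ge0// divr_ge0 ?sqn_ge0// mulr_ge0// sqr_ge0.
- exact: rho0_mid.
- by apply: ler_wpM2l; [rewrite mulr_ge0// expR_ge0|exact: expR_ge1Dx].
Qed.

(** The bounded kernel at the origin has integral at least 1/8 over the ball by [local_conductance],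
    so the ball cannot be a null set. *)
Lemma volume_eball_gt0 : 0 < fine (lebesgue R d D).
Proof.
pose o : d.-tuple R := [tuple 0 | i < d].
have bk := bmfX 2 (bmf_skern stepsize_gt0 o).
have [M M0 hM] := bmf_bound bk.
have := local_conductance stepsize_gt0 r0 stepsize_dim stepsize_le (@eball0 R d r r0).
rewrite -EFin_bmf_integral// lee_fin => h.
rewrite -(ltr_pM2l M0) mulr0; apply: lt_le_trans (_ : 1 / 8 <= _); first by lra.
apply: (le_trans h); rewrite -bint_cst//; apply: bint_le => //.
  exact: bmf_cst.
by move=> x _; apply: (le_trans (ler_norm _)); exact: hM.
Qed.

Lemma bint_gt0 (f : d.-tuple R -> R) (c : R) : bmf f -> 0 < c ->
  (forall x, D x -> c <= f x) -> 0 < E f.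
Proof.
move=> bf c0 cf; apply: (@lt_le_trans _ _ (c * fine (lebesgue R d D))).
  by rewrite mulr_gt0// volume_eball_gt0.
by rewrite -bint_cst//; apply: bint_le => //; exact: bmf_cst.
Qed.

Lemma rho0_mass_gt0 : 0 < E rho0.
Proof.
pose o : d.-tuple R := [tuple 0 | i < d].
have Do : D o by exact: eball0.
apply: (@bint_gt0 _ (rho0 o / expR (2 * (L * r)))) bmf_rho0 _ _.
  by rewrite divr_gt0 ?expR_gt0 ?rho0_gt0.
by move=> x Dx; rewrite ler_pdivrMr ?expR_gt0//; exact: rho0_ratio.
Qed.

Lemma rhot_mass_gt0 : 0 < E rhot.
Proof.
have : E rho0 <= 16 / 9 * E rhot.
  rewrite -bintZl//; last exact: bmf_rhot.
  apply: bint_le => //; [exact: bmf_rho0| |exact: rhot_ge].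
  by apply: bmfM; [exact: bmf_cst|exact: bmf_rhot].
have := rho0_mass_gt0; lra.
Qed.

(** The constant collects 16/9 for removing the Gaussian factor, 8 (168 * 16 K + 21) from the
    weighted inequality with r^2 / eta^2 = 16 K, and 4/3 for passing to the minimum of the two
    densities. As K >= 1, the product is at most 512/27 * 2709 K < 52000 K. *)
Theorem nonlocal_poincare (f : d.-tuple R -> R) : bmf f ->
  exists c : R, E (fun x => (f x - c) ^+ 2 * rho0 x) <=
  52 * 10 ^+ 3 * dimK *
  E (fun x => E (fun y => Num.min (rho0 x) (rho0 y) * skern stepsize x y ^+ 2 *
    (f y - f x) ^+ 2)).
Proof.
move=> bf.
have [c hc] := nonlocal_poincare_weight r0 stepsize_gt0 stepsize_dim
  stepsize_le bmf_rhot (fun x _ => rhot_ge0 x) rhot_mass_gt0 rhot_mid bf.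
exists c.
have bmm (g : d.-tuple R * d.-tuple R -> R) : bmf g ->
    bmf (fun z => g z * skern stepsize z.1 z.2 ^+ 2 * (f z.2 - f z.1) ^+ 2).
  move=> bg; apply: bmfM.
    by apply: bmfM => //; exact: bmfX (bmf_skern2 d stepsize_gt0).
  apply: bmfX; apply: bmfB; first exact: (bmf_comp bf measurable_snd).
  exact: (bmf_comp bf measurable_fst).
have b1 : bmf (fun z : d.-tuple R * d.-tuple R => rhot z.1).
  exact: (bmf_comp bmf_rhot measurable_fst).
have b2 : bmf (fun z : d.-tuple R * d.-tuple R => Num.min (rho0 z.1) (rho0 z.2)).
  by apply: bmf_min; [exact: (bmf_comp bmf_rho0 measurable_fst)|
    exact: (bmf_comp bmf_rho0 measurable_snd)].
have B1 := bmm _ b1; have B2 := bmm _ b2.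
set J := E (fun x => E (fun y => Num.min (rho0 x) (rho0 y) *
  skern stepsize x y ^+ 2 * (f y - f x) ^+ 2)).
have J0 : 0 <= J.
  apply: bint_ge0 => x _; apply: bint_ge0 => y _.
  apply: mulr_ge0; last exact: sqr_ge0.
  apply: mulr_ge0; last exact: sqr_ge0.
  by rewrite le_min !rho0_ge0.
have JJ : E (fun x => E (fun y => rhot x * skern stepsize x y ^+ 2 * (f y - f x) ^+ 2)) <=
    4 / 3 * J.
  rewrite -bintZl//; last exact: (bmf_bint1 mD finD B2).
  apply: bint_le => //; first exact: (bmf_bint1 mD finD B1).
    apply: bmfM; first exact: bmf_cst.
    exact: (bmf_bint1 mD finD B2).
  move=> x Dx; rewrite -bintZl//; last exact: (bmf_pair1 x B2).
  apply: bint_le => //; first exact: (bmf_pair1 x B1).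
    by apply: bmfM; [exact: bmf_cst|exact: (bmf_pair1 x B2)].
  move=> y Dy; rewrite [leRHS]mulrA; apply: ler_wpM2r; first exact: sqr_ge0.
  rewrite [leRHS]mulrA.
  have [->|k0] := eqVneq (skern stepsize x y) 0; first by rewrite expr0n !mulr0.
  apply: ler_wpM2r; first exact: sqr_ge0.
  by apply: (le_trans (rhot_le x)); exact: rho0_close.
have hs : E (fun x => (f x - c) ^+ 2 * rho0 x) <= 16 / 9 * E (fun x => (f x - c) ^+ 2 * rhot x).
  have bfc : bmf (fun x => (f x - c) ^+ 2) by bmf_tac.
  have b3 : bmf (fun x => (f x - c) ^+ 2 * rhot x) by apply: bmfM => //; exact: bmf_rhot.
  rewrite -bintZl//; apply: bint_le => //.
  - by apply: bmfM => //; exact: bmf_rho0.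
  - by apply: bmfM => //; exact: bmf_cst.
  - move=> x Dx; rewrite mulrCA; apply: ler_wpM2l; first exact: sqr_ge0.
    exact: rhot_ge.
apply: (le_trans hs).
have rE : r ^+ 2 / stepsize ^+ 2 = 16 * dimK.
  by rewrite stepsize_sqr; field; rewrite (gt_eqF r0) (gt_eqF dimK_gt0).
rewrite rE in hc.
have k1 := dimK_ge1.
have h1 : 16 / 9 * E (fun x => (f x - c) ^+ 2 * rhot x) <=
    16 / 9 * (8 * (168 * (16 * dimK) + 21) * (4 / 3 * J)).
  apply: ler_wpM2l; first by ge0_tac.
  apply: (le_trans hc); apply: ler_wpM2l => //.
  have := dimK_gt0 => k0; lra.
apply: (le_trans h1).
have -> : 16 / 9 * (8 * (168 * (16 * dimK) + 21) * (4 / 3 * J)) =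
  512 / 27 * (168 * (16 * dimK) + 21) * J by field.
apply: ler_wpM2r => //; lra.
Qed.

End density.

(** * Lazy reversible chains *)

Section double_integral.
Context (R : realType) dd (T : measurableType dd).
Variables (m : {sigma_finite_measure set T -> \bar R}) (D : set T).
Hypotheses (mD : measurable D) (finD : (m D < +oo)%E).
Implicit Types F G : T * T -> R.

Definition dint F : R := \int[m]_(x in D) (\int[m]_(y in D) F (x, y)).

Lemma dint_le F G : bmf F -> bmf G ->
  (forall x y, D x -> D y -> F (x, y) <= G (x, y)) -> dint F <= dint G.
Proof.
move=> bF bG FG; apply: bint_le => //; [exact: bmf_bint1|exact: bmf_bint1|].
by move=> x Dx; apply: bint_le => //; [exact: bmf_pair1|exact: bmf_pair1|auto].
Qed.

Lemma dint_eq F G : (forall x y, D x -> D y -> F (x, y) = G (x, y)) ->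
  dint F = dint G.
Proof. by move=> FG; apply: bint_eq => x Dx; apply: bint_eq => y Dy; exact: FG. Qed.

Lemma dintD F G : bmf F -> bmf G -> dint (fun z => F z + G z) = dint F + dint G.
Proof.
move=> bF bG; rewrite /dint -bintD//; try exact: bmf_bint1.
by apply: bint_eq => x Dx; rewrite bintD//; exact: bmf_pair1.
Qed.

Lemma dintZ (c : R) F : bmf F -> dint (fun z => c * F z) = c * dint F.
Proof.
move=> bF; rewrite /dint -bintZl//; try exact: bmf_bint1.
by apply: bint_eq => x Dx; rewrite bintZl//; exact: bmf_pair1.
Qed.

Lemma dintB F G : bmf F -> bmf G -> dint (fun z => F z - G z) = dint F - dint G.
Proof.
move=> bF bG; rewrite /dint -bintB//; try exact: bmf_bint1.
by apply: bint_eq => x Dx; rewrite bintB//; exact: bmf_pair1.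
Qed.

Lemma dint_swap F : bmf F -> dint F = dint (fun z => F (z.2, z.1)).
Proof. by move=> bF; rewrite /dint bint_fubini. Qed.

Lemma dint_ge0 F : (forall x y, D x -> D y -> 0 <= F (x, y)) -> 0 <= dint F.
Proof. by move=> F0; apply: bint_ge0 => x Dx; apply: bint_ge0 => y Dy; exact: F0. Qed.

End double_integral.

(* The transition operator with off-diagonal density [q]; the missing mass stays
   put. *)
Definition lazyP (R : realType) dd (T : measurableType dd)
    (m : {measure set T -> \bar R}) (D : set T) (q : T * T -> R) (f : T -> R) (x : T) : R :=
  f x + \int[m]_(y in D) (q (x, y) * (f y - f x)).

(* [chain_sum n x] and [chain_sqr n x] are the first two moments of
   [phi(X_0) + ... + phi(X_(n-1))] for the chain started at [X_0 = x]. *)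
Fixpoint chain_sum (R : realType) dd (T : measurableType dd)
    (m : {measure set T -> \bar R}) (D : set T) (q : T * T -> R) (phi : T -> R)
    (n : nat) : T -> R :=
  if n is k.+1 then fun x => phi x + lazyP m D q (chain_sum m D q phi k) x
  else fun=> 0.

Fixpoint chain_sqr (R : realType) dd (T : measurableType dd)
    (m : {measure set T -> \bar R}) (D : set T) (q : T * T -> R) (phi : T -> R)
    (n : nat) : T -> R :=
  if n is k.+1 then fun x => phi x ^+ 2 + 2 * phi x * lazyP m D q (chain_sum m D q phi k) x
    + lazyP m D q (chain_sqr m D q phi k) x
  else fun=> 0.

Section lazy_chain.
Context (R : realType) dd (T : measurableType dd).
Variables (m : {sigma_finite_measure set T -> \bar R}) (D : set T).
Hypotheses (mD : measurable D) (finD : (m D < +oo)%E).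
Local Notation E f := (\int[m]_(x in D) (f x)).
Variables (w : T -> R) (q : T * T -> R).
Hypotheses (bw : bmf w) (w0 : forall x, D x -> 0 < w x).
Hypotheses (bq : bmf q) (q0 : forall z, 0 <= q z).
Hypothesis qS : forall x y, D x -> D y -> w x * q (x, y) = w y * q (y, x).
Hypothesis qH : forall x, D x -> E (fun y => q (x, y)) <= 1 / 2.
Implicit Types f g : T -> R.
Local Notation P := (lazyP m D q).
Local Notation dint := (dint m D).

(** The weight is not normalized to a probability density; this is the origin of the factor [E w] in
    all later bounds. *)
Definition wip f g : R := E (fun x => f x * g x * w x).

Let bmf1 f : bmf f -> bmf (fun z : T * T => f z.1).
Proof. by move=> bf; exact: bmf_comp bf measurable_fst. Qed.

Let bmf2 f : bmf f -> bmf (fun z : T * T => f z.2).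
Proof. by move=> bf; exact: bmf_comp bf measurable_snd. Qed.

Let bq1 x : bmf (fun y => q (x, y)).
Proof. exact: bmf_pair1. Qed.

Lemma bmf_lazyP f : bmf f -> bmf (P f).
Proof.
move=> bf; apply: bmfD => //.
have b1 := bmf1 bf; have b2 := bmf2 bf.
apply: (@bmf_bint1 _ _ _ _ _ m D mD finD (fun z => q z * (f z.2 - f z.1))).
by bmf_tac.
Qed.

Lemma lazyPD f g : bmf f -> bmf g -> P (fun x => f x + g x) = (fun x => P f x + P g x).
Proof.
move=> bf bg; apply/funext => x; rewrite /lazyP addrACA; congr (_ + _).
have b1 := bq1 x; rewrite -bintD//; try by bmf_tac.
by apply: bint_eq => y _; ring.
Qed.

Lemma lazyPZ (c : R) f : bmf f -> P (fun x => c * f x) = (fun x => c * P f x).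
Proof.
move=> bf; apply/funext => x; rewrite /lazyP mulrDr; congr (_ + _).
have b1 := bq1 x; rewrite -bintZl//; try by bmf_tac.
by apply: bint_eq => y _; ring.
Qed.

Lemma lazyPB f g : bmf f -> bmf g -> P (fun x => f x - g x) = (fun x => P f x - P g x).
Proof.
move=> bf bg; rewrite (_ : (fun x => f x - g x) = fun x => f x + -1 * g x); last first.
  by apply/funext => x; rewrite mulN1r.
rewrite lazyPD//; last by bmf_tac.
by rewrite lazyPZ//; apply/funext => x; rewrite mulN1r.
Qed.

Lemma lazyP_cst (c : R) : P (fun _ => c) = fun _ => c.
Proof.
apply/funext => x; rewrite /lazyP.
rewrite (@bint_eq _ _ _ m D _ (fun _ => 0)) ?bint_cst ?mul0r ?addr0//.
by move=> y _; rewrite subrr mulr0.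
Qed.

Lemma lazyPE f x : bmf f ->
  P f x = (1 - E (fun y => q (x, y))) * f x + E (fun y => q (x, y) * f y).
Proof.
move=> bf; have b1 := bq1 x; rewrite /lazyP.
rewrite (@bint_eq _ _ _ m D _ (fun y => q (x, y) * f y - q (x, y) * f x)); last first.
  by move=> y _; ring.
by rewrite bintB// ?bintZr//; [ring|bmf_tac|bmf_tac].
Qed.

Lemma lazyP_le f g : bmf f -> bmf g -> (forall x, D x -> f x <= g x) ->
  forall x, D x -> P f x <= P g x.
Proof.
move=> bf bg fg x Dx; have b1 := bq1 x; rewrite !lazyPE//; apply: lerD.
  by apply: ler_wpM2l; [have := qH Dx; lra|exact: fg].
apply: bint_le => //; [by bmf_tac|by bmf_tac|].
by move=> y Dy; apply: ler_wpM2l => //; exact: fg.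
Qed.

Lemma wipC f g : wip f g = wip g f.
Proof. by apply: bint_eq => x _; ring. Qed.

Lemma wip_sqr_ge0 f : 0 <= wip f f.
Proof.
apply: bint_ge0 => x Dx; apply: mulr_ge0; first by rewrite -expr2 sqr_ge0.
exact: ltW (w0 Dx).
Qed.

Lemma wipDr f g h : bmf f -> bmf g -> bmf h ->
  wip f (fun x => g x + h x) = wip f g + wip f h.
Proof.
move=> bf bg bh; rewrite /wip -bintD//; try by bmf_tac.
by apply: bint_eq => x _; ring.
Qed.

Lemma wipZr (c : R) f g : bmf f -> bmf g -> wip f (fun x => c * g x) = c * wip f g.
Proof.
move=> bf bg; rewrite /wip -bintZl//; try by bmf_tac.
by apply: bint_eq => x _; ring.
Qed.

Lemma wipBr f g h : bmf f -> bmf g -> bmf h ->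
  wip f (fun x => g x - h x) = wip f g - wip f h.
Proof.
move=> bf bg bh; rewrite /wip -bintB//; try by bmf_tac.
by apply: bint_eq => x _; ring.
Qed.

Lemma wipBl f g h : bmf f -> bmf g -> bmf h ->
  wip (fun x => f x - g x) h = wip f h - wip g h.
Proof. by move=> bf bg bh; rewrite wipC wipBr// [wip h f]wipC [wip h g]wipC. Qed.

Let K (z : T * T) : R := w z.1 * q z.

Let bK : bmf K.
Proof. by have := bmf1 bw; rewrite /K => ?; bmf_tac. Qed.

Let KS x y : D x -> D y -> K (x, y) = K (y, x).
Proof. by move=> Dx Dy; exact: qS. Qed.

Let K0 x y : D x -> 0 <= K (x, y).
Proof. by move=> Dx; apply: mulr_ge0; [exact: ltW (w0 Dx)|]. Qed.

Lemma wip_lazyP f g : bmf f -> bmf g ->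
  wip f (P g) = wip f g + (dint (fun z => K z * (f z.1 * g z.2)) -
    dint (fun z => K z * (f z.1 * g z.1))).
Proof.
move=> bf bg; have b1 := bmf1 bf; have b2 := bmf2 bg; have b3 := bmf1 bg.
have b4 : bmf (fun z => K z * (f z.1 * g z.2)) by bmf_tac.
have b5 : bmf (fun z => K z * (f z.1 * g z.1)) by bmf_tac.
have b6 := bmfB b4 b5.
have b0 : bmf (fun x => f x * g x * w x) by bmf_tac.
rewrite -(dintB mD finD b4 b5) /dint /wip.
rewrite -(bintD mD finD b0 (bmf_bint1 mD finD b6)).
apply: bint_eq => x Dx; rewrite /lazyP.
have b7 := bq1 x.
rewrite mulrDr mulrDl; congr (_ + _).
transitivity ((f x * w x) * E (fun y => q (x, y) * (g y - g x))).
  by rewrite mulrAC.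
rewrite -(bintZl mD finD); last by bmf_tac.
by apply: bint_eq => y _; rewrite /K /=; ring.
Qed.

Lemma lazyP_sym f g : bmf f -> bmf g -> wip f (P g) = wip (P f) g.
Proof.
move=> bf bg; rewrite [RHS]wipC (wip_lazyP bf bg) (wip_lazyP bg bf) (wipC g f).
have b1 := bmf1 bf; have b2 := bmf2 bg.
have b3 : bmf (fun z => K z * (f z.1 * g z.2)) by bmf_tac.
have e1 : dint (fun z => K z * (f z.1 * g z.2)) = dint (fun z => K z * (g z.1 * f z.2)).
  rewrite (dint_swap mD finD b3).
  by apply: dint_eq => x y Dx Dy /=; rewrite KS//; ring.
have e2 : dint (fun z => K z * (f z.1 * g z.1)) = dint (fun z => K z * (g z.1 * f z.1)).
  by apply: dint_eq => x y Dx Dy /=; ring.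
by rewrite e1 e2.
Qed.

Let dint_diag f : bmf f ->
  dint (fun z => K z * (f z.2 * f z.2)) = dint (fun z => K z * (f z.1 * f z.1)).
Proof.
move=> bf; have b2 := bmf2 bf.
have b3 : bmf (fun z => K z * (f z.2 * f z.2)) by bmf_tac.
rewrite (dint_swap mD finD b3).
by apply: dint_eq => x y Dx Dy /=; rewrite KS.
Qed.

Lemma lazyP_dirichlet f : bmf f ->
  wip f f - wip f (P f) =
  1 / 2 * dint (fun z => w z.1 * q z * (f z.2 - f z.1) ^+ 2).
Proof.
move=> bf; rewrite wip_lazyP//.
have b1 := bmf1 bf; have b2 := bmf2 bf.
have -> : dint (fun z => w z.1 * q z * (f z.2 - f z.1) ^+ 2) =
  dint (fun z => K z * (f z.2 * f z.2) + (K z * (f z.1 * f z.1) - 2 * (K z * (f z.1 * f z.2)))).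
  by apply: dint_eq => x y _ _; rewrite /K/=; ring.
rewrite dintD//; [|by bmf_tac|by bmf_tac].
rewrite dintB//; [|by bmf_tac|by bmf_tac].
rewrite dintZ//; last by bmf_tac.
by rewrite (dint_diag bf); move: (dint _) (dint _) => a b; field.
Qed.

Lemma lazyP_le1 f : bmf f -> wip f (P f) <= wip f f.
Proof.
move=> bf; rewrite -subr_ge0 lazyP_dirichlet//; apply: mulr_ge0; first by lra.
apply: dint_ge0 => x y Dx Dy; apply: mulr_ge0; last exact: sqr_ge0.
exact: K0.
Qed.

(* Laziness: [q] has mass at most 1/2, so the off-diagonal part of the form is
   dominated by the diagonal one. *)
Lemma lazyP_psd f : bmf f -> 0 <= wip f (P f).
Proof.
move=> bf; rewrite wip_lazyP//.
have b1 := bmf1 bf; have b2 := bmf2 bf.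
set A := dint (fun z => K z * (f z.1 * f z.2)).
set B := dint (fun z => K z * (f z.1 * f z.1)).
have AB : - B <= A.
  have : dint (fun z => (- (1 / 2)) * (K z * (f z.1 * f z.1) + K z * (f z.2 * f z.2))) <= A.
    apply: dint_le => //; [by bmf_tac|by bmf_tac|].
    move=> x y Dx Dy; have := mulr_ge0 (K0 y Dx) (sqr_ge0 (f x + f y)) => /=.
    by move: (K (x, y)) (f x) (f y) => k a b; lra.
  rewrite dintZ//; last by bmf_tac.
  rewrite dintD//; [|by bmf_tac|by bmf_tac].
  by rewrite dint_diag// -/B; lra.
have B1 : B <= 1 / 2 * wip f f.
  rewrite /B /dint /wip -(bintZl mD finD); last by bmf_tac.
  have b3 : bmf (fun z => K z * (f z.1 * f z.1)) by bmf_tac.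
  apply: bint_le => //; [exact: (bmf_bint1 mD finD b3)|by bmf_tac|].
  move=> x Dx; have b4 := bq1 x.
  rewrite (@bint_eq _ _ _ m D _ (fun y => (f x * f x * w x) * q (x, y))); last first.
    by move=> y _; rewrite /K/=; ring.
  rewrite bintZl// mulrC; apply: ler_wpM2r; last exact: qH.
  by apply: mulr_ge0; [rewrite -expr2 sqr_ge0|exact: ltW (w0 Dx)].
by have := wip_sqr_ge0 f; lra.
Qed.

(** The spectrum of P lies between 0 and 1, hence P^2 <= P. Concretely, positivity at f - P f gives
    2 <Pf, Pf> <= <f, Pf> + <Pf, PPf>, and the last term is at most <Pf, Pf>. *)
Lemma lazyP_sqr_le f : bmf f -> wip (P f) (P f) <= wip f (P f).
Proof.
move=> bf; have bP := bmf_lazyP bf; have bPP := bmf_lazyP bP.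
have h1 := lazyP_le1 bP.
have h2 := lazyP_psd (bmfB bf bP).
rewrite (lazyPB bf bP) (wipBr (bmfB bf bP) bP bPP) (wipBl bf bP bP)
  (wipBl bf bP bPP) in h2.
have h3 : wip f (P (P f)) = wip (P f) (P f) by exact: lazyP_sym bf bP.
move: h1 h2 h3; move: (wip _ _) (wip _ _) (wip _ _) => a b c; lra.
Qed.

Variable ga : R.
Hypotheses (ga0 : 0 < ga) (ga1 : ga <= 1).
Hypothesis poincare : forall f, bmf f -> exists c, ga * E (fun x => (f x - c) ^+ 2 * w x) <=
  1 / 2 * dint (fun z => w z.1 * q z * (f z.2 - f z.1) ^+ 2).
Hypothesis Ew : 0 < E w.

Lemma lazyP_mean f : bmf f -> E (fun x => P f x * w x) = E (fun x => f x * w x).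
Proof.
move=> bf; have := lazyP_sym (bmf_cst T (1 : R)) bf.
rewrite lazyP_cst /wip => h.
transitivity (E (fun x => 1 * P f x * w x)); first by apply: bint_eq => x _; ring.
by rewrite h; apply: bint_eq => x _; ring.
Qed.

(** The Poincare inequality bounds <f, Pf>, and P^2 <= P transfers the bound to the norm of P f. A
    function of mean 0 has the smallest quadratic deviation from the constant 0, so the [c] of the
    inequality is harmless. *)
Lemma lazyP_gap f : bmf f -> E (fun x => f x * w x) = 0 ->
  wip (P f) (P f) <= (1 - ga) * wip f f.
Proof.
move=> bf f0; apply: (le_trans (lazyP_sqr_le bf)).
have [c] := poincare bf; rewrite -lazyP_dirichlet// => h.
have : wip f f <= E (fun x => (f x - c) ^+ 2 * w x).
  have -> : E (fun x => (f x - c) ^+ 2 * w x) =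
    E (fun x => f x * f x * w x + (c ^+ 2 * w x - (2 * c) * (f x * w x))).
    by apply: bint_eq => x _; ring.
  rewrite bintD//; [|by bmf_tac|by bmf_tac].
  rewrite bintB//; [|by bmf_tac|by bmf_tac].
  rewrite !bintZl//; [|by bmf_tac].
  rewrite f0 mulr0 subr0 lerDl; apply: mulr_ge0; [exact: sqr_ge0|exact: ltW].
by move=> /(ler_wpM2l (ltW ga0)); lra.
Qed.

Lemma bmf_iter_lazyP n f : bmf f -> bmf (iter n P f).
Proof. by move=> bf; elim: n => //= n IH; exact: bmf_lazyP. Qed.

Lemma iter_lazyP_sym n f g : bmf f -> bmf g ->
  wip f (iter n P g) = wip (iter n P f) g.
Proof.
move=> bf bg; elim: n f bf => [//|n IH] f bf.
rewrite [in RHS]iterSr -(IH _ (bmf_lazyP bf)) /=; apply: lazyP_sym => //.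
exact: bmf_iter_lazyP.
Qed.

Lemma iter_lazyP_gap n f : bmf f -> E (fun x => f x * w x) = 0 ->
  wip (iter n P f) (iter n P f) <= (1 - ga) ^+ n * wip f f.
Proof.
move=> bf f0; have fn k : E (fun x => iter k P f x * w x) = 0.
  elim: k => //= k IH; rewrite lazyP_mean//; exact: bmf_iter_lazyP.
elim: n => [|n IH]; first by rewrite mul1r.
rewrite /= exprS -mulrA; apply: (le_trans (lazyP_gap (bmf_iter_lazyP n bf) (fn n))).
by apply: ler_wpM2l => //; rewrite subr_ge0.
Qed.

Lemma iter_lazyP_contract n f : bmf f -> wip (iter n P f) (iter n P f) <= wip f f.
Proof.
move=> bf; elim: n => //= n IH; apply: le_trans IH.
have bn := bmf_iter_lazyP n bf.
exact: le_trans (lazyP_sqr_le bn) (lazyP_le1 bn).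
Qed.

Lemma iter_lazyP_le n f g : bmf f -> bmf g -> (forall x, D x -> f x <= g x) ->
  forall x, D x -> iter n P f x <= iter n P g x.
Proof.
move=> bf bg fg; elim: n => //= n IH; apply: lazyP_le => //; exact: bmf_iter_lazyP.
Qed.

Lemma iter_lazyP_cst n (c : R) : iter n P (fun _ => c) = fun _ => c.
Proof. by elim: n => //= n ->; rewrite lazyP_cst. Qed.

Lemma iter_lazyPB n f g : bmf f -> bmf g ->
  iter n P (fun x => f x - g x) = fun x => iter n P f x - iter n P g x.
Proof.
by move=> bf bg; elim: n => //= n ->; rewrite lazyPB//; exact: bmf_iter_lazyP.
Qed.

Lemma lazyP_sum n (F : nat -> T -> R) : (forall i, bmf (F i)) ->
  P (fun x => \sum_(i < n) F i x) = fun x => \sum_(i < n) P (F i) x.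
Proof.
move=> bF; elim: n => [|n IH].
  rewrite (_ : (fun x => _) = fun _ => 0); last by apply/funext => x; rewrite big_ord0.
  by rewrite lazyP_cst; apply/funext => x; rewrite big_ord0.
rewrite (_ : (fun x => _) = fun x => \sum_(i < n) F i x + F n x); last first.
  by apply/funext => x; rewrite big_ord_recr.
have bS : bmf (fun x => \sum_(i < n) F i x) by apply: bmf_sum => i; exact: bF.
by rewrite (lazyPD bS (bF n)) IH; apply/funext => x; rewrite big_ord_recr.
Qed.

Lemma wip_sumr n f (F : nat -> T -> R) : bmf f -> (forall i, bmf (F i)) ->
  wip f (fun x => \sum_(i < n) F i x) = \sum_(i < n) wip f (F i).
Proof.
move=> bf bF; rewrite -(bint_sum mD finD); last by move=> i; have := bF i; move=> ?; bmf_tac.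
by apply: bint_eq => x _; rewrite mulr_sumr mulr_suml.
Qed.

Lemma lazyP_jensen f x : bmf f -> D x -> P f x ^+ 2 <= P (fun y => f y ^+ 2) x.
Proof.
move=> bf Dx; set c := P f x.
have b2 : bmf (fun y => f y ^+ 2) by bmf_tac.
have b3 : bmf (fun y => (2 * c) * f y) by bmf_tac.
have b4 : bmf (fun y => f y ^+ 2 - (2 * c) * f y) by bmf_tac.
have b5 := bmf_cst T (c ^+ 2).
have b6 := bmfD b4 b5.
have h : forall y, D y -> 0 <= f y ^+ 2 - (2 * c) * f y + c ^+ 2.
  move=> y _; have := sqr_ge0 (f y - c); move: (f y) => a; lra.
have := lazyP_le (bmf_cst T 0) b6 h Dx.
rewrite (lazyPD b4 b5) (lazyPB b2 b3) (lazyPZ _ bf) !lazyP_cst -/c.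
have alg (a b : R) : 0 <= a - 2 * b * b + b ^+ 2 -> b ^+ 2 <= a by lra.
exact: alg.
Qed.

Lemma iter_lazyP_jensen n f x : bmf f -> D x ->
  iter n P f x ^+ 2 <= iter n P (fun y => f y ^+ 2) x.
Proof.
move=> bf Dx; elim: n x Dx => // n IH x Dx; rewrite !iterS.
have bn := bmf_iter_lazyP n bf.
apply: (le_trans (lazyP_jensen bn Dx)); apply: lazyP_le => //.
  by apply: bmfX.
by apply: bmf_iter_lazyP; apply: bmfX.
Qed.

(** Symmetry moves half of the steps to the other side: with k the integer part of (i + 1) / 2, the
    inner product is at most the squared norm of P^k f, a leftover odd step only decreasing it. Then
    1 - ga <= (1 - ga / 2)^2 and 2 k >= i. *)
Lemma wip_autocov i f : bmf f -> E (fun x => f x * w x) = 0 ->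
  wip f (iter i.+1 P f) <= (1 - ga / 2) ^+ i * wip f f.
Proof.
move=> bf f0; set k := (i.+1)./2.
have bk := bmf_iter_lazyP k bf.
have -> : iter i.+1 P f = iter k P (iter (odd i.+1) P (iter k P f)).
  by rewrite -!iterD; congr (iter _ P f); rewrite [(k + _)%N]addnC -addnA addnn odd_double_half.
have h1 : wip f (iter k P (iter (odd i.+1) P (iter k P f))) <= (1 - ga) ^+ k * wip f f.
  apply: le_trans (iter_lazyP_gap k bf f0).
  case: (odd i.+1) => /=; last by rewrite iter_lazyP_sym.
  rewrite iter_lazyP_sym//; last exact: bmf_lazyP.
  exact: lazyP_le1.
apply: (le_trans h1); apply: ler_wpM2r; first exact: wip_sqr_ge0.
have g0 : 0 <= 1 - ga by rewrite subr_ge0.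
have g2 : 0 <= 1 - ga / 2 by lra.
have g3 : 1 - ga / 2 <= 1 by have := ga0; lra.
apply: (@le_trans _ _ ((1 - ga / 2) ^+ (k.*2))).
  rewrite -mul2n exprM lerXn2r ?nnegrE ?sqr_ge0//.
  by have := sqr_ge0 ga; lra.
apply: ler_wiXn2l => //; rewrite -ltnS -[X in (X <= _)%N](odd_double_half i.+1) -/k.
by case: odd; rewrite ?leqnSn.
Qed.

Lemma bmf_chain_sum phi n : bmf phi -> bmf (chain_sum m D q phi n).
Proof.
move=> bp; elim: n => [|n IH] /=; first exact: bmf_cst.
by apply: bmfD => //; exact: bmf_lazyP.
Qed.

Lemma bmf_chain_sqr phi n : bmf phi -> bmf (chain_sqr m D q phi n).
Proof.
move=> bp; elim: n => [|n IH] /=; first exact: bmf_cst.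
have := bmf_lazyP IH; have := bmf_lazyP (bmf_chain_sum n bp) => ? ?.
by bmf_tac.
Qed.

Lemma lazyP_chain_sum phi n : bmf phi ->
  P (chain_sum m D q phi n) = fun x => \sum_(i < n) iter i.+1 P phi x.
Proof.
move=> bp; elim: n => [|n IH] /=.
  by rewrite lazyP_cst; apply/funext => x; rewrite big_ord0.
rewrite (lazyPD bp (bmf_lazyP (bmf_chain_sum n bp))) IH.
rewrite (@lazyP_sum n (fun i => iter i.+1 P phi)); last first.
  by move=> i; exact: bmf_iter_lazyP.
by apply/funext => x; rewrite big_ord_recl.
Qed.

(* [h] is the density of the initial distribution with respect to the stationary
   one, and [Y j] is a bound for the moments of [phi ^+ 2] against the bias
   [`|P^j h - 1|] that is left after [j] steps. *)
Section burn_in.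
Variables (phi h : T -> R) (H : R) (Y : nat -> R).
Hypotheses (bphi : bmf phi) (bh : bmf h) (H1 : 1 <= H).
Hypotheses (phi0 : E (fun x => phi x * w x) = 0) (phi1 : wip phi phi <= E w).
Hypotheses (h0 : forall x, D x -> 0 <= h x) (hH : forall x, D x -> h x <= H).
Hypothesis h1 : E (fun x => h x * w x) = E w.
Hypothesis Y0 : forall j, 0 <= Y j.
Hypothesis hY : forall j g, bmf g -> (forall x, D x -> 0 <= g x) ->
  (forall x, D x -> g x <= H) -> wip g g <= (1 - ga) ^+ j * (H * E w) ->
  wip g (fun x => phi x ^+ 2) <= Y j * E w.

Let hj j := iter j P h.
Let gj j := fun x => `|hj j x - 1|.

Let bhj j : bmf (hj j). Proof. exact: bmf_iter_lazyP. Qed.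

Let bgj j : bmf (gj j).
Proof. by apply: bmf_norm; apply: bmfB => //; exact: bmf_cst. Qed.

Let gj_ge0 j x : 0 <= gj j x. Proof. exact: normr_ge0. Qed.

Let gj_le j x : D x -> gj j x <= H.
Proof.
move=> Dx; have /= a1 := iter_lazyP_le j (bmf_cst T 0) bh h0 Dx.
have /= a2 := iter_lazyP_le j bh (bmf_cst T H) hH Dx.
rewrite !iter_lazyP_cst -/(hj j) in a1 a2.
rewrite /gj ler_norml; move: (hj j x) a1 a2 => t a1 a2; have := H1; lra.
Qed.

Let gj_sqr j : wip (gj j) (gj j) <= (1 - ga) ^+ j * (H * E w).
Proof.
have b1 : bmf (fun x => h x - 1) by bmf_tac.
have e1 : wip (gj j) (gj j) = wip (iter j P (fun x => h x - 1)) (iter j P (fun x => h x - 1)).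
  apply: bint_eq => x Dx; rewrite (iter_lazyPB j bh (bmf_cst T 1)) iter_lazyP_cst.
  by rewrite /gj -!expr2 real_normK ?num_real.
have m0 : E (fun x => (h x - 1) * w x) = 0.
  rewrite (@bint_eq _ _ _ m D _ (fun x => h x * w x - w x)); last by move=> x _; ring.
  by rewrite (bintB mD finD (bmfM bh bw) bw) h1 subrr.
rewrite e1; apply: (le_trans (iter_lazyP_gap j b1 m0)).
apply: ler_wpM2l; first by apply: exprn_ge0; rewrite subr_ge0.
have b2 : bmf (fun x => H * (h x * w x)) by bmf_tac.
have b3 : bmf (fun x => 2 * (h x * w x)) by bmf_tac.
have b4 : bmf (fun x => h x * w x) by bmf_tac.
(* As 0 <= h <= H, (h - 1)^2 is at most H h - 2 h + 1, whose weighted integral is (H - 1) E w. *)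
apply: (@le_trans _ _ (E (fun x => H * (h x * w x) - (2 * (h x * w x) - w x)))).
  apply: bint_le => //; [by bmf_tac|by bmf_tac|].
  move=> x Dx; have k0 := h0 Dx; have k1 := hH Dx; have k2 := w0 Dx.
  have -> : H * (h x * w x) - (2 * (h x * w x) - w x) = (H * h x - 2 * h x + 1) * w x by ring.
  apply: ler_wpM2r; first exact: ltW.
  have := ler_wpM2r k0 k1; move: (h x) H => a b; lra.
rewrite (bintB mD finD b2 (bmfB b3 bw)) (bintB mD finD b3 bw) !(bintZl mD finD _ b4) h1.
by have := Ew; move: (E w) => z; lra.
Qed.

(** By reversibility [hj j] is the density of X_j relative to the stationary law, so this is the
    mixed moment of phi (X_j) and phi (X_(j + i + 1)). Writing the density as 1 plus a bias leaves a
    stationary autocovariance; in the bias term the product is split into squares, and Jensen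
    replaces (P^(i + 1) phi)^2 by P^(i + 1) (phi^2). *)
Let step_cov j i : wip (hj j) (fun x => phi x * iter i.+1 P phi x) <=
  ((1 - ga / 2) ^+ i + Y j) * E w.
Proof.
have bi := bmf_iter_lazyP i.+1 bphi.
have bp2 : bmf (fun x => phi x ^+ 2) by bmf_tac.
have bi2 := bmf_iter_lazyP i.+1 bp2.
have b1 : bmf (fun x => phi x * iter i.+1 P phi x) by bmf_tac.
have b2 : bmf (fun x => 1 / 2 * (phi x ^+ 2 + iter i.+1 P (fun y => phi y ^+ 2) x)) by bmf_tac.
have b3 : bmf (fun x => gj j x * (1 / 2 * (phi x ^+ 2 + iter i.+1 P (fun y => phi y ^+ 2) x)) * w x).
  by have := bgj j => b; bmf_tac.
have b4 : bmf (fun x => phi x * iter i.+1 P phi x * w x) by bmf_tac.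
have k1 : wip (hj j) (fun x => phi x * iter i.+1 P phi x) <=
    wip phi (iter i.+1 P phi) +
    wip (gj j) (fun x => 1 / 2 * (phi x ^+ 2 + iter i.+1 P (fun y => phi y ^+ 2) x)).
  rewrite /wip -(bintD mD finD b4 b3); apply: bint_le => //.
  - by have := bhj j => b; bmf_tac.
  - exact: bmfD.
  move=> x Dx; rewrite -mulrDl; apply: ler_wpM2r; first exact: ltW (w0 Dx).
  have alg (a s b t : R) : a ^+ 2 <= s ->
      t * (b * a) <= b * a + `|t - 1| * (1 / 2 * (b ^+ 2 + s)).
    move=> sa; have : (t - 1) * (b * a) <= `|t - 1| * (1 / 2 * (b ^+ 2 + s)).
      apply: (le_trans (ler_norm _)); rewrite normrM; apply: ler_wpM2l => //.
      rewrite ler_norml; have := sqr_ge0 (a + b); have := sqr_ge0 (a - b); lra.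
    by lra.
  by apply: alg; exact: iter_lazyP_jensen.
apply: (le_trans k1); rewrite mulrDl; apply: lerD.
  apply: (le_trans (wip_autocov i bphi phi0)); apply: ler_wpM2l => //.
  by apply: exprn_ge0; have := ga1; lra.
rewrite (wipZr _ (bgj j) (bmfD bp2 bi2)) (wipDr (bgj j) bp2 bi2).
have k2 := hY (bgj j) (fun x _ => gj_ge0 j x) (@gj_le j) (gj_sqr j).
(* The powers of P pass by symmetry from phi^2 to the bias, which keeps its sign, its uniform bound
   and its norm bound. This is why [hY] is stated for every such [g]. *)
have k3 : wip (gj j) (iter i.+1 P (fun y => phi y ^+ 2)) <= Y j * E w.
  rewrite iter_lazyP_sym//; apply: hY; first exact: bmf_iter_lazyP.
  - move=> x Dx; have := iter_lazyP_le i.+1 (bmf_cst T 0) (bgj j) (fun x _ => gj_ge0 j x) Dx.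
    by rewrite iter_lazyP_cst.
  - move=> x Dx; have := iter_lazyP_le i.+1 (bgj j) (bmf_cst T H) (@gj_le j) Dx.
    by rewrite iter_lazyP_cst.
  - exact: le_trans (iter_lazyP_contract i.+1 (bgj j)) (gj_sqr j).
move: k2 k3; move: (wip _ _) (wip _ _) => a b; lra.
Qed.

Let step_var j : wip (hj j) (fun x => phi x ^+ 2) <= (1 + Y j) * E w.
Proof.
have bp2 : bmf (fun x => phi x ^+ 2) by bmf_tac.
have b1 : bmf (fun x => phi x * phi x * w x) by bmf_tac.
have b2 : bmf (fun x => gj j x * phi x ^+ 2 * w x) by have := bgj j => b; bmf_tac.
have k1 : wip (hj j) (fun x => phi x ^+ 2) <= wip phi phi + wip (gj j) (fun x => phi x ^+ 2).
  rewrite /wip -(bintD mD finD b1 b2); apply: bint_le => //.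
  - by have := bhj j => b; bmf_tac.
  - exact: bmfD.
  move=> x Dx; rewrite -mulrDl; apply: ler_wpM2r; first exact: ltW (w0 Dx).
  rewrite /gj; have := ler_wpM2r (sqr_ge0 (phi x)) (ler_norm (hj j x - 1)).
  by move: (phi x) (hj j x) `| _ | => a b c; lra.
apply: (le_trans k1); rewrite mulrDl mul1r; apply: lerD => //.
exact: hY (bgj j) (fun x _ => gj_ge0 j x) (@gj_le j) (gj_sqr j).
Qed.

Lemma geo_sum_le n : \sum_(i < n) (1 - ga / 2) ^+ i <= 2 / ga.
Proof.
have e : (ga / 2) * \sum_(i < n) (1 - ga / 2) ^+ i = 1 - (1 - ga / 2) ^+ n.
  elim: n => [|n IH]; first by rewrite big_ord0 mulr0 expr0 subrr.
  by rewrite big_ord_recr/= mulrDr IH exprS; ring.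
have : 0 <= (1 - ga / 2) ^+ n by apply: exprn_ge0; have := ga1; lra.
move=> p0; rewrite ler_pdivlMr//; move: e p0; move: (\sum_(i < n) _) (_ ^+ n) => a b; lra.
Qed.

(** One step of the recursion costs 1 for the square and 2 * (2 / ga) for the covariances, together
    at most 5 / ga, plus (1 + 2 N) Y j for the bias. The time j advances while N decreases; the
    fixed [M] bounds all multiplicities 1 + 2 N by 2 M. *)
Lemma chain_sqr_burn_in N M j : (N <= M)%N ->
  wip (hj j) (chain_sqr m D q phi N) <=
  (N%:R * (5 / ga) + 2 * M%:R * \sum_(i < N) Y (j + i)) * E w.
Proof.
elim: N j => [|N IH] j NM /=.
  rewrite big_ord0 mul0r mulr0 addr0 mul0r /wip.
  rewrite le_eqVlt; apply/orP; left; apply/eqP; transitivity (E (fun=> 0 : R)).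
    by apply: bint_eq => x _; rewrite mulr0 mul0r.
  by rewrite bint_cst// mul0r.
have bp2 : bmf (fun x => phi x ^+ 2) by bmf_tac.
have bcov i : bmf (fun x => phi x * iter i.+1 P phi x).
  by apply: bmfM => //; exact: bmf_iter_lazyP.
have bS : bmf (fun x => \sum_(i < N) (phi x * iter i.+1 P phi x)).
  by apply: bmf_sum.
have bB := bmf_chain_sqr N bphi.
have bPB := bmf_lazyP bB.
have b2S : bmf (fun x => 2 * \sum_(i < N) (phi x * iter i.+1 P phi x)) by bmf_tac.
have -> : (fun x => phi x ^+ 2 + 2 * phi x * P (chain_sum m D q phi N) x +
    P (chain_sqr m D q phi N) x) = (fun x => phi x ^+ 2 +
    2 * (\sum_(i < N) (phi x * iter i.+1 P phi x)) + P (chain_sqr m D q phi N) x).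
  by apply/funext => x; rewrite (lazyP_chain_sum N bphi) -mulr_sumr mulrA.
rewrite (wipDr (bhj j) (bmfD bp2 b2S) bPB) (wipDr (bhj j) bp2 b2S) (wipZr _ (bhj j) bS).
rewrite (@wip_sumr N _ (fun i x => phi x * iter i.+1 P phi x) (bhj j) bcov).
have e1 : wip (hj j) (P (chain_sqr m D q phi N)) = wip (hj j.+1) (chain_sqr m D q phi N).
  by rewrite lazyP_sym.
have i1 := IH j.+1 (ltnW NM).
have i2 := step_var j.
have i3 : \sum_(i < N) wip (hj j) (fun x => phi x * iter i.+1 P phi x) <=
    (2 / ga + N%:R * Y j) * E w.
  apply: (@le_trans _ _ (\sum_(i < N) ((1 - ga / 2) ^+ i + Y j) * E w)).
    by apply: ler_sum => i _; exact: step_cov.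
  rewrite -mulr_suml; apply: ler_wpM2r; first exact: ltW.
  rewrite big_split/= sumr_const card_ord -[Y j *+ N]mulr_natl lerD2r.
  exact: geo_sum_le.
rewrite e1 big_ord_recl addn0.
have -> : \sum_(i < N) Y (j + bump 0 i) = \sum_(i < N) Y (j.+1 + i)%N.
  by apply: eq_bigr => i _; rewrite addSnnS.
have i4 : (1 + 2 * N%:R) * Y j <= 2 * M%:R * Y j.
  apply: ler_wpM2r => //; have : N%:R + 1 <= M%:R :> R by rewrite natr1 ler_nat.
  by lra.
have i5 : 1 <= ga^-1 by rewrite invf_ge1.
have z0 := Ew.
have i6 := ler_wpM2r (ltW z0) i4; have i7 := ler_wpM2r (ltW z0) i5.
rewrite -natr1.
move: i1 i2 i3 i6 i7.
move: (wip _ _) (wip _ _) (\sum_(i < N) wip _ _) => a b c.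
move: (E w) (ga^-1) (Y j) (\sum_(i < N) _) => z v y s i1 i2 i3 i6 i7.
lra.
Qed.

End burn_in.

End lazy_chain.

Lemma bmf_powR (R : realType) dd (T : measurableType dd) (f : T -> R) (p : R) :
  0 <= p -> bmf f -> bmf (fun x => `|f x| `^ p).
Proof.
move=> p0 bf; have [M M0 fM] := bmf_bound bf; split.
  apply: (measurableT_comp (measurable_powR p)).
  by case: (bmf_norm bf).
exists (M `^ p) => x; rewrite ger0_norm ?powR_ge0//.
by apply: ge0_ler_powR => //; rewrite ?nnegrE//; exact: ltW.
Qed.

(** * Young's inequality against the initial bias *)

Section young.
Context (R : realType) (p : R).
Hypotheses (p2 : 2 < p) (p4 : p <= 4).

(* The conjugate exponent of [p / 2]. *)
Definition mexp : R := p / (p - 2).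

Lemma mexp_ge2 : 2 <= mexp.
Proof. by have h := p2; have h' := p4; rewrite /mexp ler_pdivlMr; lra. Qed.

Lemma mexpV : mexp^-1 = 1 - 2 / p.
Proof. by rewrite /mexp; field; have h := p2; rewrite !gt_eqF//; lra. Qed.

Lemma sqr_powR_half (t : R) : (t ^+ 2) `^ (p / 2) = `|t| `^ p.
Proof.
rewrite -(real_normK (num_real t)) -[_ ^+ 2]powR_mulrn// -powRrM.
by congr (_ `^ _); field.
Qed.

Lemma mexp_conj : mexp^-1 + (p / 2)^-1 = 1.
Proof. by rewrite mexpV; field; have h := p2; rewrite !gt_eqF//; lra. Qed.

(** Young's inequality for g / exp y and t^2 with the exponents [mexp] and p / 2. Since p <= 4 gives
    [mexp] >= 2, the power of g is at most g^2 exp (A (mexp - 2)): only the L_2 norm and the uniform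
    bound of g will be needed. The parameter y serves to balance the two terms. *)
Lemma young_sqr (A y t g : R) : 0 <= g <= expR A ->
  g * t ^+ 2 <= expR ((1 - mexp) * y + A * (mexp - 2)) / mexp * g ^+ 2 +
    expR y * (1 - mexp^-1) * `|t| `^ p.
Proof.
move=> /andP[g0 gA].
have q2 := mexp_ge2; have q0 : 0 < mexp by lra.
have pp : 0 < p / 2 by have h := p2; lra.
have ey := expR_gt0 y.
have a0 : 0 <= g / expR y by rewrite divr_ge0// ltW.
have := conjugate_powR a0 (sqr_ge0 t) q0 pp mexp_conj.
rewrite sqr_powR_half => h.
have e1 : (p / 2)^-1 = 1 - mexp^-1 
  by apply/eqP; rewrite eq_sym subr_eq addrC mexp_conj.
rewrite e1 in h.
have h2 := ler_wpM2l (ltW ey) h.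
have e2 : expR y * (g / expR y * t ^+ 2) = g * t ^+ 2.
  by field; rewrite gt_eqF.
rewrite e2 in h2; apply: (le_trans h2); rewrite mulrDr; apply: lerD; last first.
  by rewrite mulrA mulrAC.
have [->|gn] := eqVneq g 0.
  rewrite mul0r powR0 ?gt_eqF// !mul0r mulr0; apply: mulr_ge0; last exact: sqr_ge0.
  by rewrite divr_ge0 ?expR_ge0// ltW.
have gp : 0 < g by rewrite lt_neqAle eq_sym gn.
have gE : g = expR (ln g) by rewrite lnK.
have uA : ln g <= A by rewrite -ler_expR -gE.
rewrite {1 2}gE -expRN -expRD -expRM -expRM_natl mulrA -expRD [leRHS]mulrAC -expRD.
apply: ler_wpM2r; first by rewrite invr_ge0 ltW.
rewrite ler_expR.
have := ler_wpM2r (_ : 0 <= mexp - 2) uA; lra.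
Qed.

(** Young's inequality against the constant 1. Integrated over a probability measure, it bounds the
    moment of order a by 1 if the one of order p is at most 1. *)
Lemma powR_le_convex (t a : R) : 0 < a -> a <= p ->
  `|t| `^ a <= a / p * `|t| `^ p + (1 - a / p).
Proof.
move=> a0 ap; have p0 : 0 < p by exact: lt_le_trans ap.
have [->|an] := eqVneq a p; first by rewrite divff ?gt_eqF// mul1r subrr addr0.
have al : a < p by rewrite lt_neqAle an.
have k0 : 0 < p / a by rewrite divr_gt0.
have l0 : 0 < p / (p - a) by rewrite divr_gt0// subr_gt0.
have kl : (p / a)^-1 + (p / (p - a))^-1 = 1.
  by field; rewrite ?gt_eqF// subr_gt0.
have := conjugate_powR (powR_ge0 `|t| a) (@ler01 R) k0 l0 kl.
rewrite mulr1 -powRrM powR1 mulrCA divff ?gt_eqF// mulr1 => /le_trans; apply.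
rewrite le_eqVlt; apply/orP; left; apply/eqP.
by field; rewrite ?gt_eqF// subr_gt0.
Qed.

End young.

Section moments.
Context (R : realType) dd (T : measurableType dd).
Variables (m : {sigma_finite_measure set T -> \bar R}) (D : set T).
Hypotheses (mD : measurable D) (finD : (m D < +oo)%E).
Local Notation E f := (\int[m]_(x in D) (f x)).
Variables (w : T -> R) (p : R) (f : T -> R).
Hypotheses (bw : bmf w) (w0 : forall x, D x -> 0 < w x) (Ew : 0 < E w).
Hypotheses (p2 : 2 < p) (p4 : p <= 4).
Hypotheses (bf : bmf f) (fp : E (fun x => `|f x| `^ p * w x) <= E w).
Local Notation wip := (wip m D w).
Local Notation q := (mexp p).

Let p0 : 0 <= p. Proof. by have h := p2; lra. Qed.

Lemma second_moment : wip f f <= E w.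
Proof.
have bp := bmf_powR p0 bf.
have b1 : bmf (fun x => `|f x| `^ p * w x) by bmf_tac.
have b2 : bmf (fun x => 2 / p * (`|f x| `^ p * w x)) by bmf_tac.
have b3 : bmf (fun x => (1 - 2 / p) * w x) by bmf_tac.
have le : wip f f <= E (fun x => 2 / p * (`|f x| `^ p * w x) + (1 - 2 / p) * w x).
  apply: bint_le => //; [by bmf_tac|exact: bmfD|].
  move=> x Dx; rewrite mulrA -mulrDl; apply: ler_wpM2r; first exact: ltW (w0 Dx).
  have := @powR_le_convex R p (f x) 2 (ltr0n _ 2) (ltW p2).
  by rewrite powR_mulrn// real_normK ?num_real// expr2.
apply: (le_trans le).
rewrite (bintD mD finD b2 b3) (bintZl mD finD _ b1) (bintZl mD finD _ bw).
have k : 0 <= 2 / p by rewrite divr_ge0.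
have := ler_wpM2l k fp; move: (E w) (E _) => a b; lra.
Qed.

(** The condition on y makes the two terms of [young_sqr] contribute at most the fractions 1 / q and
    1 - 1 / q of exp y. *)
Lemma wip_young (A b y : R) (g : T -> R) : bmf g ->
  (forall x, D x -> 0 <= g x) -> (forall x, D x -> g x <= expR A) ->
  wip g g <= b * E w -> expR (A * (q - 2)) * b <= expR (q * y) ->
  wip g (fun x => f x ^+ 2) <= expR y * E w.
Proof.
move=> bg g0 gA gg yb.
have bp := bmf_powR p0 bf.
have q2 := mexp_ge2 p2 p4; have q0 : 0 < q by lra.
set c := expR ((1 - q) * y + A * (q - 2)) / q.
set k := expR y * (1 - q^-1).
have b1 : bmf (fun x => `|f x| `^ p * w x) by bmf_tac.
have b2 : bmf (fun x => k * (`|f x| `^ p * w x)) by bmf_tac.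
have b3 : bmf (fun x => g x * g x * w x) by bmf_tac.
have b4 : bmf (fun x => c * (g x * g x * w x)) by bmf_tac.
have le : wip g (fun x => f x ^+ 2) <= E (fun x => c * (g x * g x * w x) + k * (`|f x| `^ p * w x)).
  apply: bint_le => //; [by bmf_tac|exact: bmfD|].
  move=> x Dx; have gx : 0 <= g x <= expR A by rewrite g0// gA.
  have h := ler_wpM2r (ltW (w0 Dx)) (young_sqr p2 p4 y (f x) gx).
  apply: (le_trans h); rewrite -/c -/k le_eqVlt; apply/orP; left; apply/eqP; ring.
apply: (le_trans le).
rewrite (bintD mD finD b4 b2) (bintZl mD finD _ b3) (bintZl mD finD _ b1) -/(wip g g).
have c0 : 0 <= c by rewrite divr_ge0 ?expR_ge0// ltW.
have k0 : 0 <= k by apply: mulr_ge0; rewrite ?expR_ge0// subr_ge0 invf_le1//; lra.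
have h1 := ler_wpM2l c0 gg; have h2 := ler_wpM2l k0 fp.
have h3 : c * b <= expR y / q.
  rewrite /c mulrAC; apply: ler_wpM2r; first by rewrite invr_ge0 ltW.
  rewrite expRD -mulrA.
  have -> : expR y = expR ((1 - q) * y) * expR (q * y) :> R.
    by rewrite -expRD; congr expR; ring.
  by apply: ler_wpM2l => //; exact: expR_ge0.
have h4 := ler_wpM2r (ltW Ew) h3.
have e : expR y * E w = expR y / q * E w + k * E w by rewrite /k; ring.
rewrite e; move: h1 h2 h4; move: (wip g g) (E w) (E _) (expR y / q) => u z v s; lra.
Qed.

(** Centering costs the factor 4 through (f - S)^2 <= 2 f^2 + 2, the constant 1 being handled by the
    same exp y. *)
Lemma wip_young_centered (A b y S : R) (g : T -> R) : bmf g ->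
  (forall x, D x -> 0 <= g x) -> (forall x, D x -> g x <= expR A) ->
  wip g g <= b * E w -> expR (A * (q - 2)) * b <= expR (q * y) ->
  wip g (fun=> 1) <= expR y * E w -> S ^+ 2 <= 1 ->
  wip g (fun x => (f x - S) ^+ 2) <= 4 * expR y * E w.
Proof.
move=> bg g0 gA gg yb g1 S1.
have h := wip_young bg g0 gA gg yb.
have b1 : bmf (fun x => g x * f x ^+ 2 * w x) by bmf_tac.
have b2 : bmf (fun x => g x * 1 * w x) by bmf_tac.
have b3 : bmf (fun x => 2 * (g x * f x ^+ 2 * w x)) by bmf_tac.
have b4 : bmf (fun x => 2 * (g x * 1 * w x)) by bmf_tac.
have le : wip g (fun x => (f x - S) ^+ 2) <=
    E (fun x => 2 * (g x * f x ^+ 2 * w x) + 2 * (g x * 1 * w x)).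
  apply: bint_le => //; [by bmf_tac|exact: bmfD|].
  move=> x Dx.
  have -> : 2 * (g x * f x ^+ 2 * w x) + 2 * (g x * 1 * w x) =
    g x * (2 * f x ^+ 2 + 2) * w x by ring.
  apply: ler_wpM2r; first exact: ltW (w0 Dx).
  apply: ler_wpM2l; first exact: g0.
  have := sqr_ge0 (f x + S); move: (f x) => t; move: S S1 => s; lra.
apply: (le_trans le).
rewrite (bintD mD finD b3 b4) (bintZl mD finD _ b1) (bintZl mD finD _ b2).
have alg (a c e z : R) : a <= e * z -> c <= e * z -> 2 * a + 2 * c <= 4 * e * z by lra.
exact: alg.
Qed.

Lemma mean_sqr_le1 : (E (fun x => f x * w x) / E w) ^+ 2 <= 1.
Proof.
set S := _ / _.
have b1 : bmf (fun x => f x * w x) by bmf_tac.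
have b2 : bmf (fun x => f x * f x * w x) by bmf_tac.
have b3 : bmf (fun x => (2 * S) * (f x * w x)) by bmf_tac.
have b4 : bmf (fun x => S ^+ 2 * w x) by bmf_tac.
have b5 := bmfB b3 b4.
have := @bint_ge0 _ _ _ m D (fun x => f x * f x * w x - (2 * S * (f x * w x) - S ^+ 2 * w x)).
have -> : E (fun x => f x * f x * w x - (2 * S * (f x * w x) - S ^+ 2 * w x)) =
    wip f f - S ^+ 2 * E w.
  rewrite (bintB mD finD b2 b5) (bintB mD finD b3 b4) (bintZl mD finD _ b1)
    (bintZl mD finD _ bw) -/(wip f f).
  have -> : E (fun x => f x * w x) = S * E w by rewrite /S divfK// gt_eqF.
  ring.
move=> h; have {}h : 0 <= wip f f - S ^+ 2 * E w.
  apply: h => x Dx.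
  have -> : f x * f x * w x - (2 * S * (f x * w x) - S ^+ 2 * w x) = (f x - S) ^+ 2 * w x by ring.
  by apply: mulr_ge0; [exact: sqr_ge0|exact: ltW (w0 Dx)].
have h2 := second_moment.
rewrite -(ler_pM2r Ew) mul1r; lra.
Qed.

Lemma variance_le : wip (fun x => f x - E (fun x => f x * w x) / E w)
  (fun x => f x - E (fun x => f x * w x) / E w) <= E w.
Proof.
set S := E (fun x => f x * w x) / E w.
have b1 : bmf (fun x => f x * w x) by bmf_tac.
have b2 : bmf (fun x => f x * f x * w x) by bmf_tac.
have b3 : bmf (fun x => (2 * S) * (f x * w x)) by bmf_tac.
have b4 : bmf (fun x => S ^+ 2 * w x) by bmf_tac.
have b5 := bmfB b3 b4.
have -> : wip (fun x => f x - S) (fun x => f x - S) =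
    E (fun x => f x * f x * w x - (2 * S * (f x * w x) - S ^+ 2 * w x)).
  by apply: bint_eq => x _; ring.
rewrite (bintB mD finD b2 b5) (bintB mD finD b3 b4) (bintZl mD finD _ b1)
    (bintZl mD finD _ bw) -/(wip f f).
have -> : E (fun x => f x * w x) = S * E w by rewrite /S divfK// gt_eqF.
have := second_moment; have := mulr_ge0 (sqr_ge0 S) (ltW Ew).
move: (wip f f) (E w) => a z; lra.
Qed.

End moments.

(** The ratio satisfies exp (- x) <= 1 / (1 + x) <= 1 - x / 2 for 0 < x <= 1, which bounds the
    geometric series by 2 / x. *)
Lemma expR_geo_sum (R : realType) (y x : R) n : 0 < x -> x <= 1 ->
  \sum_(i < n) expR (y - x * i%:R) <= expR y * (2 / x).
Proof.
move=> x0 x1.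
have ex : expR (- x) <= 1 - x / 2.
  rewrite expRN; apply: (@le_trans _ _ (1 + x)^-1).
    rewrite lef_pV2 ?posrE ?expR_gt0//; [exact: expR_ge1Dx|lra].
  rewrite -[leLHS]mul1r ler_pdivrMr; last by lra.
  have := mulr_ge0 (ltW x0) (_ : 0 <= 1 - x); lra.
have e0 := expR_ge0 (- x).
have -> : \sum_(i < n) expR (y - x * i%:R) = expR y * \sum_(i < n) expR (- x) ^+ i.
  rewrite mulr_sumr; apply: eq_bigr => i _.
  by rewrite expRD -expRM_natl; congr (_ * expR _); ring.
apply: ler_wpM2l; first exact: expR_ge0.
have e : (1 - expR (- x)) * \sum_(i < n) expR (- x) ^+ i = 1 - expR (- x) ^+ n.
  elim: n => [|n IH]; first by rewrite big_ord0 mulr0 expr0 subrr.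
  by rewrite big_ord_recr/= mulrDr IH exprS; ring.
have s0 : 0 <= \sum_(i < n) expR (- x) ^+ i by apply: sumr_ge0 => i _; exact: exprn_ge0.
have p0 : 0 <= expR (- x) ^+ n by exact: exprn_ge0.
have le := ler_wpM2r s0 ex.
rewrite ler_pdivlMr//.
have alg (s u v : R) : v * s <= (1 - x / 2) * s -> (1 - v) * s = 1 - u -> 0 <= u ->
  s * x <= 2 by lra.
exact: alg le e p0.
Qed.

(** * The Metropolis chain *)

Section chain_mse.
Context (R : realType) dd (T : measurableType dd).
Variables (m : {sigma_finite_measure set T -> \bar R}) (D : set T).
Hypotheses (mD : measurable D) (finD : (m D < +oo)%E).
Local Notation E f := (\int[m]_(x in D) (f x)).
Variables (w : T -> R) (q : T * T -> R).
Hypotheses (bw : bmf w) (w0 : forall x, D x -> 0 < w x) (Ew : 0 < E w).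
Hypotheses (bq : bmf q) (q0 : forall z, 0 <= q z).
Hypothesis qS : forall x y, D x -> D y -> w x * q (x, y) = w y * q (y, x).
Hypothesis qH : forall x, D x -> E (fun y => q (x, y)) <= 1 / 2.
Variable ga : R.
Hypotheses (ga0 : 0 < ga) (ga1 : ga <= 1).
Hypothesis poincare : forall f, bmf f -> exists c, ga * E (fun x => (f x - c) ^+ 2 * w x) <=
  1 / 2 * dint m D (fun z => w z.1 * q z * (f z.2 - f z.1) ^+ 2).
Variables (p A : R) (f h : T -> R).
Hypotheses (p2 : 2 < p) (p4 : p <= 4) (A0 : 0 <= A).
Hypotheses (bf : bmf f) (fp : E (fun x => `|f x| `^ p * w x) <= E w).
Hypotheses (bh : bmf h) (h0 : forall x, D x -> 0 <= h x)
  (hA : forall x, D x -> h x <= expR A) (h1 : E (fun x => h x * w x) = E w).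
Local Notation s := (mexp p).
Local Notation S := (E (fun x => f x * w x) / E w).
Local Notation phi := (fun x => f x - S).

(** At time j the bias bound is 4 exp (y j). Summed from n0 on it is at most (8 / ga) s exp (y n0),
    and the burn-in condition reduces this to 2 / ga. With the factor 2 N in front, the total is N
    (5 + 2 * 2) / ga. *)
Lemma chain_sqr_mse n0 N :
  s * expR ((A * (s - 1) - ga * n0%:R) / s) <= 1 / 4 ->
  wip m D w h (iter n0 (lazyP m D q) (chain_sqr m D q phi N)) <=
  9 * N%:R ^+ 2 / (ga * N%:R) * E w.
Proof.
move=> hn.
have s2 := mexp_ge2 p2 p4; have s0 : 0 < s by lra.
have bphi : bmf phi by bmf_tac.
(* The value that solves exp (s y) = exp (A (s - 2)) exp (A - ga j); it is admissible in [wip_young]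
   since (1 - ga)^j <= exp (- ga j). *)
pose y j := (A * (s - 1) - ga * j%:R) / s.
have mean0 : E (fun x => phi x * w x) = 0.
  have b1 : bmf (fun x => f x * w x) by bmf_tac.
  have b2 : bmf (fun x => S * w x) by bmf_tac.
  rewrite (@bint_eq _ _ _ m D _ (fun x => f x * w x - S * w x)); last by move=> x _; ring.
  by rewrite (bintB mD finD b1 b2) (bintZl mD finD _ bw) divfK ?subrr// gt_eqF.
have var1 : wip m D w phi phi <= E w 
  by exact: (variance_le mD finD bw w0 Ew p2 bf fp).
have H1 : 1 <= expR A by rewrite -[leLHS]expR0 ler_expR.
have Y0 j : 0 <= 4 * expR (y j) by rewrite mulr_ge0// expR_ge0.
have one : E (fun x => `|(fun=> 1) x : R| `^ p * w x) <= E w.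
  rewrite le_eqVlt; apply/orP; left; apply/eqP; apply: bint_eq => x _.
  by rewrite normr1 powR1 mul1r.
have hY j g : bmf g -> (forall x, D x -> 0 <= g x) ->
    (forall x, D x -> g x <= expR A) ->
    wip m D w g g <= (1 - ga) ^+ j * (expR A * E w) ->
    wip m D w g (fun x => phi x ^+ 2) <= 4 * expR (y j) * E w.
  move=> bg g0 gA gg; rewrite mulrA in gg.
  have yb : expR (A * (s - 2)) * ((1 - ga) ^+ j * expR A) <= expR (s * y j).
    have -> : s * y j = - ga * j%:R + (A * (s - 2) + A).
      by rewrite /y; field; rewrite gt_eqF.
    rewrite mulrCA expRD expRD; apply: ler_wpM2r.
      by rewrite mulr_ge0// expR_ge0.
    rewrite mulrC expRM_natl; apply: lerXn2r; rewrite ?nnegrE ?expR_ge0 ?subr_ge0//.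
    exact: expR_ge1Dx.
  have g1 : wip m D w g (fun=> 1) <= expR (y j) * E w.
    have := wip_young mD finD bw w0 Ew p2 p4 (bmf_cst T 1) one bg g0 gA gg yb.
    by rewrite expr1n.
  apply: (wip_young_centered mD finD bw w0 Ew p2 p4 bf fp bg g0 gA gg yb g1).
  exact: (mean_sqr_le1 mD finD bw w0 Ew p2 bf fp).
rewrite (iter_lazyP_sym mD finD bw bq qS n0 bh (bmf_chain_sqr mD finD bq N bphi)).
apply: (le_trans (chain_sqr_burn_in mD finD bw w0 bq q0 qS qH ga0 ga1 poincare
  Ew bphi bh H1 mean0 var1 h0 hA h1 Y0 hY n0 (leqnn N))).
apply: ler_wpM2r; first exact: ltW.
have sx : \sum_(i < N) 4 * expR (y (n0 + i)%N) <= 4 * (expR (y n0) * (2 / (ga / s))).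
  rewrite -mulr_sumr; apply: ler_wpM2l => //.
  have g1 : 0 < ga / s by rewrite divr_gt0.
  have g2 : ga / s <= 1 by rewrite ler_pdivrMr// mul1r; apply: (le_trans ga1); lra.
  apply: le_trans (expR_geo_sum (y n0) N g1 g2).
  rewrite le_eqVlt; apply/orP; left; apply/eqP; apply: eq_bigr => i _.
  by congr expR; rewrite /y natrD; field; rewrite gt_eqF.
have [->|Nn] := eqVneq N 0%N.
  by rewrite big_ord0 expr0n/= !mulr0 !mul0r addr0.
have Np : 0 < N%:R :> R by rewrite ltr0n lt0n.
have -> : 9 * N%:R ^+ 2 / (ga * N%:R) = N%:R * (5 / ga) + 2 * N%:R * (2 / ga).
  by field; rewrite !gt_eqF.
rewrite lerD2l; apply: ler_wpM2l; first by rewrite mulr_ge0.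
apply: (le_trans sx).
have -> : 4 * (expR (y n0) * (2 / (ga / s))) = 8 / ga * (s * expR (y n0)).
  by field; rewrite !gt_eqF.
have -> : 2 / ga = 8 / ga * (1 / 4) by field; rewrite gt_eqF.
by apply: ler_wpM2l => //; rewrite divr_ge0// ltW.
Qed.

End chain_mse.

Section metropolis.
Context (R : realType) (d : nat) (r L : R) (rho : d.-tuple R -> R).
Hypotheses (r0 : 0 < r) (L0 : 0 <= L) (rhoP : RL L (@eball R d r) rho).
Local Notation D := (@eball R d r).
Local Notation E f := (\int[lebesgue R d]_(y in D) (f y)).
Local Notation K := (@dimK R d r L).
Local Notation eta := (@stepsize R d r L).
Local Notation w := (@rho0 R d r rho).

Let mD := @measurable_eball R d r.
Let finD := @lebesgue_eball_fin R d r r0.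
Let eta0 : 0 < eta := stepsize_gt0 d L r0.
Let bw : bmf w := bmf_rho0 r0 L0 rhoP.
Let w_gt0 x : D x -> 0 < w x. Proof. by move=> Dx; exact: (rho0_gt0 rhoP Dx). Qed.
Let w_ge0 x : 0 <= w x. Proof. exact: (rho0_ge0 rhoP x). Qed.
Let Ew : 0 < E w := rho0_mass_gt0 r0 L0 rhoP.
Let V := fine (lebesgue R d D).
Let V0 : 0 < V := volume_eball_gt0 d L r0.

(** As [rho0] vanishes outside the ball, a proposal that leaves the ball has acceptance probability
    0. *)
Definition accept (x y : d.-tuple R) : R := Num.min 1 (w y / w x).

Lemma accept_ge0 x y : 0 <= accept x y.
Proof. by rewrite le_min ler01 divr_ge0. Qed.

Lemma accept_le1 x y : accept x y <= 1.
Proof. by rewrite ge_min lexx. Qed.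

Lemma bmf_accept : bmf (fun z => accept z.1 z.2).
Proof.
split; last by exists 1 => z; rewrite ger0_norm ?accept_ge0// accept_le1.
apply: measurable_minr; first exact: measurable_cst.
(* The inverse is expressed as the power -1, a measurable function on the whole line that takes the
   value 0 at 0. *)
rewrite (_ : (fun x => _) = fun z => w z.2 * w z.1 `^ (-1)); last first.
  by apply/funext => z; rewrite powR_inv1.
apply: measurable_funM.
  exact: (bmf_measurable (bmf_comp bw measurable_snd)).
apply: (measurableT_comp (measurable_powR (-1))).
exact: (bmf_measurable (bmf_comp bw measurable_fst)).
Qed.

Definition mhq (z : (d.-tuple R) * (d.-tuple R)) : R :=
  1 / 2 * skern eta z.1 z.2 ^+ 2 * accept z.1 z.2.

Lemma bmf_mhq : bmf mhq.
Proof.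
apply: bmfM bmf_accept; apply: bmfM; first exact: bmf_cst.
exact: bmfX (bmf_skern2 d eta0).
Qed.

Lemma mhq_ge0 z : 0 <= mhq z.
Proof.
apply: mulr_ge0; last exact: accept_ge0.
by apply: mulr_ge0; [rewrite divr_ge0|exact: sqr_ge0].
Qed.

Lemma mhqE x y : D x -> w x * mhq (x, y) =
  1 / 2 * (Num.min (w x) (w y) * skern eta x y ^+ 2).
Proof.
move=> Dx; have x0 := w_gt0 Dx; rewrite /mhq /accept /=.
have -> : Num.min (w x) (w y) = w x * Num.min 1 (w y / w x).
  by rewrite minr_pMr ?mulr1 ?ltW// mulrC divfK// gt_eqF.
ring.
Qed.

Lemma mhq_sym x y : D x -> D y -> w x * mhq (x, y) = w y * mhq (y, x).
Proof. by move=> Dx Dy; rewrite !mhqE// minC /skern rootk_vsubC. Qed.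

Lemma mhq_mass x : D x -> E (fun y => mhq (x, y)) <= 1 / 2.
Proof.
move=> Dx; have bk := bmfX 2 (bmf_skern eta0 x).
apply: (@le_trans _ _ (E (fun y => 1 / 2 * skern eta x y ^+ 2))).
  apply: bint_le => //; [exact: (bmf_pair1 x bmf_mhq)|by apply: bmfM => //; exact: bmf_cst|].
  move=> y Dy; rewrite /mhq/= ler_piMr ?accept_le1//.
  by apply: mulr_ge0; [rewrite divr_ge0|exact: sqr_ge0].
rewrite (bintZl mD finD _ bk) -[leRHS]mulr1; apply: ler_wpM2l; first by rewrite divr_ge0.
rewrite -lee_fin EFin_bmf_integral// -(rootk_mass_shift eta0 x).
apply: ge0_subset_integral => //.
  by apply/measurable_EFinP; exact: bmf_measurable.
by move=> y _; rewrite lee_fin sqr_ge0.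
Qed.

Lemma mhgapV_gt0 : 0 < 208 * 10 ^+ 3 * K.
Proof.
by apply: mulr_gt0; [rewrite mulr_gt0 ?exprn_gt0 ?ltr0n|exact: dimK_gt0].
Qed.

(** 208 = 4 * 52: one factor 2 is the 1/2 of the Dirichlet form, the other the laziness in [mhq]. *)
Definition mhgap : R := (208 * 10 ^+ 3 * K)^-1.

Lemma mhgap_gt0 : 0 < mhgap.
Proof. by rewrite invr_gt0; exact: mhgapV_gt0. Qed.

Lemma mhgap_le1 : mhgap <= 1.
Proof.
have k1 := dimK_ge1 d r L; rewrite /mhgap invf_le1.
  by move: k1; move: K => k; lra.
exact: mhgapV_gt0.
Qed.

Lemma mh_poincare f : bmf f -> exists c, mhgap * E (fun x => (f x - c) ^+ 2 * w x) <=
  1 / 2 * dint (lebesgue R d) D (fun z => w z.1 * mhq z * (f z.2 - f z.1) ^+ 2).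
Proof.
move=> bf; have [c hc] := nonlocal_poincare r0 L0 rhoP bf; exists c.
have b1 : bmf (fun z : d.-tuple R * d.-tuple R => f z.1) by exact: bmf_comp bf measurable_fst.
have b2 : bmf (fun z : d.-tuple R * d.-tuple R => f z.2) by exact: bmf_comp bf measurable_snd.
have b3 : bmf (fun z => Num.min (w z.1) (w z.2) * skern eta z.1 z.2 ^+ 2 * (f z.2 - f z.1) ^+ 2).
  apply: bmfM; last by bmf_tac.
  apply: bmfM; last exact: bmfX (bmf_skern2 d eta0).
  by apply: bmf_min; [exact: (bmf_comp bw measurable_fst)|exact: (bmf_comp bw measurable_snd)].
have e : dint (lebesgue R d) D (fun z => w z.1 * mhq z * (f z.2 - f z.1) ^+ 2) =
    1 / 2 * E (fun x => E (fun y => Num.min (w x) (w y) * skern eta x y ^+ 2 * (f y - f x) ^+ 2)).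
  rewrite -(dintZ mD finD (1 / 2) b3).
  by apply: dint_eq => x y Dx Dy /=; rewrite mhqE//; ring.
rewrite e mulrC ler_pdivrMr; last exact: mhgapV_gt0.
apply: (le_trans hc); rewrite le_eqVlt; apply/orP; left; apply/eqP.
by field.
Qed.

(** Density on the ball of the uniform distribution with respect to the target distribution. *)
Definition start_density (x : d.-tuple R) : R := E w / V * w x `^ (-1).

Let w_lower x : D x -> E w <= V * (w x * expR (2 * (L * r))).
Proof.
move=> Dx; rewrite mulrC -bint_cst//; apply: bint_le => //; first exact: bmf_cst.
by move=> y Dy; exact: rho0_ratio.
Qed.

Lemma start_density_ge0 x : 0 <= start_density x.
Proof. by rewrite /start_density mulr_ge0 ?powR_ge0// divr_ge0// ltW. Qed.

Lemma start_density_le x : D x -> start_density x <= expR (2 * (L * r)).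
Proof.
move=> Dx; rewrite /start_density powR_inv1//.
rewrite ler_pdivrMr ?w_gt0// ler_pdivrMr//.
by apply: (le_trans (w_lower Dx)); rewrite le_eqVlt; apply/orP; left; apply/eqP; ring.
Qed.

Lemma bmf_start_density : bmf start_density.
Proof.
split.
  apply: measurable_funM; first exact: measurable_cst.
  apply: (measurableT_comp (measurable_powR (-1))).
  exact: bmf_measurable.
exists (expR (2 * (L * r))) => x; rewrite ger0_norm ?start_density_ge0//.
have [Dx|Dx] := pselect (D x); first exact: start_density_le.
by rewrite /start_density rho0N// powR0 ?mulr0 ?expR_ge0// oppr_eq0.
Qed.

Lemma start_densityE F : bmf F ->
  E (fun x => start_density x * F x * w x) = E w / V * E F.
Proof.
move=> bF; rewrite -(bintZl mD finD _ bF); apply: bint_eq => x Dx.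
rewrite /start_density powR_inv1//; have := w_gt0 Dx.
by move: (E w) => z x0; field; rewrite !gt_eqF.
Qed.

Local Notation P := (lazyP (lebesgue R d) D mhq).

Theorem metropolis_mse (p : R) (f : d.-tuple R -> R) n0 N : 2 < p -> p <= 4 -> bmf f ->
  E (fun x => `|f x| `^ p * w x) <= E w ->
  mexp p * expR ((2 * (L * r) * (mexp p - 1) - mhgap * n0%:R) / mexp p) <= 1 / 4 ->
  E (iter n0 P (chain_sqr (lebesgue R d) D mhq
    (fun x => f x - E (fun x => f x * w x) / E w) N)) <=
  9 * N%:R ^+ 2 / (mhgap * N%:R) * V.
Proof.
move=> p2 p4 bf fp hn.
have A0 : 0 <= 2 * (L * r) by rewrite !mulr_ge0// ltW.
have h1 : E (fun x => start_density x * w x) = E w.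
  transitivity (E (fun x => start_density x * 1 * w x)); first by apply: bint_eq => x _; ring.
  rewrite (start_densityE (bmf_cst _ 1)) bint_cst// mul1r divfK// gt_eqF//.
have := chain_sqr_mse mD finD bw w_gt0 Ew bmf_mhq mhq_ge0 mhq_sym mhq_mass
  mhgap_gt0 mhgap_le1 mh_poincare p2 p4 A0 bf fp bmf_start_density
  (fun x _ => start_density_ge0 x) start_density_le h1 N hn.
set B := iter n0 _ _.
have bB : bmf B.
  apply: bmf_iter_lazyP => //; first exact: bmf_mhq.
  apply: bmf_chain_sqr => //; [exact: bmf_mhq|by bmf_tac].
rewrite /wip start_densityE//.
have -> : E w / V * E B = E B / V * E w 
  by rewrite mulrAC [RHS]mulrAC [E B * _]mulrC.
rewrite ler_pM2r// ler_pdivrMr//.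
Qed.

End metropolis.

(** * Simulation of the chain *)

Section density_probability.
Context (R : realType) dd (T : measurableType dd).
Variables (mu : {sigma_finite_measure set T -> \bar R}) (g : T -> R).
Hypotheses (mg : measurable_fun setT g) (g0 : forall x, 0 <= g x).
Hypothesis g1 : (\int[mu]_x (g x)%:E = 1)%E.

(* The arguments record that [g] is a probability density. *)
Definition density_prob (_ : measurable_fun setT g) (_ : forall x, 0 <= g x)
    (_ : (\int[mu]_x (g x)%:E = 1)%E) : set T -> \bar R :=
  fun A => (\int[mu]_(x in A) (g x)%:E)%E.

Local Notation nu := (density_prob mg g0 g1).

Let nu0 : nu set0 = 0%E.
Proof. by rewrite /density_prob integral_set0. Qed.

Let nu_ge0 A : (0 <= nu A)%E.
Proof. by apply: integral_ge0 => x _; rewrite lee_fin. Qed.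

Let nu_sigma_additive : semi_sigma_additive nu.
Proof.
move=> F mF tF mUF; rewrite /density_prob ge0_integral_bigcup//.
- by apply: is_cvg_ereal_nneg_natsum_cond => k _ _; exact: nu_ge0.
- by apply/measurable_EFinP; exact: measurable_funTS.
- by move=> x _; rewrite lee_fin.
Qed.

HB.instance Definition _ := isMeasure.Build _ _ _ nu nu0 nu_ge0 nu_sigma_additive.

HB.instance Definition _ := @Measure_isProbability.Build _ _ R nu g1.

(** [g] agrees almost everywhere with the Radon-Nikodym derivative, because both have the same
    integral over every measurable set; the general change of variables then applies. *)
Lemma integral_density_prob (f : T -> \bar R) : measurable_fun setT f ->
  (forall x, 0 <= f x)%E ->
  (\int[nu]_x f x = \int[mu]_x (f x * (g x)%:E))%E.
Proof.
move=> mf f0.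
have numu : nu `<< mu.
  apply/null_content_dominatesP => A mA muA0; rewrite /density_prob.
  by rewrite null_set_integral//; apply/measurable_EFinP; exact: measurable_funTS.
have mEg : measurable_fun setT (EFin \o g) by exact/measurable_EFinP.
have ae : ae_eq mu setT (Radon_Nikodym_SigmaFinite.f nu mu) (EFin \o g).
  apply: integral_ae_eq => //; first exact: Radon_Nikodym_SigmaFinite.f_integrable.
  by move=> E _ mE; rewrite -Radon_Nikodym_SigmaFinite.f_integral.
rewrite -(Radon_Nikodym_SigmaFinite.change_of_variables numu f0)//.
apply: ge0_ae_eq_integral => //.
- apply: emeasurable_funM => //.
  by apply: measurable_int (Radon_Nikodym_SigmaFinite.f_integrable numu).
- exact: emeasurable_funM.
- by move=> x _; rewrite mule_ge0// Radon_Nikodym_SigmaFinite.f_ge0.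
- by move=> x _; rewrite mule_ge0// lee_fin.
- by apply: filterS ae => x /= h _; rewrite h.
Qed.

End density_probability.

Section iid.
Context (R : realType) dd (V : measurableType dd).
Variable kappa : probability V R.

Definition consv n (z : V * n.-tuple V) : n.+1.-tuple V := [tuple of z.1 :: z.2].

Lemma measurable_consv n : measurable_fun setT (@consv n).
Proof. exact: measurable_cons measurable_fst measurable_snd. Qed.

HB.instance Definition _ n := isMeasurableFun.Build _ _ _ _ (@consv n)
  (@measurable_consv n).

Fixpoint iid n : probability (n.-tuple V) R :=
  match n with
  | 0 => dirac [tuple]
  | k.+1 => distribution (kappa \x iid k)%E (@consv k)
  end.

Lemma integral_iidS n (F : n.+1.-tuple V -> \bar R) : measurable_fun setT F ->
  (forall w, 0 <= F w)%E ->
  (\int[iid n.+1]_w F w = \int[kappa]_v \int[iid n]_w F (consv (v, w)))%E.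
Proof.
move=> mF F0; rewrite /= ge0_integral_distribution//.
rewrite (@fubini_tonelli1 _ _ _ _ _ kappa (iid n) (F \o @consv n))//.
  exact: (measurableT_comp mF (@measurable_consv n)).
by move=> z; exact: F0.
Qed.

End iid.

Lemma uniform_threshold (R : realType) (a b al : R) : 0 <= a -> 0 <= b ->
  0 <= al <= 1 ->
  (\int[uniform_prob (@ltr01 R)]_t (if (t < al)%R then a else b)%:E =
   (al * a + (1 - al) * b)%:E)%E.
Proof.
move=> a0 b0 /andP[al0 al1].
have mf : measurable_fun setT (fun t : measurableTypeR R => (if (t < al)%R then a else b)%:E).
  apply/measurable_EFinP; apply: measurable_fun_ifT => //.
  exact: measurable_fun_ltr.
rewrite integral_uniform//; last by move=> t; rewrite lee_fin; case: ifP.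
rewrite subr0 invr1 mul1e.
have -> : `[0, 1]%classic = `[0, al[%classic `|` `[al, 1]%classic :> set R.
  apply/seteqP; split => t /=; rewrite !in_itv/=.
    move=> /andP[t0 t1]; have [ta|ta] := ltP t al; first by left; rewrite t0.
    by right.
  by move=> [/andP[t0 t1]|/andP[t0 t1]]; apply/andP; split => //; lra.
rewrite ge0_integral_setU//; last 3 first.
- exact: measurable_funTS.
- by move=> t _; rewrite lee_fin; case: ifP.
- rewrite disj_set2E; apply/eqP/seteqP; split => t //=; rewrite !in_itv/=.
  by move=> [/andP[_ t1] /andP[t2 _]]; move: (lt_le_trans t1 t2); rewrite ltxx.
rewrite (eq_integral (fun=> a%:E)); last first.
  by move=> t /[!inE]/=; rewrite in_itv/= => /andP[_ ->].
rewrite [X in (_ + X)%E](eq_integral (fun=> b%:E)); last first.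
  by move=> t /[!inE]/=; rewrite in_itv/= => /andP[ta _]; rewrite ltNge ta.
rewrite !integral_cst//= !lebesgue_measure_itv/= !lte_fin.
have -> : (if (0 < al)%R then al%:E + (- 0)%:E else 0%R)%E = al%:E.
  case: (ltP 0 al) => h; first by rewrite oppr0 adde0.
  by have -> : al = 0 by apply/le_anti; rewrite h.
have -> : (if (al < 1)%R then 1 + (- al)%:E else 0%R)%E = (1 - al)%:E.
  case: (ltP al 1) => h; first by rewrite EFinB.
  by have -> : al = 1; [apply/le_anti; rewrite al1|rewrite subrr].
by rewrite -!EFinM -EFinD; congr (_%:E); ring.
Qed.

Section metropolis_walk.
Context (R : realType) (d : nat) (r L : R) (rho : d.-tuple R -> R).
Hypotheses (r0 : 0 < r) (L0 : 0 <= L) (rhoP : RL L (@eball R d r) rho).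
Local Notation D := (@eball R d r).
Local Notation E f := (\int[lebesgue R d]_(y in D) (f y)).
Local Notation eta := (@stepsize R d r L).
Local Notation w := (@rho0 R d r rho).
Local Notation acc := (@accept R d r rho).
Local Notation MHQ := (@mhq R d r L rho).
Local Notation P := (lazyP (lebesgue R d) D MHQ).

Let mD := @measurable_eball R d r.
Let finD := @lebesgue_eball_fin R d r r0.
Let eta0 : 0 < eta := stepsize_gt0 d L r0.
Let bq : bmf MHQ := bmf_mhq r0 L0 rhoP.

Definition noise := (d.-tuple R * measurableTypeR R)%type.

Let mk : measurable_fun setT (fun u : d.-tuple R => rootk eta u ^+ 2).
Proof. by apply: measurable_funX; exact: (measurable_rootk eta0). Qed.

Definition noise_prob : probability noise R :=
  (density_prob mk (fun u => sqr_ge0 (rootk eta u)) (rootk_mass eta0 d) \x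
   uniform_prob (@ltr01 R))%E.

(** A single uniform variable decides on laziness and acceptance together, through the threshold 1/2
    times the acceptance probability. *)
Definition mhstep (x : d.-tuple R) (v : noise) : d.-tuple R :=
  let y := vadd x v.1 in
  if (enorm y <= r) && (v.2 < 1 / 2 * acc x y) then y else x.

Lemma mhstep_eball x v : D x -> D (mhstep x v).
Proof. by move=> Dx; rewrite /mhstep; case: ifP => // /andP[]. Qed.

Lemma measurable_enorm : measurable_fun setT (@enorm R d).
Proof.
apply: (@measurableT_comp _ _ _ _ _ _ (@Num.sqrt R)); last exact: measurable_sqn.
by apply: continuous_measurable_fun => x; exact: sqrt_continuous.
Qed.

Lemma measurable_mhstep dd (T : measurableType dd) (X : T -> d.-tuple R) (v : T -> noise) :
  measurable_fun setT X -> measurable_fun setT v ->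
  measurable_fun setT (fun z => mhstep (X z) (v z)).
Proof.
move=> mX mv.
have mv1 : measurable_fun setT (fun z => (v z).1) by exact: measurableT_comp.
have mv2 : measurable_fun setT (fun z => (v z).2) by exact: measurableT_comp.
have my := measurable_vadd mX mv1.
apply: measurable_fun_ifT => //; apply: measurable_and.
  apply: measurable_fun_ler; last exact: measurable_cst.
  exact: (measurableT_comp measurable_enorm my).
apply: measurable_fun_ltr => //; apply: measurable_funM; first exact: measurable_cst.
exact: (measurableT_comp (bmf_measurable (bmf_accept r0 L0 rhoP))
  (measurable_fun_pair mX my)).
Qed.

Lemma integral_noise (F : noise -> \bar R) : measurable_fun setT F ->
  (forall v, 0 <= F v)%E ->
  (\int[noise_prob]_v F v =
   \int[lebesgue R d]_u ((\int[uniform_prob (@ltr01 R)]_t F (u, t)) * (rootk eta u ^+ 2)%:E))%E.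
Proof.
move=> mF F0; rewrite /noise_prob fubini_tonelli1// integral_density_prob//.
  exact: measurable_fun_fubini_tonelli_F.
by move=> u; exact: integral_ge0.
Qed.

Lemma mhstep_integral_ge0 (F : d.-tuple R -> R) x : bmf F -> (forall y, 0 <= F y) ->
  D x -> (\int[noise_prob]_v (F (mhstep x v))%:E = (P F x)%:E)%E.
Proof.
move=> bF F0 Dx.
have mFs : measurable_fun setT (fun v => (F (mhstep x v))%:E).
  apply/measurable_EFinP; apply: (measurableT_comp (bmf_measurable bF)).
  by apply: measurable_mhstep => //; exact: measurable_cst.
rewrite integral_noise//; last by move=> v; rewrite lee_fin.
(* The mean of F after the step for the given proposal y, the uniform variable being integrated
   out. *)
pose G y := F x + 1 / 2 * acc x y * (F y - F x).
have bacc : bmf (acc x) by exact: (bmf_pair1 x (bmf_accept r0 L0 rhoP)).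
have bG : bmf G by bmf_tac.
have GE y : G y = 1 / 2 * acc x y * F y + (1 - 1 / 2 * acc x y) * F x by rewrite /G; ring.
have a0 y : 0 <= 1 / 2 * acc x y by apply: mulr_ge0 => //; exact: accept_ge0 rhoP _ _.
have a1 y : 1 / 2 * acc x y <= 1 by have := accept_le1 r rho x y; lra.
have G0 y : 0 <= G y.
  by rewrite GE addr_ge0// mulr_ge0// subr_ge0.
have accN y : ~ D y -> acc x y = 0.
  by move=> Dy; rewrite /accept (rho0N rho Dy) mul0r min_r.
have inner u : (\int[uniform_prob (@ltr01 R)]_t (F (mhstep x (u, t)))%:E = (G (vadd x u))%:E)%E.
  have [yr|yr] := pselect (D (vadd x u)).
    rewrite GE -uniform_threshold ?a0 ?a1//; apply: eq_integral => t _.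
    by rewrite /mhstep/= (yr : enorm _ <= r)/=; case: ifP.
  rewrite /G accN// mulr0 mul0r addr0.
  rewrite (eq_integral (fun=> (F x)%:E)); last first.
    by move=> t _; rewrite /mhstep/=; case: ifP => // /andP[].
  by rewrite integral_cst//= probability_setT mule1.
under eq_integral => u _ do rewrite inner.
pose k y := skern eta x y ^+ 2.
have k0 y : 0 <= k y by exact: sqr_ge0.
have bk : bmf k by exact: bmfX (bmf_skern eta0 x).
have mk' : measurable_fun setT k by exact: bmf_measurable.
transitivity (\int[lebesgue R d]_y (G y * k y)%:E)%E.
  rewrite -(integral_lebesgue_shift x).
  - by apply: eq_integral => u _; rewrite /k /skern vaddK EFinM.
  - by apply/measurable_EFinP; apply: measurable_funM => //; exact: bmf_measurable.
  - by move=> y; rewrite lee_fin mulr_ge0.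
pose q y := MHQ (x, y).
have bq1 : bmf q by exact: (bmf_pair1 x bq).
have q0 y : 0 <= q y by exact: mhq_ge0 rhoP _.
have qN y : ~ D y -> q y = 0 by move=> Dy; rewrite /q /mhq/= accN// mulr0.
have qint c : bmf c -> (\int[lebesgue R d]_y (q y * c y)%:E = (E (fun y => q y * c y))%:E)%E.
  move=> bc; rewrite EFin_bmf_integral//; last by bmf_tac.
  rewrite [RHS]integral_mkcond; apply: eq_integral => y _; rewrite patchE.
  by case: ifPn => //; rewrite notin_setE => Dy; rewrite qN// mul0r.
have bFx := bmf_cst (d.-tuple R) (F x).
(* The term with F x is added to both sides, so that only nonnegative functions are integrated over
   the whole space; it is finite and is subtracted afterwards. *)
have key : (\int[lebesgue R d]_y (G y * k y)%:E + (E (fun y => q y * F x))%:E =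
    (F x + E (fun y => q y * F y))%:E)%E.
  rewrite EFinD -(qint _ bFx) -(qint _ bF) -ge0_integralD//; last 4 first.
  - by move=> y _; rewrite lee_fin mulr_ge0.
  - by apply/measurable_EFinP; apply: measurable_funM => //; exact: bmf_measurable.
  - by move=> y _; rewrite lee_fin mulr_ge0.
  - by apply/measurable_EFinP; apply: measurable_funM; exact: bmf_measurable.
  have -> : (F x)%:E = (\int[lebesgue R d]_y ((F x)%:E * (k y)%:E))%E.
    rewrite ge0_integralZl_EFin//;
      [|by move=> y _; rewrite lee_fin|exact/measurable_EFinP].
    by rewrite (rootk_mass_shift eta0 x) mule1.
  rewrite -ge0_integralD//; last 4 first.
  - by move=> y _; rewrite mule_ge0// lee_fin.
  - by apply: measurable_funeM; exact/measurable_EFinP.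
  - by move=> y _; rewrite lee_fin mulr_ge0.
  - by apply/measurable_EFinP; apply: measurable_funM; exact: bmf_measurable.
  apply: eq_integral => y _; rewrite -EFinM -!EFinD; congr (_%:E).
  by rewrite /G /q /mhq /k/=; ring.
have b1 : bmf (fun y => q y * F y) by bmf_tac.
have b2 : bmf (fun y => q y * F x) by bmf_tac.
transitivity (\int[lebesgue R d]_y (G y * k y)%:E + (E (fun y => q y * F x))%:E -
  (E (fun y => q y * F x))%:E)%E; first by rewrite addeK.
rewrite key -EFinB; congr (_%:E).
rewrite /lazyP -addrA -(bintB mD finD b1 b2); congr (_ + _).
by apply: bint_eq => y _; rewrite /q; ring.
Qed.

(** The moments to be inserted for F are known to be nonnegative on the ball only. The step never
    leaves the ball, so F can be exchanged for its positive part. *)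
Lemma mhstep_integral (F : d.-tuple R -> R) x : bmf F -> (forall y, D y -> 0 <= F y) ->
  D x -> (\int[noise_prob]_v (F (mhstep x v))%:E = (P F x)%:E)%E.
Proof.
move=> bF F0 Dx.
have FE y : D y -> Num.max 0 (F y) = F y by move=> Dy; rewrite max_r// F0.
transitivity (\int[noise_prob]_v (Num.max 0 (F (mhstep x v)))%:E)%E.
  by apply: eq_integral => v _; rewrite FE//; exact: mhstep_eball.
rewrite (@mhstep_integral_ge0 (fun y => Num.max 0 (F y)))//.
- congr (_%:E); rewrite /lazyP FE//; congr (_ + _).
  by apply: bint_eq => y Dy; rewrite FE.
- exact: (bmf_max (bmf_cst _ 0) bF).
- by move=> y; rewrite le_max lexx.
Qed.

Definition walk (x : d.-tuple R) (s : seq noise) : d.-tuple R := foldl mhstep x s.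

Lemma walk_eball x s : D x -> D (walk x s).
Proof. by elim: s x => //= v s IH x Dx; apply: IH; exact: mhstep_eball. Qed.

Lemma measurable_walk dd (T : measurableType dd) n k (X : T -> d.-tuple R)
    (v : T -> n.-tuple noise) :
  measurable_fun setT X -> measurable_fun setT v ->
  measurable_fun setT (fun z => walk (X z) (take k (v z))).
Proof.
move=> mX mv; elim: k => [|k IH].
  rewrite (_ : (fun z => _) = X)//.
  by apply/funext => z; rewrite take0.
have [kn|kn] := ltnP k n; last first.
  rewrite (_ : (fun z => _) = fun z => walk (X z) (take k (v z)))//.
  by apply/funext => z; rewrite !take_oversize ?size_tuple// ltnW.
rewrite (_ : (fun z => _) = fun z => mhstep (walk (X z) (take k (v z)))
    (tnth (v z) (Ordinal kn))).
  apply: measurable_mhstep => //.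
  exact: (measurableT_comp (measurable_tnth (Ordinal kn)) mv).
apply/funext => z; rewrite (take_nth (tnth (v z) (Ordinal kn))) ?size_tuple//.
by rewrite /walk foldl_rcons -(tnth_nth _ (v z) (Ordinal kn)).
Qed.

Section walk_sum.
Variable phi : d.-tuple R -> R.
Hypothesis bphi : bmf phi.
Local Notation A := (chain_sum (lebesgue R d) D MHQ phi).
Local Notation B := (chain_sqr (lebesgue R d) D MHQ phi).

Let bA n : bmf (A n). Proof. exact: bmf_chain_sum. Qed.
Let bB n : bmf (B n). Proof. exact: bmf_chain_sqr. Qed.

Definition walk_sum (n0 N : nat) (x : d.-tuple R) (s : seq noise) : R :=
  \sum_(k < N) phi (walk x (take (n0 + k) s)).

Let measurable_walk_sqr n n0 N x (s : R) :
  measurable_fun setT (fun v : n.-tuple noise => ((s + walk_sum n0 N x v) ^+ 2)%:E).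
Proof.
apply/measurable_EFinP; apply: measurable_funX; apply: measurable_funD.
  exact: measurable_cst.
apply: measurable_sum => k; apply: (measurableT_comp (bmf_measurable bphi)).
apply: measurable_walk; [exact: measurable_cst|exact: measurable_id].
Qed.

(** The offset [s] stands for the values already summed. It makes the induction close: after one
    step the offset becomes s + phi x, and the mixed term brings in the first moment [chain_sum]. *)
Lemma walk_sum_sqr0 n N x (s : R) : (N <= n)%N -> D x ->
  (\int[iid noise_prob n]_v ((s + walk_sum 0 N x v) ^+ 2)%:E =
   (s ^+ 2 + 2 * s * A N x + B N x)%:E)%E.
Proof.
elim: N n x s => [|N IH] n x s Nn Dx.
  rewrite (eq_integral (fun=> (s ^+ 2)%:E)); last first.
    by move=> v _; rewrite /walk_sum big_ord0 addr0.
  by rewrite integral_cst//= probability_setT mule1 mulr0 !addr0.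
case: n Nn => // n Nn.
rewrite integral_iidS//; last by move=> v; rewrite lee_fin sqr_ge0.
pose F y := (s + phi x) ^+ 2 + 2 * (s + phi x) * A N y + B N y.
have bAN := bA N; have bBN := bB N.
have bF : bmf F by bmf_tac.
have FE y : D y -> (\int[iid noise_prob n]_v ((s + phi x + walk_sum 0 N y v) ^+ 2)%:E = (F y)%:E)%E.
  by move=> Dy; exact: IH.
have F0 y : D y -> 0 <= F y.
  move=> Dy; rewrite -lee_fin -FE//; apply: integral_ge0 => v _.
  by rewrite lee_fin sqr_ge0.
transitivity (\int[noise_prob]_v (F (mhstep x v))%:E)%E.
  apply: eq_integral => v _; rewrite -FE; last exact: mhstep_eball.
  apply: eq_integral => u _; rewrite /walk_sum big_ord_recl/= addrA.
  by congr ((_ + _) ^+ 2)%:E.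
rewrite mhstep_integral//; congr (_%:E); rewrite /F /=.
have b1 : bmf (fun y => (s + phi x) ^+ 2 + 2 * (s + phi x) * A N y) by bmf_tac.
have b2 : bmf (fun y => 2 * (s + phi x) * A N y) by bmf_tac.
rewrite (lazyPD mD finD bq b1 bBN) (lazyPD mD finD bq (bmf_cst _ _) b2).
rewrite (lazyPZ mD finD bq _ bAN) lazyP_cst//.
by ring.
Qed.

Lemma walk_sum_sqr n n0 N x : (n0 + N <= n)%N -> D x ->
  (\int[iid noise_prob n]_v (walk_sum n0 N x v ^+ 2)%:E = (iter n0 P (B N) x)%:E)%E.
Proof.
elim: n0 n x => [|n0 IH] n x Nn Dx.
  have := @walk_sum_sqr0 n N x 0 Nn Dx.
  rewrite expr0n/= mulr0 mul0r !add0r => <-.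
  by apply: eq_integral => v _; rewrite add0r.
case: n Nn => // n Nn.
have mW : measurable_fun setT (fun v : n.+1.-tuple noise => (walk_sum n0.+1 N x v ^+ 2)%:E).
  have := @measurable_walk_sqr n.+1 n0.+1 N x 0.
  by under eq_fun do rewrite add0r.
rewrite integral_iidS//; last by move=> v; rewrite lee_fin sqr_ge0.
have bF : bmf (iter n0 P (B N)) by exact: bmf_iter_lazyP.
have FE y : D y -> (\int[iid noise_prob n]_v (walk_sum n0 N y v ^+ 2)%:E = (iter n0 P (B N) y)%:E)%E.
  by move=> Dy; exact: IH.
have F0 y : D y -> 0 <= iter n0 P (B N) y.
  move=> Dy; rewrite -lee_fin -FE//; apply: integral_ge0 => v _.
  by rewrite lee_fin sqr_ge0.
rewrite iterS -mhstep_integral//; apply: eq_integral => v _.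
by rewrite -FE//; exact: mhstep_eball.
Qed.

End walk_sum.

End metropolis_walk.

Section answers_nth.
Context (R : realType) (d n : nat) (A : algorithm R d n) (f rho : d.-tuple R -> R).

Lemma nth_answers1 w i j : (j < i)%N ->
  nth 0 (@answers R d n A f rho w i).1 j = f (@sample R d n A f rho w j).
Proof.
elim: i => // i IH; rewrite ltnS leq_eqVlt => /orP[/eqP ->|ji] /=.
  by rewrite nth_rcons size_tuple ltnn eqxx.
by rewrite nth_rcons size_tuple ji IH.
Qed.

Lemma nth_answers2 w i j : (j < i)%N ->
  nth 0 (@answers R d n A f rho w i).2 j = rho (@sample R d n A f rho w j).
Proof.
elim: i => // i IH; rewrite ltnS leq_eqVlt => /orP[/eqP ->|ji] /=.
  by rewrite nth_rcons size_tuple ltnn eqxx.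
by rewrite nth_rcons size_tuple ji IH.
Qed.

End answers_nth.

(** * The chain as an algorithm driven by oracle answers *)

Section metropolis_algorithm.
Context (R : realType) (d : nat) (r L : R).
Hypothesis r0 : 0 < r.
Variables (n0 N : nat).
Local Notation D := (@eball R d r).
Local Notation noise := (noise R d).
Local Notation M := (n0 + N)%N.
Local Notation nq := (M.*2).

Let mD := @measurable_eball R d r.
Let finD := @lebesgue_eball_fin R d r r0.
Let V := fine (lebesgue R d D).
Let V0 : 0 < V := volume_eball_gt0 d L r0.

Definition vzero : d.-tuple R := [tuple 0 | i < d].

(** Queries have to lie in the ball for every seed and all answers, including starting points of
    probability 0 and proposals that leave the ball. *)
Definition clamp (x : d.-tuple R) : d.-tuple R := if enorm x <= r then x else vzero.

Lemma clamp_eball x : D (clamp x).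
Proof. by rewrite /clamp; case: ifP => // _; exact: eball0. Qed.

Lemma measurable_clamp : measurable_fun setT clamp.
Proof.
apply: measurable_fun_ifT => //.
by apply: measurable_fun_ler => //; exact: measurable_enorm.
Qed.

Definition start_pdf (x : d.-tuple R) : R := V^-1 * \1_D x.

Lemma measurable_start_pdf : measurable_fun setT start_pdf.
Proof.
by apply: measurable_funM; [exact: measurable_cst|exact: measurable_indic].
Qed.

Lemma start_pdf_ge0 x : 0 <= start_pdf x.
Proof. by rewrite /start_pdf mulr_ge0// invr_ge0 ltW. Qed.

Lemma start_pdf_mass : (\int[lebesgue R d]_x (start_pdf x)%:E = 1)%E.
Proof.
under eq_integral => x _ do rewrite /start_pdf EFinM.
rewrite ge0_integralZl_EFin//; last 2 first.
- by apply/measurable_EFinP; exact: measurable_indic.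
- by rewrite invr_ge0 ltW.
rewrite integral_indic// setIT -[X in (_ * X)%E]fineK ?ge0_fin_numE//.
by rewrite -EFinM mulVf// gt_eqF.
Qed.

Definition start_prob : probability (d.-tuple R) R :=
  density_prob measurable_start_pdf start_pdf_ge0 start_pdf_mass.

Definition mhseed := (d.-tuple R * M.-tuple noise)%type.

Definition seed_prob : probability mhseed R :=
  (start_prob \x iid (noise_prob d L r0) M)%E.

(** Every call receives the same seed, which holds the starting point and all the noise, so each
    query can recompute the whole past. The joint law of the seeds is thus concentrated on the
    diagonal. *)
Definition diag (s : mhseed) : nq.-tuple mhseed := [tuple s | i < nq].

Lemma measurable_diag : measurable_fun setT diag.
Proof.
apply/measurable_fun_tnthP => i.
rewrite (_ : _ \o _ = id); first exact: measurable_id.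
by apply/funext => s; rewrite /= tnth_mktuple.
Qed.

HB.instance Definition _ := isMeasurableFun.Build _ _ _ _ diag measurable_diag.

(* The [k]-th state of the chain, recomputed from the answers [b] of the
   density oracle: [b_(2j)] and [b_(2j+1)] are the values at the [j]-th state
   and at the [j]-th proposal. *)
Fixpoint mhstate (k : nat) (b : seq R) (s : mhseed) : d.-tuple R :=
  match k with
  | 0 => clamp s.1
  | j.+1 =>
    let x := mhstate j b s in
    let v := nth point s.2 j in
    let y := vadd x v.1 in
    if (enorm y <= r) &&
       (v.2 * nth 0 b j.*2 < 1 / 2 * Num.min (nth 0 b j.*2) (nth 0 b j.*2.+1))
    then y else x
  end.

(** Odd calls evaluate the proposal. If it lies outside the ball, the origin is queried in its place
    and the answer has no effect, because [mhstate] tests the norm as well. *)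
Definition mhpoint (i : nat) (b : seq R) (s : mhseed) : d.-tuple R :=
  let x := mhstate i./2 b s in
  if odd i then clamp (vadd x (nth point s.2 i./2).1) else x.

(** Only answers of even index belong to states of the chain, and the first n0 states are
    burn-in. *)
Definition mhoutput (a : seq R) : R :=
  N%:R^-1 * \sum_(k < N) nth 0 a (n0 + k).*2.

Definition mhalg : algorithm R d nq :=
  {| law := distribution seed_prob diag;
     query := fun i _ b s => mhpoint i b s;
     output := fun a _ => mhoutput a |}.

Lemma mhstate_eball k b s : D (mhstate k b s).
Proof.
elim: k => [|k IH] /=; first exact: clamp_eball.
by case: ifP => // /andP[].
Qed.

Lemma mhpoint_eball i b s : D (mhpoint i b s).
Proof.
by rewrite /mhpoint; case: ifP => _; [exact: clamp_eball|exact: mhstate_eball].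
Qed.

Section measurability.
Context (dd : measure_display) (T : measurableType dd).
Variables (b : T -> seq R) (s : T -> mhseed).
Hypotheses (mb : forall j, measurable_fun setT (fun z => nth 0 (b z) j))
  (ms : measurable_fun setT s).

Lemma measurable_nth_noise j : measurable_fun setT (fun z => nth point (s z).2 j).
Proof.
have m2 : measurable_fun setT (fun z => (s z).2) by exact: measurableT_comp.
have [jM|jM] := ltnP j M.
  rewrite (_ : (fun z => _) = fun z => tnth (s z).2 (Ordinal jM)).
    exact: (measurableT_comp (measurable_tnth (Ordinal jM)) m2).
  by apply/funext => z; rewrite (tnth_nth point).
rewrite (_ : (fun z => _) = fun=> point); first exact: measurable_cst.
by apply/funext => z; rewrite nth_default// size_tuple.
Qed.

Lemma measurable_mhstate k : measurable_fun setT (fun z => mhstate k (b z) (s z)).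
Proof.
elim: k => [|k IH] /=.
  apply: (measurableT_comp measurable_clamp).
  exact: measurableT_comp.
have mv := measurable_nth_noise k.
have mv1 : measurable_fun setT (fun z => (nth point (s z).2 k).1) by exact: measurableT_comp.
have mv2 : measurable_fun setT (fun z => (nth point (s z).2 k).2) by exact: measurableT_comp.
have my := measurable_vadd IH mv1.
apply: measurable_fun_ifT => //; apply: measurable_and.
  apply: measurable_fun_ler; last exact: measurable_cst.
  exact: (measurableT_comp (@measurable_enorm R d) my).
apply: measurable_fun_ltr; first exact: measurable_funM.
by apply: measurable_funM; [exact: measurable_cst|exact: measurable_minr].
Qed.

Lemma measurable_mhpoint i : measurable_fun setT (fun z => mhpoint i (b z) (s z)).
Proof.
rewrite /mhpoint; case: (odd i); last exact: measurable_mhstate.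
apply: (measurableT_comp measurable_clamp).
apply: measurable_vadd; first exact: measurable_mhstate.
by apply: measurableT_comp => //; exact: measurable_nth_noise.
Qed.

End measurability.

Section run.
Variables (f rho : d.-tuple R -> R).
Hypotheses (mf : measurable_fun D f) (mrho : measurable_fun D rho).

Let measurable_on_ball dd (T : measurableType dd) (h : d.-tuple R -> R)
    (X : T -> d.-tuple R) : measurable_fun D h -> measurable_fun setT X ->
  (forall z, D (X z)) -> measurable_fun setT (fun z => h (X z)).
Proof.
move=> mh mX DX; rewrite (_ : (fun z => _) = (h \_ D) \o X).
  exact: (measurableT_comp ((measurable_restrictT h mD).1 mh) mX).
by apply/funext => z /=; rewrite patchE mem_set.
Qed.

(** Strong induction: the answers that determine a query are values of [rho] at earlier samples,
    which are already measurable. *)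
Lemma measurable_mhsample i : (i < nq)%N ->
  measurable_fun setT (fun w => @sample R d _ mhalg f rho w i).
Proof.
elim/ltn_ind: i => i IH iM.
have ms : measurable_fun setT (fun w : nq.-tuple mhseed => nth point w i).
  rewrite (_ : (fun w => _) = fun w : nq.-tuple mhseed => tnth w (Ordinal iM)).
    exact: measurable_tnth.
  by apply/funext => w; rewrite (tnth_nth point).
apply: (measurable_mhpoint (b := fun w => (@answers R d _ mhalg f rho w i).2)) => // j.
have [ji|ji] := ltnP j i.
  rewrite (_ : (fun w => _) = fun w => rho (@sample R d _ mhalg f rho w j)).
    apply: measurable_on_ball => //; first by apply: IH => //; exact: ltn_trans iM.
    by move=> w; exact: mhpoint_eball.
  by apply/funext => w; rewrite nth_answers2.
rewrite (_ : (fun w => _) = fun=> 0); first exact: measurable_cst.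
by apply/funext => w; rewrite nth_default// size_tuple.
Qed.

Let even_lt k : (k < N)%N -> ((n0 + k).*2 < nq)%N.
Proof. by move=> kN; rewrite ltn_double ltn_add2l. Qed.

Lemma measurable_mhrun : measurable_fun setT (@run R d _ mhalg f rho).
Proof.
apply: measurable_funM; first exact: measurable_cst.
apply: measurable_sum => k.
rewrite (_ : (fun w => _) = fun w => f (@sample R d _ mhalg f rho w (n0 + k).*2)).
  apply: measurable_on_ball => //; first by apply: measurable_mhsample; exact: even_lt.
  by move=> w; exact: mhpoint_eball.
by apply/funext => w; rewrite nth_answers1//; exact: even_lt.
Qed.

Hypothesis rho0_ : forall x, D x -> 0 < rho x.

Let W (s : mhseed) k := walk r rho (clamp s.1) (take k s.2).

Let W_eball s k : D (W s k).
Proof. by apply: walk_eball; exact: clamp_eball. Qed.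

Let Y s k := clamp (vadd (W s k) (nth point s.2 k).1).

(** [mhstate] compares after multiplication by the density at the current state, which avoids
    dividing by an answer; positivity of [rho] makes this test equivalent to the one in [mhstep]. *)
Lemma mhstate_walk k b s : (k <= M)%N ->
  (forall j, (j < k)%N -> nth 0 b j.*2 = rho (W s j) /\ nth 0 b j.*2.+1 = rho (Y s j)) ->
  mhstate k b s = W s k.
Proof.
elim: k => [|k IH] kM hb; first by rewrite /W take0.
have Wk : mhstate k b s = W s k.
  by apply: IH => [|j jk]; [exact: ltnW|apply: hb; exact: ltnW].
have [b1 b2] := hb k (ltnSn k).
have -> : W s k.+1 = mhstep r rho (W s k) (nth point s.2 k).
  by rewrite /W (take_nth point) ?size_tuple// /walk foldl_rcons.
rewrite /= Wk b1 b2 /mhstep.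
set y := vadd _ _; have Wp := rho0_ (W_eball s k).
case: (leP (enorm y) r) => //= yD.
have yE : Y s k = y by rewrite /Y /clamp -/y yD.
have wW : rho0 r rho (W s k) = rho (W s k) by exact: rho0E (W_eball s k).
have wy : rho0 r rho y = rho y by exact: rho0E.
rewrite yE /accept wW wy.
have e : 1 / 2 * Num.min (rho (W s k)) (rho y) =
    1 / 2 * Num.min 1 (rho y / rho (W s k)) * rho (W s k).
  by rewrite -[RHS]mulrA; congr (_ * _); rewrite minr_pMl ?mul1r ?divfK ?gt_eqF// ltW.
by rewrite e (ltr_pM2r Wp).
Qed.

Lemma mhsample_walk s i : (i < nq)%N ->
  @sample R d _ mhalg f rho (diag s) i = if odd i then Y s i./2 else W s i./2.
Proof.
elim/ltn_ind: i => i IH iM.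
have iM2 : (i./2 < M)%N by rewrite -ltn_double (leq_ltn_trans _ iM)// -[leqRHS]odd_double_half leq_addl.
have st : nth point (diag s) i = s.
  by rewrite -(tnth_nth point _ (Ordinal iM)) tnth_mktuple.
have sW : mhstate i./2 (@answers R d _ mhalg f rho (diag s) i).2 s = W s i./2.
  apply: mhstate_walk; first exact: ltnW.
  move=> j ji.
  have j2 : (j.*2.+1 < i)%N.
    have : (j.+1.*2 <= i./2.*2)%N by rewrite leq_double.
    rewrite doubleS => /leq_trans; apply.
    by rewrite -[leqRHS]odd_double_half leq_addl.
  rewrite !nth_answers2//; last exact: ltnW.
  rewrite !IH//; [|exact: ltn_trans iM|exact: ltnW|exact: ltn_trans (ltnW j2) iM].
  by rewrite /= odd_double uphalf_double doubleK.
by rewrite /sample /= /mhpoint st sW.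
Qed.

Lemma mhrun_walk s : @run R d _ mhalg f rho (diag s) =
  N%:R^-1 * \sum_(k < N) f (W s (n0 + k)).
Proof.
congr (_ * _); apply: eq_bigr => k _.
by rewrite nth_answers1 ?even_lt// mhsample_walk ?even_lt// odd_double doubleK.
Qed.

End run.

End metropolis_algorithm.

(** * Moments, error and cost *)

Section target_moments.
Context (R : realType) (d : nat) (r L : R) (rho : d.-tuple R -> R).
Hypotheses (r0 : 0 < r) (L0 : 0 <= L) (rhoP : RL L (@eball R d r) rho).
Local Notation D := (@eball R d r).
Local Notation E f := (\int[lebesgue R d]_(y in D) (f y)).
Local Notation w := (@rho0 R d r rho).
Local Notation Z := (E w).

Let mD := @measurable_eball R d r.
Let finD := @lebesgue_eball_fin R d r r0.
Let bw : bmf w := bmf_rho0 r0 L0 rhoP.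
Let w_ge0 x : 0 <= w x. Proof. exact: (rho0_ge0 rhoP x). Qed.
Let Z0 : 0 < Z := rho0_mass_gt0 r0 L0 rhoP.

Definition target_pdf (x : d.-tuple R) : R := Z^-1 * w x.

Let mpdf : measurable_fun setT target_pdf.
Proof. by apply: measurable_funM; [exact: measurable_cst|exact: bmf_measurable]. Qed.

Let pdf_ge0 x : 0 <= target_pdf x.
Proof. by rewrite mulr_ge0// invr_ge0 ltW. Qed.

Lemma integral_rho0 (h : d.-tuple R -> \bar R) :
  (\int[lebesgue R d]_x (h x * (w x)%:E) = \int[lebesgue R d]_(x in D) (h x * (w x)%:E))%E.
Proof.
rewrite [RHS]integral_mkcond; apply: eq_integral => x _; rewrite patchE.
by case: ifPn => //; rewrite notin_setE => Dx; rewrite rho0N// mule0.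
Qed.

Lemma integral_target_pdf (h : d.-tuple R -> \bar R) : measurable_fun setT h ->
  (forall x, 0 <= h x)%E ->
  (\int[lebesgue R d]_x (h x * (target_pdf x)%:E) =
   (Z^-1)%:E * \int[lebesgue R d]_(x in D) (h x * (w x)%:E))%E.
Proof.
move=> mh h0; rewrite -integral_rho0 -ge0_integralZl_EFin//.
- by apply: eq_integral => x _; rewrite EFinM muleCA.
- by move=> x _; rewrite mule_ge0// lee_fin.
- by apply: emeasurable_funM => //; apply/measurable_EFinP; exact: bmf_measurable.
- by rewrite invr_ge0 ltW.
Qed.

Let pdf1 : (\int[lebesgue R d]_x (target_pdf x)%:E = 1)%E.
Proof.
transitivity (\int[lebesgue R d]_x (1 * (target_pdf x)%:E))%E.
  by apply: eq_integral => x _; rewrite mul1e.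
rewrite integral_target_pdf//.
under eq_integral => x _ do rewrite mul1e.
by rewrite -EFin_bmf_integral// -EFinM mulVf// gt_eqF.
Qed.

Lemma integral_pi_measure (h : d.-tuple R -> \bar R) : measurable_fun setT h ->
  (forall x, 0 <= h x)%E ->
  (\int[pi_measure rhoP]_x h x =
   (Z^-1)%:E * \int[lebesgue R d]_(x in D) (h x * (w x)%:E))%E.
Proof.
move=> mh h0; rewrite -integral_target_pdf//.
rewrite -(integral_density_prob mpdf pdf_ge0 pdf1)//.
apply: eq_measure_integral => A mA _; rewrite /= /pi_measure /density_prob.
have -> : \int[lebesgue R d]_(x in D) rho x = Z.
  by apply: bint_eq => x Dx; rewrite rho0E.
have -> : (\int[lebesgue R d]_(x in A `&` D) (rho x)%:E = \int[lebesgue R d]_(x in A) (w x)%:E)%E.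
  rewrite integral_mkcondr; apply: eq_integral => x _.
  by rewrite /rho0 !patchE; case: ifP.
rewrite muleC -ge0_integralZl_EFin//.
- by move=> x _; rewrite lee_fin.
- by apply/measurable_EFinP; apply: measurable_funTS; exact: bmf_measurable.
- by rewrite invr_ge0 ltW.
Qed.

Lemma pi_measureT : pi_measure rhoP setT = 1%E.
Proof.
rewrite -[LHS]mul1e -(@integral_cst _ _ _ (pi_measure rhoP))//.
rewrite integral_pi_measure// -(integral_target_pdf (measurable_cst _))//.
by under eq_integral => x _ do rewrite mul1e.
Qed.

(** Orders above 4 are reduced to 4. There the exponent conjugate to p / 2 is 2, and the L_2 decay
    of the bias enters without interpolation. *)
Definition moment_exp (p : \bar R) : R := if (p < 4%:E)%E then fine p else 4.

Lemma moment_exp_gt2 p : (2%:E < p)%E -> 2 < moment_exp p.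
Proof.
rewrite /moment_exp; case: p => [s| |//].
  by rewrite lte_fin => s2; case: ifP => // _; rewrite ltr_nat.
by move=> _; rewrite [(+oo < _)%E]ltNge leey/= ltr_nat.
Qed.

Lemma moment_exp_le4 p : (2%:E < p)%E -> moment_exp p <= 4.
Proof.
rewrite /moment_exp; case: ifP => // + _.
by case: p => //= s; rewrite lte_fin => /ltW.
Qed.

(** Norms on a probability space increase with the order: for finite p >= 4 this is [powR_le_convex]
    integrated, for p infinite the bound |f| <= 1 almost everywhere. The integral is an extended
    real because [f] may be unbounded. *)
Lemma target_moment (p : \bar R) (f : d.-tuple R -> R) : (2%:E < p)%E ->
  measurable_fun D f -> ('N[pi_measure rhoP]_p[EFin \o (f \_ D)] <= 1)%E ->
  (\int[lebesgue R d]_(x in D) (`|f x| `^ moment_exp p * w x)%:E <= Z%:E)%E.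
Proof.
move=> p2 mf; set F := f \_ D.
have mF : measurable_fun setT F by exact: (measurable_restrictT f mD).1.
have mFp (s : R) : measurable_fun setT (fun x => (`|F x| `^ s)%:E).
  apply/measurable_EFinP; apply: (measurableT_comp (measurable_powR s)).
  exact: measurableT_comp.
have Fp0 (s : R) x : (0 <= (`|F x| `^ s)%:E)%E by rewrite lee_fin powR_ge0.
suff key : ('N[pi_measure rhoP]_p[EFin \o F] <= 1 ->
    \int[pi_measure rhoP]_x (`|F x| `^ moment_exp p)%:E <= 1)%E.
  move=> /key; rewrite integral_pi_measure// => h.
  have := lee_wpmul2l (_ : (0 <= Z%:E)%E) h.
  rewrite lee_fin muleA -EFinM mulfV ?gt_eqF// mul1e mule1 => /(_ (ltW Z0)).
  apply: le_trans; rewrite le_eqVlt; apply/orP; left; apply/eqP.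
  by apply: eq_integral => x /[!inE] Dx; rewrite -EFinM /F patchE mem_set.
have real_case (s : R) : 0 < s -> ('N[pi_measure rhoP]_s%:E[EFin \o F] <= 1)%E ->
    (\int[pi_measure rhoP]_x (`|F x| `^ s)%:E <= 1)%E.
  move=> s0 h; have := @poweR_Lnorm _ _ R (pi_measure rhoP) (EFin \o F) s.
  rewrite gt_eqF// => /(_ isT) <-.
  rewrite -(poweR1r s); apply: gt0_ler_poweR => //; first exact: ltW.
  - by rewrite in_itv/= leey Lnorm_ge0.
  - by rewrite in_itv/= leey lee01.
have cstE (c : R) : (\int[pi_measure rhoP]_x c%:E = c%:E)%E.
  by rewrite integral_cst// -[RHS]mule1; congr (_ * _)%E; exact: pi_measureT.
have pi1 : (\int[pi_measure rhoP]_x 1 = 1)%E by exact: cstE.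
have piT0 : (0 < pi_measure rhoP setT)%E by rewrite pi_measureT lte01.
case: p p2 => [s s2|_ h|//].
- rewrite /moment_exp lte_fin; case: ifPn => [s4|]; first exact: (real_case s (lt_trans (ltr0n _ 2) s2)).
  rewrite -leNgt => s4 h.
  have s0 : 0 < s by apply: lt_le_trans s4.
  have c0 : 0 <= 4 / s by rewrite divr_ge0// ltW.
  have c1 : 0 <= 1 - 4 / s by rewrite subr_ge0 ler_pdivrMr// mul1r.
  apply: (@le_trans _ _ (\int[pi_measure rhoP]_x ((4 / s)%:E * (`|F x| `^ s)%:E + (1 - 4 / s)%:E))%E).
    apply: ge0_le_integral => //.
    + by apply: emeasurable_funD; [exact: measurable_funeM|exact: measurable_cst].
    + by move=> x _; rewrite -EFinM -EFinD lee_fin; exact: powR_le_convex.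
  rewrite ge0_integralD//; last 2 first.
  + by move=> x _; rewrite mule_ge0 ?lee_fin ?powR_ge0.
  + exact: measurable_funeM.
  rewrite ge0_integralZl_EFin// cstE.
  have := lee_wpmul2l (_ : (0 <= (4 / s)%:E)%E) (real_case s s0 h).
  rewrite lee_fin => /(_ c0) h2; apply: (le_trans (leeD2r _ h2)).
  by rewrite mule1 -EFinD addrC subrK.
- rewrite /moment_exp /=; move: h; rewrite unlock ifT; last exact: piT0.
  move=> /ess_sup_inf.ess_supP h.
  rewrite -pi1; apply: ae_ge0_le_integral => //.
  apply: filterS h => x /=; rewrite !lee_fin => h _.
  apply: (@le_trans _ _ ((1 : R) `^ 4)); last by rewrite powR1.
  by apply: ge0_ler_powR; rewrite ?nnegrE.
Qed.

End target_moments.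

Section metropolis_error.
Context (R : realType) (d : nat) (r L : R) (rho : d.-tuple R -> R).
Hypotheses (r0 : 0 < r) (L0 : 0 <= L) (rhoP : RL L (@eball R d r) rho).
Local Notation D := (@eball R d r).
Local Notation E f := (\int[lebesgue R d]_(y in D) (f y)).
Local Notation w := (@rho0 R d r rho).
Local Notation Z := (E w).
Local Notation gap := (mhgap d r L).

Let mD := @measurable_eball R d r.
Let finD := @lebesgue_eball_fin R d r r0.
Let bw : bmf w := bmf_rho0 r0 L0 rhoP.
Let w_ge0 x : 0 <= w x. Proof. exact: (rho0_ge0 rhoP x). Qed.
Let Z0 : 0 < Z := rho0_mass_gt0 r0 L0 rhoP.
Let gap0 : 0 < gap := mhgap_gt0 d r L.

Variables (n0 N : nat) (p : R).
Hypotheses (N0 : (0 < N)%N) (p2 : 2 < p) (p4 : p <= 4).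
Hypothesis burn :
  mexp p * expR ((2 * (L * r) * (mexp p - 1) - gap * n0%:R) / mexp p) <= 1 / 4.
Local Notation seedP := (seed_prob d L r0 n0 N).
Local Notation seedT := (mhseed R d n0 N).

Definition mh_mean (f : d.-tuple R -> R) (s : seedT) : R :=
  N%:R^-1 * \sum_(k < N) f (walk r rho (clamp r s.1) (take (n0 + k) s.2)).

Lemma measurable_mh_mean f : measurable_fun setT f -> measurable_fun setT (mh_mean f).
Proof.
move=> mf; apply: measurable_funM; first exact: measurable_cst.
apply: measurable_sum => k; apply: (measurableT_comp mf).
apply: (measurable_walk r0 L0 rhoP); last exact: measurable_snd.
exact: (measurableT_comp (@measurable_clamp R d r) measurable_fst).
Qed.

Lemma measurable_mh_error f (S : R) : measurable_fun setT f ->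
  measurable_fun setT (fun s : seedT => ((S - mh_mean f s) ^+ 2)%:E).
Proof.
move=> mf; apply/measurable_EFinP; apply: measurable_funX; apply: measurable_funB.
  exact: measurable_cst.
exact: measurable_mh_mean.
Qed.

Lemma mh_mse_bounded f : bmf f -> E (fun x => `|f x| `^ p * w x) <= Z ->
  (\int[seedP]_s ((E (fun x => f x * w x) / Z - mh_mean f s) ^+ 2)%:E <=
   (9 / (gap * N%:R))%:E)%E.
Proof.
move=> bf fp; set S := E _ / Z.
have mf : measurable_fun setT f by exact: bmf_measurable.
have mE := measurable_mh_error S mf.
have Np : 0 < N%:R :> R by rewrite ltr0n.
pose phi x := f x - S.
have bphi : bmf phi by rewrite /phi; bmf_tac.
rewrite /seed_prob fubini_tonelli1//; last by move=> s; rewrite lee_fin sqr_ge0.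
set B := iter n0 (lazyP (lebesgue R d) D (mhq r L rho))
  (chain_sqr (lebesgue R d) D (mhq r L rho) phi N).
have bq := bmf_mhq r0 L0 rhoP.
have bB : bmf B.
  apply: (bmf_iter_lazyP mD finD bq); exact: (bmf_chain_sqr mD finD bq).
have BE y : D y -> (\int[iid (noise_prob d L r0) (n0 + N)]_v
    (walk_sum r rho phi n0 N y v ^+ 2)%:E = (B y)%:E)%E.
  by move=> Dy; exact: (walk_sum_sqr r0 L0 rhoP bphi).
have B0 y : D y -> 0 <= B y.
  move=> Dy; rewrite -lee_fin -BE//; apply: integral_ge0 => v _.
  by rewrite lee_fin sqr_ge0.
(* The identity for the chain holds for starting points in the ball, so the start stays clamped
   until it is integrated against the uniform density. *)
have inner x : (\int[iid (noise_prob d L r0) (n0 + N)]_v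
    ((S - mh_mean f (x, v)) ^+ 2)%:E = (N%:R^-1 ^+ 2 * B (clamp r x))%:E)%E.
  have Dc := clamp_eball r0 x.
  rewrite EFinM -BE// -ge0_integralZl_EFin//.
  - apply: eq_integral => v _; rewrite -EFinM; congr (_%:E).
    rewrite -exprMn -sqrrN; congr (_ ^+ 2).
    rewrite /mh_mean/= opprB /walk_sum /phi.
    rewrite sumrB sumr_const card_ord -[S *+ N]mulr_natl mulrBr mulrA mulVf ?mul1r//.
    by rewrite gt_eqF.
  - by move=> v _; rewrite lee_fin sqr_ge0.
  - apply/measurable_EFinP; apply: measurable_funX; apply: measurable_sum => k.
    apply: (measurableT_comp (bmf_measurable bphi)).
    by apply: (measurable_walk r0 L0 rhoP); [exact: measurable_cst|exact: measurable_id].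
rewrite (eq_integral (fun x => (N%:R^-1 ^+ 2 * B (clamp r x))%:E)); last first.
  by move=> x _; exact: inner.
have mBc : measurable_fun setT (fun x => (N%:R^-1 ^+ 2 * B (clamp r x))%:E).
  apply/measurable_EFinP; apply: measurable_funM; first exact: measurable_cst.
  exact: (measurableT_comp (bmf_measurable bB) (@measurable_clamp R d r)).
rewrite integral_density_prob//; last first.
  by move=> x; rewrite lee_fin mulr_ge0 ?sqr_ge0// B0//; exact: clamp_eball.
set V := fine (lebesgue R d D).
have V0 : 0 < V by exact: (volume_eball_gt0 d L r0).
have bc : bmf (fun x => (N%:R^-1 ^+ 2 * V^-1) * B x) by bmf_tac.
have -> : (\int[lebesgue R d]_x ((N%:R^-1 ^+ 2 * B (clamp r x))%:E * (start_pdf r x)%:E) =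
    (N%:R^-1 ^+ 2 * V^-1 * E B)%:E)%E.
  rewrite -(bintZl mD finD _ bB) EFin_bmf_integral// [RHS]integral_mkcond.
  apply: eq_integral => x _; rewrite patchE /start_pdf indicE.
  case: ifPn => xD; last by rewrite mulr0 mule0.
  rewrite mulr1 -EFinM; congr (_%:E); move: xD; rewrite inE => Dx.
  by rewrite /clamp (Dx : enorm x <= r); ring.
rewrite lee_fin.
have := metropolis_mse r0 L0 rhoP N p2 p4 bf fp burn; rewrite -/B -/V => h.
have c0 : 0 <= N%:R^-1 ^+ 2 * V^-1 by rewrite mulr_ge0 ?sqr_ge0// invr_ge0 ltW.
apply: (le_trans (ler_wpM2l c0 h)); rewrite le_eqVlt; apply/orP; left; apply/eqP.
by field; rewrite !gt_eqF.
Qed.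

(* Truncation of [f] and Fatou's lemma. *)
Section unbounded.
Variable f : d.-tuple R -> R.
Hypotheses (mf : measurable_fun D f)
  (fp : (\int[lebesgue R d]_(x in D) (`|f x| `^ p * w x)%:E <= Z%:E)%E).

Let F := f \_ D.

Let mF : measurable_fun setT F.
Proof. exact: (measurable_restrictT f mD).1. Qed.

Let FE x : D x -> F x = f x.
Proof. by move=> Dx; rewrite /F patchE mem_set. Qed.

Let clip (j : nat) x := Num.max (- j%:R) (Num.min j%:R (F x)).

Let bclip j : bmf (clip j).
Proof.
split.
  apply: measurable_maxr; first exact: measurable_cst.
  by apply: measurable_minr => //; exact: measurable_cst.
exists j%:R => x; rewrite ler_norml le_max lexx/= ge_max ge_min lexx/= andbT.
by rewrite lerN2 in_itv || apply: (@le_trans _ _ 0); rewrite ?oppr_le0.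
Qed.

Let clip_le j x : `|clip j x| <= `|F x|.
Proof.
have j0 : 0 <= j%:R :> R by [].
rewrite /clip maxElt minElt; case: (ltP j%:R (F x)) => h1; case: ltP => h2;
  rewrite ?normrN ?(ger0_norm j0)//.
- by rewrite ger0_norm; [exact: ltW|exact: le_trans j0 (ltW h1)].
- by rewrite (le_trans _ (ler_norm _))// ltW.
- have : F x <= 0 by apply: (le_trans h2); rewrite oppr_le0.
  by move=> F0; rewrite ler0_norm// lerNr.
Qed.

Let clip_near x : \forall j \near \oo, clip j x = F x.
Proof.
near=> j; have : `|F x| <= j%:R by near: j; exact: nbhs_infty_ger.
by rewrite ler_norml => /andP[h1 h2]; rewrite /clip min_r// max_r.
Unshelve. all: end_near. Qed.

Let clip_moment j : E (fun x => `|clip j x| `^ p * w x) <= Z.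
Proof.
have p0 : 0 <= p by apply: ltW; exact: lt_trans p2.
have b1 : bmf (fun x => `|clip j x| `^ p * w x).
  by apply: bmfM => //; exact: bmf_powR.
rewrite -lee_fin (EFin_bmf_integral mD finD b1); apply: le_trans fp.
have mp : measurable_fun D (fun x => (`|f x| `^ p * w x)%:E).
  apply/measurable_EFinP; apply: measurable_funM.
    apply: (measurableT_comp (measurable_powR p)); exact: measurableT_comp.
  by apply: measurable_funTS; exact: bmf_measurable.
apply: ge0_le_integral => //.
- by move=> x _; rewrite lee_fin mulr_ge0// powR_ge0.
- by apply/measurable_EFinP; apply: measurable_funTS; exact: bmf_measurable.
- move=> x Dx; rewrite lee_fin; apply: ler_wpM2r => //.
  by rewrite -FE//; apply: ge0_ler_powR; rewrite ?nnegrE.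
Qed.

Let integrable_F : (lebesgue R d).-integrable D (fun x => (`|F x| * w x)%:E).
Proof.
have p0 : 0 < p by exact: lt_trans p2.
have mFw : measurable_fun D (fun x => (`|F x| * w x)%:E).
  apply/measurable_EFinP; apply: measurable_funTS; apply: measurable_funM.
    exact: measurableT_comp.
  exact: bmf_measurable.
apply/integrableP; split => //.
have mp : measurable_fun D (fun x => (`|F x| `^ p * w x)%:E).
  apply/measurable_EFinP; apply: measurable_funTS; apply: measurable_funM.
    apply: (measurableT_comp (measurable_powR p)); exact: measurableT_comp.
  exact: bmf_measurable.
have mw : measurable_fun D (fun x => (w x)%:E).
  by apply/measurable_EFinP; apply: measurable_funTS; exact: bmf_measurable.
apply: (@le_lt_trans _ _ (\int[lebesgue R d]_(x in D) ((`|F x| `^ p * w x)%:E + (w x)%:E))%E).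
  apply: ge0_le_integral => //.
  - exact: measurableT_comp.
  - exact: emeasurable_funD.
  - move=> x Dx; rewrite /= ger0_norm ?mulr_ge0// -EFinD lee_fin.
    rewrite -[X in _ + X]mul1r -mulrDl; apply: ler_wpM2r => //.
    have p1 : 1 <= p by apply: ltW; apply: lt_trans p2; rewrite ltr1n.
    have := @powR_le_convex R p (F x) 1 ltr01 p1; rewrite powRr1// => /le_trans; apply.
    have i0 : 0 <= 1 / p by rewrite divr_ge0// ltW.
    have i1 : 1 / p <= 1 by rewrite ler_pdivrMr// mul1r.
    have i2 := ler_wpM2r (powR_ge0 `|F x| p) i1; rewrite [X in _ <= X]mul1r in i2.
    have alg (a b : R) : 0 <= a -> a * b <= b -> a * b + (1 - a) <= b + 1 by lra.
    exact: alg.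
rewrite ge0_integralD//; last 2 first.
- by move=> x _; rewrite lee_fin mulr_ge0// powR_ge0.
- by move=> x _; rewrite lee_fin.
rewrite -EFin_bmf_integral//; apply: lte_add_pinfty; last exact: ltry.
apply: (le_lt_trans _ (ltry Z)); apply: le_trans fp.
by rewrite le_eqVlt; apply/orP; left; apply/eqP; apply: eq_integral => x /[!inE] Dx; rewrite FE.
Qed.

Let mean_cvg : E (fun x => clip j x * w x) / Z @[j --> \oo] --> E (fun x => F x * w x) / Z.
Proof.
apply: cvgM; last exact: cvg_cst.
have dom : (\int[lebesgue R d]_(x in D) (clip j x * w x)%:E)%E @[j --> \oo] -->
    (\int[lebesgue R d]_(x in D) (F x * w x)%:E)%E.
  apply: (@dominated_cvg _ _ _ _ _ mD _ _ (fun x => (`|F x| * w x)%:E)) => //.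
  - move=> j; apply/measurable_EFinP; apply: measurable_funTS; apply: bmf_measurable.
    exact: bmfM.
  - move=> x _; apply: cvg_near_cst; apply: filterS (clip_near x) => j ->.
    by [].
  - move=> j x _; rewrite /= lee_fin normrM [X in _ * X]ger0_norm//.
    by apply: ler_wpM2r.
have fin : (\int[lebesgue R d]_(x in D) (F x * w x)%:E)%E \is a fin_num.
  apply: integrable_fin_num => //; apply: le_integrable integrable_F => //.
    apply/measurable_EFinP; apply: measurable_funTS; apply: measurable_funM => //.
    exact: bmf_measurable.
  by move=> x _; rewrite /= lee_fin !normrM normr_id.
by apply: fine_cvg; rewrite fineK.
Qed.

Lemma mh_mse : (\int[seedP]_s ((Sint r f rho - mh_mean f s) ^+ 2)%:E <=
   (9 / (gap * N%:R))%:E)%E.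
Proof.
pose Sj j := E (fun x => clip j x * w x) / Z.
pose g j s := ((Sj j - mh_mean (clip j) s) ^+ 2)%:E.
(* A run visits finitely many points, so a high enough truncation level leaves its mean
   unchanged. *)
have mean_near s : \forall j \near \oo, mh_mean (clip j) s = mh_mean F s.
  have near_all : \forall j \near \oo, forall k : 'I_N,
      clip j (walk r rho (clamp r s.1) (take (n0 + k) s.2)) =
      F (walk r rho (clamp r s.1) (take (n0 + k) s.2)).
    by apply: filter_forall => k; exact: clip_near.
  apply: filterS near_all => j h; rewrite /mh_mean; congr (_ * _).
  by apply: eq_bigr => k _; rewrite h.
have meanE s : mh_mean F s = mh_mean f s.
  congr (_ * _); apply: eq_bigr => k _; rewrite FE//.
  by apply: walk_eball; exact: clamp_eball.
have SE : Sint r f rho = E (fun x => F x * w x) / Z.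
  congr (_ / _); apply: bint_eq => x Dx; rewrite ?FE// rho0E//.
have gcvg s : g j s @[j --> \oo] --> ((Sint r f rho - mh_mean f s) ^+ 2)%:E.
  apply: cvg_EFin; first exact: nearW.
  have hc : Sj j - mh_mean (clip j) s @[j --> \oo] --> Sint r f rho - mh_mean f s.
    rewrite SE -meanE; apply: cvgB; first exact: mean_cvg.
    by apply: cvg_near_cst; exact: mean_near.
  exact: (cvgM hc hc).
rewrite (eq_integral (fun s => limn_einf (fun j => g j s))); last first.
  move=> s _; rewrite is_cvg_limn_einfE; last by apply/cvg_ex; eexists; exact: gcvg.
  by apply/esym/cvg_lim => //; exact: gcvg.
have mg j : measurable_fun setT (g j).
  by apply: measurable_mh_error; exact: bmf_measurable.
have g0 j s : setT s -> (0 <= g j s)%E by move=> _; rewrite lee_fin sqr_ge0.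
apply: (le_trans (fatou seedP measurableT mg g0)).
rewrite limn_einf_lim; apply: lime_le; first exact: is_cvg_einfs.
apply: nearW => j; rewrite /einfs /=.
apply: (@le_trans _ _ (\int[seedP]_s g j s)%E).
  by apply: ereal_inf_lbound; exists j => //=.
exact: mh_mse_bounded.
Qed.

End unbounded.

Lemma mhalg_error (f : d.-tuple R -> R) : measurable_fun D f ->
  (\int[lebesgue R d]_(x in D) (`|f x| `^ p * w x)%:E <= Z%:E)%E ->
  (error r (mhalg d L r0 n0 N) f rho <= (9 / (gap * N%:R) )%:E `^ 2^-1)%E.
Proof.
move=> mf fp; rewrite /error; apply: gt0_ler_poweR; first by rewrite invr_ge0.
- rewrite in_itv/= leey andbT; apply: integral_ge0 => s _.
  by rewrite lee_fin sqr_ge0.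
- by rewrite in_itv/= leey andbT lee_fin divr_ge0// mulr_ge0// ltW.
have rho_pos x : D x -> 0 < rho x by move=> Dx; case: rhoP => + _ _; exact.
have mrho : measurable_fun D rho by exact: measurable_RL mD rhoP.
have mrun := measurable_mhrun (r0 := r0) (n0 := n0) (N := N) (L := L) mf mrho.
rewrite /= ge0_integral_distribution//.
- apply: le_trans (mh_mse mf fp); rewrite le_eqVlt; apply/orP; left; apply/eqP.
  apply: eq_integral => s _; congr (_%:E).
  rewrite real_normK ?num_real//; congr ((_ - _) ^+ 2).
  exact: mhrun_walk.
- apply/measurable_EFinP; apply: measurable_funX; apply: measurableT_comp => //.
  by apply: measurable_funB; first exact: measurable_cst.
Qed.

End metropolis_error.

(** * Burn-in length, run length and number of oracle calls *)

Section metropolis_cost.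
Context (R : realType) (d : nat) (r L : R).
Hypotheses (r0 : 0 < r) (L0 : 0 <= L).
Local Notation K := (dimK d r L).

Let K1 : 1 <= K := dimK_ge1 d r L.

(** The real n with q exp ((2 L r (q - 1) - gap n) / q) = 1/4, where 208 10^3 K is the inverse of
    the gap. *)
Definition burn_cost (q : R) : R :=
  208 * 10 ^+ 3 * K * (2 * (L * r) * (q - 1) + q * ln (4 * q)).

Definition burn_steps (q : R) : nat := (Num.truncn (burn_cost q)).+1.

(** The real N with 9 / (gap N) = eps^2. *)
Definition run_cost (eps : R) : R := 9 * (208 * 10 ^+ 3) * K * eps ^- 2.

Definition run_steps (eps : R) : nat := (Num.truncn (run_cost eps)).+1.

Lemma burn_stepsP (q : R) : 2 <= q ->
  q * expR ((2 * (L * r) * (q - 1) - mhgap d r L * (burn_steps q)%:R) / q) <= 1 / 4.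
Proof.
move=> q2; have q0 : 0 < q by lra.
have q4 : 0 < 4 * q by rewrite mulr_gt0.
have K0 : 0 < 208 * 10 ^+ 3 * K by exact: mhgapV_gt0.
have h : burn_cost q <= (burn_steps q)%:R by apply: ltW; exact: Num.Theory.truncnS_gt.
have g0 := mhgap_gt0 d r L.
have gE : mhgap d r L * burn_cost q = 2 * (L * r) * (q - 1) + q * ln (4 * q).
  by rewrite /burn_cost /mhgap mulrA mulVf ?mul1r// gt_eqF.
have h2 := ler_wpM2l (ltW g0) h; rewrite gE in h2.
apply: (@le_trans _ _ (q * expR (- ln (4 * q)))).
  apply: ler_wpM2l; first exact: ltW.
  rewrite ler_expR ler_pdivrMr//; move: h2; move: (_ * (burn_steps q)%:R) (ln _) => a b; lra.
rewrite expRN lnK ?posrE// le_eqVlt; apply/orP; left; apply/eqP.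
by field; rewrite gt_eqF.
Qed.

Lemma run_steps_error (eps : R) : 0 < eps ->
  ((9 / (mhgap d r L * (run_steps eps)%:R))%:E `^ 2^-1 <= eps%:E)%E.
Proof.
move=> e0.
have K0 : 0 < 208 * 10 ^+ 3 * K by exact: mhgapV_gt0.
have N0 : 0 < (run_steps eps)%:R :> R by rewrite ltr0n.
have g0 := mhgap_gt0 d r L.
have le : 9 / (mhgap d r L * (run_steps eps)%:R) <= eps ^+ 2.
  rewrite ler_pdivrMr ?mulr_gt0//.
  have h : run_cost eps <= (run_steps eps)%:R by apply: ltW; exact: Num.Theory.truncnS_gt.
  have c0 : 0 <= eps ^+ 2 * mhgap d r L by rewrite mulr_ge0 ?sqr_ge0// ltW.
  apply: le_trans (_ : eps ^+ 2 * mhgap d r L * run_cost eps <= _); last first.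
    by rewrite [leRHS]mulrA; apply: ler_wpM2l.
  rewrite le_eqVlt; apply/orP; left; apply/eqP.
  rewrite /mhgap /run_cost; move: K0; move: (208 * 10 ^+ 3) => c K0.
  have c1 : c != 0 by apply/eqP => c1; move: K0; rewrite c1 mul0r ltxx.
  have K2 : K != 0 by apply/eqP => K2; move: K0; rewrite K2 mulr0 ltxx.
  by field; rewrite c1 K2 gt_eqF.
rewrite poweR_EFin lee_fin powR12_sqrt; last by rewrite divr_ge0// mulr_ge0// ltW.
rewrite -[leRHS]ger0_norm; last exact: ltW.
by rewrite -sqrtr_sqr ler_sqrt// sqr_ge0.
Qed.

(** Rounding each of the two lengths up adds at most 1, and every step makes two calls: this is the
    4. *)
Lemma query_count_le (eps q : R) : 0 < eps -> 2 <= q ->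
  ((burn_steps q + run_steps eps).*2)%:R <=
  2 * run_cost eps + 2 * burn_cost q + 4.
Proof.
move=> e0 q2.
have c0 : 0 <= 208 * 10 ^+ 3 * K by apply: ltW; exact: mhgapV_gt0.
have b0 : 0 <= burn_cost q.
  apply: mulr_ge0 => //; apply: addr_ge0.
    by rewrite mulr_ge0 ?mulr_ge0 ?(ltW r0)// subr_ge0; lra.
  by rewrite mulr_ge0 ?ln_ge0//; lra.
have u0 : 0 <= run_cost eps.
  apply: mulr_ge0; last by rewrite invr_ge0 sqr_ge0.
  by rewrite -mulrA; apply: mulr_ge0.
have := Num.Theory.truncn_le (burn_cost q); rewrite b0 => h1.
have := Num.Theory.truncn_le (run_cost eps); rewrite u0 => h2.
rewrite -addnn natrD natrD /burn_steps /run_steps -!natr1.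
move: h1 h2; move: (Num.truncn _)%:R (Num.truncn _)%:R => a b; lra.
Qed.

Lemma query_bound_lt4 (eps q : R) : 0 < eps < 1 -> 2 <= q ->
  2 * run_cost eps + 2 * burn_cost q + 4 <=
  K * (48 / 10 * 10 ^+ 6 * eps ^- 2 +
    12 / 10 * 10 ^+ 6 * (q * (L * r + 5 / 10 * ln (32 * q)))).
Proof.
move=> /andP[e0 e1] q2.
have K0 : 0 <= K := le_trans ler01 K1.
have e2 : 1 <= eps ^- 2.
  by rewrite invf_ge1 ?exprn_gt0//; apply: exprn_ile1 => //; exact: ltW.
have Ke : 1 <= K * eps ^- 2 by have := ler_pM ler01 ler01 K1 e2; rewrite mulr1.
have l4 : 0 <= ln (4 * q) by rewrite ln_ge0; lra.
have l32 : ln (4 * q) <= ln (32 * q).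
  by rewrite ler_ln ?posrE ?mulr_gt0//; lra.
have a0 : 0 <= L * r by rewrite mulr_ge0// ltW.
rewrite /run_cost /burn_cost.
set e := eps ^- 2 in e2 Ke *; set a := L * r in a0 *.
set x := ln (4 * q) in l4 l32 *; set y := ln (32 * q) in l32 *.
have q0 : 0 <= q by lra.
have k1 : 0 <= K * (q * a) by apply: mulr_ge0 => //; exact: mulr_ge0.
have k2 : 0 <= K * (q * x) by apply: mulr_ge0 => //; exact: mulr_ge0.
have k3 : K * (q * x) <= K * (q * y) by apply: ler_wpM2l => //; exact: ler_wpM2l.
have k4 : 0 <= K * a by exact: mulr_ge0.
move: k1 k2 k3 k4 Ke; move: K K0 K1 => k; lra.
Qed.

(** With q = 2 the logarithm is ln 8 = 3 ln 2, and the crude bound ln 2 <= 1 suffices: 4 * 208000 *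
    3 = 2496000 is below 4.16 * 1200000. *)
Lemma query_bound_ge4 (eps : R) : 0 < eps < 1 ->
  2 * run_cost eps + 2 * burn_cost 2 + 4 <=
  K * (48 / 10 * 10 ^+ 6 * eps ^- 2 +
    12 / 10 * 10 ^+ 6 * (2 * L * r + 416 / 100)).
Proof.
move=> /andP[e0 e1].
have K0 : 0 <= K := le_trans ler01 K1.
have e2 : 1 <= eps ^- 2.
  by rewrite invf_ge1 ?exprn_gt0//; apply: exprn_ile1 => //; exact: ltW.
have Ke : 1 <= K * eps ^- 2 by have := ler_pM ler01 ler01 K1 e2; rewrite mulr1.
have l8 : ln (4 * 2 : R) <= 3.
  have -> : 4 * 2 = 2 ^+ 3 :> R by ring.
  rewrite lnXn ?ltr0n//.
  have := @le_ln1Dx R 1; rewrite (_ : 1 + 1 = 2); last by ring.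
  move=> h; have : ln 2 <= 1 :> R by apply: h; lra.
  lra.
have a0 : 0 <= L * r by rewrite mulr_ge0// ltW.
rewrite /run_cost /burn_cost -(mulrA 2 L r).
set e := eps ^- 2 in e2 Ke *; set a := L * r in a0 *.
set x := ln (4 * 2) in l8 *.
have k3 : K * x <= K * 3 by apply: ler_wpM2l.
have k4 : 0 <= K * a by exact: mulr_ge0.
move: k3 k4 Ke; move: K K0 K1 => k; lra.
Qed.

End metropolis_cost.

Lemma mhalg_Alg (R : realType) (d : nat) (r L : R) (r0 : 0 < r) (p : \bar R) n0 N :
  Alg r (F_class L p r) (mhalg d L r0 n0 N).
Proof.
split=> [i a b s|f rho [rhoP [mf _]]]; first exact: mhpoint_eball.
have mrho : measurable_fun (eball r) rho.
  exact: measurable_RL (@measurable_eball R d r) rhoP.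
split=> [i iN|]; first exact: measurable_mhsample.
exact: measurable_mhrun.
Qed.

Theorem theorem4p9 (R : realType) (r L : R) (p : \bar R)
    (hr : 0 < r) (hL : 0 <= L) (hp : (2%:E < p)%E)
    (eps : R) (heps : 0 < eps < 1) (d : nat) :
  (complexity eps r (@F_class R d L p r) <=
   ((d%:R + 1) * Num.max (r ^+ 2 * L ^+ 2) (d%:R + 1) *
    ((48 / 10) * 10 ^+ 6 * eps ^- 2 +
     (12 / 10) * 10 ^+ 6 *
       (if (p < 4%:E)%E then
          fine p / (fine p - 2) *
            (L * r + (5 / 10) * ln (32 * fine p / (fine p - 2)))
        else 2 * L * r + 416 / 100)))%R%:E)%E.
Proof.
have /andP[e0 e1] := heps.
pose q := mexp (moment_exp p).
have s2 := moment_exp_gt2 hp; have s4 := moment_exp_le4 hp.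
have q2 : 2 <= q by exact: mexp_ge2.
pose n0 := burn_steps d r L q; pose N := run_steps d r L eps.
apply: (@le_trans _ _ (((n0 + N).*2)%:R%:E)).
  apply: ereal_inf_lbound; exists (n0 + N).*2 => //=.
  exists (mhalg d L hr n0 N); split; first exact: mhalg_Alg.
  apply: ge_ereal_sup => _ [[f rho] [rhoP [mf fp]] <-].
  have fm := target_moment hr hL hp mf fp.
  apply: (le_trans (mhalg_error hr hL rhoP (ltn0Sn _) s2 s4 _ mf fm)).
    exact: burn_stepsP.
  exact: run_steps_error.
rewrite lee_fin; have hc := query_count_le d hr hL e0 q2.
apply: le_trans hc _.
rewrite -/(dimK d r L) /q /moment_exp; case: ifPn => p4.
  have q2' : 2 <= mexp (fine p) by move: q2; rewrite /q /moment_exp p4.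
  by have := query_bound_lt4 d hr hL heps q2'; rewrite /mexp [32 * (_ / _)]mulrA.
have -> : mexp (4 : R) = 2 by rewrite /mexp; field.
exact: query_bound_ge4.
Qed.
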